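(* Let $n,d$ be integers with $1\le n\le d-1$, and let $\mu$ be an $n$-Ahlfors–David regular measure on $\mathbb{R}^d$. If $\mu$ is $n$-uniformly rectifiable, then there is a constant $C>0$ such that for every ball $B$ centered on $\operatorname{spt}(\mu)$ with radius $r_B>0$, $$\int_B\int_0^{r_B}|C^n_\mu(x,t)|^2\,\frac{dt}{t}\,d\mu(x)\le C\,r_B^n .$$
   Context: For a Radon measure $\mu$ on $\mathbb{R}^d$, $x\in\mathbb{R}^d$ and $t>0$, $$C^n_\mu(x,t):=\frac{1}{t^n}\left|\int_{B(x,t)}\frac{x-y}{t}\,d\mu(y)\right| ,\qquad B(x,t)=\{y:|x-y|<t\}.$$ A Radon measure $\mu$ is $n$-Ahlfors–David regular ($n$-ADR) if there is $c\ge1$ with $c^{-1}r^n\le\mu(B(x,r))\le c\,r^n$ for all $x\in\operatorname{spt}(\mu)$ and $r>0$. An $n$-ADR measure $\mu$ is $n$-uniformly rectifiable if there are constants $\theta,M>0$ such that for all $x\in\operatorname{spt}(\mu)$ and $r>0$ there is a Lipschitz map $g:B^n(0,r)\subset\mathbb{R}^n\to\mathbb{R}^d$ with Lipschitz constant at most $M$ and $\mu\big(B(x,r)\cap g(B^n(0,r))\big)\ge\theta r^n$. *)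

(* Defs.v *)
From HB Require Import structures.
From mathcomp Require Import all_boot all_order all_algebra.
From mathcomp Require Import all_classical all_reals all_analysis.

Set Implicit Arguments.
Unset Strict Implicit.
Unset Printing Implicit Defensive.

Import Order.TTheory GRing.Theory Num.Theory.
Import numFieldNormedType.Exports.

Local Open Scope classical_set_scope.
Local Open Scope ring_scope.

(* R^d with its Borel sigma-algebra. The topology of 'rV[R]_d is the product
   topology, i.e. the usual one. *)
Notation borel_rV R d :=
  (g_sigma_algebraType (@open 'rV[R]_d)) (only parsing).

(* The library norm and balls on 'rV[R]_d are those of the sup norm, so the
   Euclidean ones are defined here. *)
Definition enorm (R : realType) (d : nat) (x : 'rV[R]_d) : R :=
  Num.sqrt (\sum_(i < d) x 0 i ^+ 2).

Definition eball (R : realType) (d : nat) (x : 'rV[R]_d) (r : R) :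
    set 'rV[R]_d :=
  [set y | enorm (x - y) < r].

Definition lipschitz_with (R : realType) (n d : nat) (M : R)
    (A : set 'rV[R]_n) (g : 'rV[R]_n -> 'rV[R]_d) : Prop :=
  forall y z, A y -> A z -> enorm (g y - g z) <= M * enorm (y - z).

Section measures.
Context (R : realType) (d : nat).
Implicit Types (mu : {measure set (borel_rV R d) -> \bar R}) (n : nat).

(* Countable additivity on Borel sets is part of the type of mu. *)
Definition radon mu : Prop :=
  [/\ forall K : set 'rV[R]_d, compact K -> (mu K < +oo)%E,
      forall A : set (borel_rV R d), measurable A ->
        mu A = ereal_inf [set mu U | U in
          [set U : set 'rV[R]_d | open U /\ A `<=` U]]
    & forall U : set 'rV[R]_d, open U ->
        mu U = ereal_sup [set mu K | K in
          [set K : set 'rV[R]_d | compact K /\ K `<=` U]]].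

Definition spt mu : set 'rV[R]_d :=
  [set x | forall U : set 'rV[R]_d, open U -> U x -> (0 < mu U)%E].

Definition ADR n mu : Prop :=
  radon mu /\
  exists2 c : R, 1 <= c &
    forall (x : 'rV[R]_d) (r : R), spt mu x -> 0 < r ->
      ((c^-1 * r ^+ n)%:E <= mu (eball x r) <= (c * r ^+ n)%:E)%E.

(* The map g is only constrained, and only used, on the ball B^n(0, r). *)
Definition uniformly_rectifiable n mu : Prop :=
  ADR n mu /\
  exists theta M : R, [/\ 0 < theta, 0 < M &
    forall (x : 'rV[R]_d) (r : R), spt mu x -> 0 < r ->
      exists2 g : 'rV[R]_n -> 'rV[R]_d, lipschitz_with M (eball 0 r) g &
        ((theta * r ^+ n)%:E <= mu (eball x r `&` g @` eball 0%R r))%E].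

(* The vector-valued integral is taken coordinatewise. *)
Definition Cn n mu (x : 'rV[R]_d) (t : R) : R :=
  (t ^+ n)^-1 *
  enorm (\row_(i < d) \int[mu]_(y in eball x t) ((t^-1 *: (x - y)) 0 i)).

End measures.

(* Main.v *)
(* The idea is to reduce the Carleson estimate to finite sums.  At scale eta = rB / 2 ^ B the
   measure becomes finitely many point masses, C^n becomes the sum c_t(x) of m_i (y_i - x)
   over |y_i - x| < t with integer t, and the square function a sum over dyadic blocks of t.

   A Lipschitz map of a lattice satisfies Dorronsoro's estimate, because parallelogram
   identities for its second differences telescope over the scales.  Where the map is close to
   an affine one, the c_t of a measure of constant density on its image nearly cancel by
   oddness.  A varying density is compared with its average over cubes: a second difference
   of the tent function splits into one difference falling on the kernel, which gains
   geometrically, and one falling on the density, whose energy telescopes.  This bounds the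
   square function on bi-Lipschitz images of lattice sets.  By a stopping time and a colouring
   of dyadic cubes (Jones), a Lipschitz image of large mass contains a bi-Lipschitz piece of
   large mass; hence every ball has a fixed proportion of points with bounded square
   function, and a good-lambda argument with a finite Vitali covering sums it up.

   Letting eta tend to 0 costs two applications of Fatou's lemma to step functions; no
   measurability of C^n is needed. *)
Require Import Defs.
From HB Require Import structures.
From mathcomp Require Import all_boot all_order all_algebra.
From mathcomp Require Import all_classical all_reals all_analysis.
From mathcomp Require Import finmap measurable_realfun measurable_fun_approximation.
From mathcomp Require Import zify ring lra.

Set Implicit Arguments.
Unset Strict Implicit.
Unset Printing Implicit Defensive.

Import Order.TTheory GRing.Theory Num.Theory.
Import numFieldNormedType.Exports.

Local Open Scope classical_set_scope.
Local Open Scope ring_scope.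

(** * Finite sums and the Euclidean norm *)

(** The obstacle that shapes the proof is the sharp cutoff in [C^n]: the truncated kernel jumps by
    [t] across the sphere of radius [t], so no estimate at a single [t] is stable when points are
    moved. A displacement [rho] carries a point across the sphere for at most [2 * rho + 1] of the
    [2 ^ k] integers [t] in a dyadic block. Summed over the block, the jump therefore costs no more
    than the displacement itself plus a constant. The comparisons below (an image with its tangent
    plane, a kernel with its translate, an atom with a smeared atom, one centre with another) are
    put in the form displacement plus jump and summed over a block of [t].

    All constants depend on [n], [d] and the regularity and rectifiability constants, never on the
    number of scales; this uniformity is what lets the mesh be refined. *)

Section finite_sums.
Context (R : realType).

Lemma ler_sum_inj (T1 T2 : eqType) (s1 : seq T1) (s2 : seq T2) (h : T1 -> T2)
    (F : T2 -> R) :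
  uniq s1 -> uniq s2 -> {in s1 &, injective h} ->
  {in s1, forall x, h x \in s2} -> (forall y, 0 <= F y) ->
  \sum_(x <- s1) F (h x) <= \sum_(y <- s2) F y.
Proof.
move=> u1 u2 hi hs F0; rewrite -(big_map h xpredT F).
have um : uniq (map h s1) by rewrite map_inj_in_uniq.
rewrite [leRHS](bigID (mem (map h s1))) /= -[X in _ <= X + _]big_filter.
rewrite (perm_big [seq y <- s2 | y \in map h s1]) ?lerDl ?sumr_ge0 //.
apply: uniq_perm; rewrite ?filter_uniq // => y; rewrite mem_filter.
case: (boolP (y \in map h s1)) => //= /mapP[x xs ->]; exact/esym/hs.
Qed.

Lemma eq_sum_inj (V : nmodType) (T1 T2 : eqType) (s1 : seq T1) (s2 : seq T2)
    (h : T1 -> T2) (F : T2 -> V) :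
  uniq s1 -> uniq s2 -> {in s1 &, injective h} ->
  (forall x, x \in s1 -> F (h x) != 0 -> h x \in s2) ->
  (forall y, y \in s2 -> F y != 0 -> exists2 x, x \in s1 & y = h x) ->
  \sum_(x <- s1) F (h x) = \sum_(y <- s2) F y.
Proof.
move=> u1 u2 hi h12 h21; rewrite -(big_map h xpredT F).
have um : uniq (map h s1) by rewrite map_inj_in_uniq.
have nz (s : seq T2) : \sum_(y <- s) F y = \sum_(y <- [seq y <- s | F y != 0]) F y.
  rewrite big_filter [RHS]big_mkcond /=; apply: eq_bigr => y _.
  by case: ifPn => //; rewrite negbK => /eqP.
rewrite (nz (map h s1)) (nz s2); apply: perm_big; apply: uniq_perm; rewrite ?filter_uniq //.
move=> y; rewrite !mem_filter; case: (boolP (F y != 0)) => //= Fy; apply/idP/idP.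
  by move=> /mapP[x xs yE]; rewrite yE; apply: h12 => //; rewrite -yE.
by move=> /h21 -/(_ Fy)[x xs ->]; apply: map_f.
Qed.

Lemma sum_const_seq (T : Type) (s : seq T) (c : R) :
  \sum_(x <- s) c = (size s)%:R * c.
Proof. by rewrite big_const_seq count_predT iter_addr_0 mulr_natl. Qed.

Lemma ler_sum_seq_in (T : eqType) (s : seq T) (F G : T -> R) :
  (forall x, x \in s -> F x <= G x) -> \sum_(x <- s) F x <= \sum_(x <- s) G x.
Proof.
move=> h; rewrite big_seq [leRHS]big_seq; apply: ler_sum => x; exact: h.
Qed.

Lemma sum_le_const (T : eqType) (s : seq T) (F : T -> R) (c : R) :
  (forall x, x \in s -> F x <= c) -> \sum_(x <- s) F x <= (size s)%:R * c.
Proof. by move=> h; rewrite -sum_const_seq; apply: ler_sum_seq_in. Qed.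

Lemma ler_sum_term (T : eqType) (s : seq T) (F : T -> R) (x : T) :
  x \in s -> (forall y, 0 <= F y) -> F x <= \sum_(y <- s) F y.
Proof.
move=> xs F0; rewrite (big_rem x) //= lerDl; exact: sumr_ge0.
Qed.

Lemma wcauchy_schwarz (T : Type) (s : seq T) (a b : T -> R) :
  (forall x, 0 <= a x) ->
  (\sum_(x <- s) a x * b x) ^+ 2 <=
  (\sum_(x <- s) a x) * (\sum_(x <- s) a x * b x ^+ 2).
Proof.
move=> a0; elim: s => [|x s IH]; first by rewrite !big_nil expr0n mul0r.
rewrite !big_cons.
set A := \sum_(_ <- _) a _ in IH *; set B := \sum_(_ <- _) _ * b _ in IH *.
set D := \sum_(_ <- _) _ in IH *.
have A0 : 0 <= A by apply: sumr_ge0.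
have D0 : 0 <= D by apply: sumr_ge0 => y _; rewrite mulr_ge0 ?sqr_ge0.
(* Expand [a y * (b y - b x) ^ 2 >= 0] and sum over the tail [s]. *)
have key : 2 * b x * B <= D + b x ^+ 2 * A.
  rewrite /D /B /A !mulr_sumr -big_split /=; apply: ler_sum => y _.
  have := mulr_ge0 (a0 y) (sqr_ge0 (b y - b x)); nra.
have ax := a0 x.
have := ler_wpM2l ax key; nra.
Qed.

Lemma sum_sqr_le (T : Type) (s : seq T) (b : T -> R) :
  (\sum_(x <- s) b x) ^+ 2 <= (size s)%:R * \sum_(x <- s) b x ^+ 2.
Proof.
have := @wcauchy_schwarz T s (fun=> 1) b (fun=> ler01).
rewrite sum_const_seq mulr1.
by under eq_bigr do rewrite mul1r; under [X in _ * X]eq_bigr do rewrite mul1r.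
Qed.

End finite_sums.

Section euclidean_norm.
Context (R : realType) (d : nat).
Implicit Types x y z : 'rV[R]_d.

Lemma enorm_ge0 x : 0 <= enorm x.
Proof. exact: sqrtr_ge0. Qed.

Lemma enorm_sqr x : enorm x ^+ 2 = \sum_(i < d) x 0 i ^+ 2.
Proof. by rewrite sqr_sqrtr // sumr_ge0 // => i _; rewrite sqr_ge0. Qed.

Lemma enorm0 : enorm (0 : 'rV[R]_d) = 0.
Proof.
by rewrite /enorm big1 ?sqrtr0 // => i _; rewrite mxE expr0n.
Qed.

Lemma enormN x : enorm (- x) = enorm x.
Proof.
by congr Num.sqrt; apply: eq_bigr => i _; rewrite mxE sqrrN.
Qed.

Lemma enormB x y : enorm (x - y) = enorm (y - x).
Proof. by rewrite -enormN opprB. Qed.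

Lemma enorm_coord x i : `|x 0 i| <= enorm x.
Proof.
rewrite -(@ler_pXn2r _ 2) ?nnegrE ?enorm_ge0 // enorm_sqr -normrX ger0_norm ?sqr_ge0 //.
by rewrite (bigD1 i) //= lerDl sumr_ge0 // => j _; rewrite sqr_ge0.
Qed.

Lemma enormZ (a : R) x : enorm (a *: x) = `|a| * enorm x.
Proof.
rewrite /enorm -sqrtr_sqr -sqrtrM ?sqr_ge0 // mulr_sumr.
by congr Num.sqrt; apply: eq_bigr => i _; rewrite mxE exprMn.
Qed.

Lemma dot_le_enorm x y : \sum_(i < d) x 0 i * y 0 i <= enorm x * enorm y.
Proof.
apply: le_trans (ler_norm _) _.
rewrite -(@ler_pXn2r _ 2) ?nnegrE ?mulr_ge0 ?enorm_ge0 // -normrX ger0_norm ?sqr_ge0 //.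
rewrite exprMn !enorm_sqr.
set A := \sum_(i < d) x 0 i ^+ 2; set B := \sum_(i < d) y 0 i ^+ 2.
set P := \sum_(i < d) x 0 i * y 0 i.
have key (s t : R) : 0 <= s ^+ 2 * A - 2 * s * t * P + t ^+ 2 * B.
  have -> : s ^+ 2 * A - 2 * s * t * P + t ^+ 2 * B =
      \sum_(i < d) (s * x 0 i - t * y 0 i) ^+ 2.
    rewrite /A /B /P !mulr_sumr -sumrN -!big_split /=.
    by apply: eq_bigr => i _; ring.
  by apply: sumr_ge0 => i _; rewrite sqr_ge0.
have A0 : 0 <= A by apply: sumr_ge0 => i _; rewrite sqr_ge0.
have B0 : 0 <= B by apply: sumr_ge0 => i _; rewrite sqr_ge0.
have [A1|/eqP An] := eqVneq A 0.
  (* When [A = 0] the form at [(B + 1, P)] equals [- (B + 2) * P ^ 2], which forces [P = 0]. *)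
  have := key (P) (P ^+ 2 + 0); have := key (B + 1) P; nra.
have Ap : 0 < A by rewrite lt_neqAle eq_sym A0 andbT; apply/eqP.
have := key P A; rewrite -subr_ge0.
have -> : P ^+ 2 * A - 2 * P * A * P + A ^+ 2 * B = A * (A * B - P ^+ 2) by ring.
by rewrite pmulr_rge0.
Qed.

Lemma enormD x y : enorm (x + y) <= enorm x + enorm y.
Proof.
rewrite -(@ler_pXn2r _ 2) ?nnegrE ?addr_ge0 ?enorm_ge0 //.
rewrite sqrrD !enorm_sqr.
have -> : \sum_(i < d) (x + y) 0 i ^+ 2 = \sum_(i < d) x 0 i ^+ 2 +
    (\sum_(i < d) x 0 i * y 0 i) *+ 2 + \sum_(i < d) y 0 i ^+ 2.
  rewrite -sumrMnl -!big_split /=; apply: eq_bigr => i _.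
  by rewrite mxE sqrrD.
rewrite lerD2r lerD2l lerMn2r; exact: dot_le_enorm.
Qed.

Lemma enorm_triangle z x y : enorm (x - y) <= enorm (x - z) + enorm (z - y).
Proof. by apply: le_trans (enormD _ _); rewrite addrA subrK. Qed.

Lemma enorm_lip x y : `|enorm x - enorm y| <= enorm (x - y).
Proof.
rewrite ler_norml; apply/andP; split.
  have := enormD (y - x) x; rewrite subrK (enormB y x); lra.
have := enormD (x - y) y; rewrite subrK; lra.
Qed.

Lemma enorm_sum (T : Type) (s : seq T) (F : T -> 'rV[R]_d) :
  enorm (\sum_(i <- s) F i) <= \sum_(i <- s) enorm (F i).
Proof.
elim: s => [|i s IH]; first by rewrite !big_nil enorm0.
rewrite !big_cons; apply: le_trans (enormD _ _) _; exact: lerD.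
Qed.

Lemma enorm_sqrD x y : enorm (x + y) ^+ 2 <= 2 * enorm x ^+ 2 + 2 * enorm y ^+ 2.
Proof.
have := enormD x y; have := enorm_ge0 (x + y).
have := enorm_ge0 x; have := enorm_ge0 y.
set a := enorm (x + y); set b := enorm x; set c := enorm y => c0 b0 a0 h.
have := sqr_ge0 (b - c); nra.
Qed.

Lemma enorm_sum_sqr (T : Type) (s : seq T) (F : T -> 'rV[R]_d) :
  enorm (\sum_(i <- s) F i) ^+ 2 <= (size s)%:R * \sum_(i <- s) enorm (F i) ^+ 2.
Proof.
apply: le_trans (sum_sqr_le _ _).
by rewrite lerXn2r ?nnegrE ?enorm_ge0 ?sumr_ge0 ?enorm_sum // => i _; rewrite enorm_ge0.
Qed.


End euclidean_norm.

Lemma intMn (x : int) (k : nat) : x *+ k = x * k%:Z.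
Proof. by rewrite -mulr_natr natz. Qed.

(** * The lattice *)

(* [mxE] leaves the entries at a type which [lia] does not recognize as [int]. *)
Section lattice_entries.
Context (n : nat).
Implicit Types (u v : 'rV[int]_n) (i : 'I_n).

Lemma z0E i : (0%R : 'rV[int]_n) 0%R i = 0.
Proof. exact: mxE. Qed.

Lemma zDE u v i : (u + v) 0%R i = (u 0%R i + v 0%R i)%R :> int.
Proof. exact: mxE. Qed.

Lemma zNE u i : (- u) 0%R i = (- u 0%R i)%R :> int.
Proof. exact: mxE. Qed.

Lemma zBE u v i : (u - v) 0%R i = (u 0%R i - v 0%R i)%R :> int.
Proof. by rewrite zDE zNE. Qed.

Lemma zMnE u (k : nat) i : (u *+ k) 0%R i = (u 0%R i * k%:Z)%R :> int.
Proof. by rewrite mulmxnE intMn. Qed.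

Lemma zmapE (T : Type) (f : T -> int) (A : 'rV[T]_n) i :
  (map_mx f A) 0%R i = (f (A 0%R i))%R :> int.
Proof. exact: mxE. Qed.

Lemma zrowE (F : 'I_n -> int) i : (\row_j F j) 0%R i = (F i)%R :> int.
Proof. exact: mxE. Qed.

Lemma zP u v : (forall i, u 0%R i = v 0%R i :> int) -> u = v.
Proof. by move=> h; apply/rowP. Qed.

End lattice_entries.

Definition zE := (zBE, zDE, zNE, zMnE, zmapE, zrowE, z0E).

Section lattice.
Context (n : nat).
Implicit Types (u v w : 'rV[int]_n) (r s : nat).

Definition znorm u : nat := (\max_(i < n) absz (u 0%R i))%N.

Lemma zn_coord u i : (absz (u 0%R i) <= znorm u)%N.
Proof. exact: (leq_bigmax_cond (F := fun i => absz (u 0%R i))). Qed.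

Lemma zn_leP u r : reflect (forall i, (absz (u 0%R i) <= r)%N) (znorm u <= r)%N.
Proof.
by apply: (iffP (bigmax_leqP _ _ _)) => [h i|h i _]; apply: h.
Qed.

Lemma zn0 : znorm 0 = 0%N.
Proof. by apply/eqP; rewrite -leqn0; apply/zn_leP => i; rewrite zE. Qed.

Lemma zn_eq0 u : (znorm u == 0)%N = (u == 0).
Proof.
apply/idP/eqP => [|->]; last by rewrite zn0.
rewrite -leqn0 => /zn_leP h; apply/rowP => i; rewrite zE.
by apply/eqP; rewrite -absz_eq0 -leqn0; apply: h.
Qed.

Lemma znN u : znorm (- u) = znorm u.
Proof. by apply: eq_bigr => i _; rewrite zE abszN. Qed.

Lemma znB u v : znorm (u - v) = znorm (v - u).
Proof. by rewrite -znN opprB. Qed.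

Lemma znD u v : (znorm (u + v) <= znorm u + znorm v)%N.
Proof.
apply/zn_leP => i; rewrite zE; have := zn_coord u i; have := zn_coord v i; lia.
Qed.

Lemma zn_triangle w u v : (znorm (u - v) <= znorm (u - w) + znorm (w - v))%N.
Proof. by apply: leq_trans (znD _ _); rewrite addrA subrK. Qed.

Lemma zn_max_coord u : (0 < n)%N -> exists i, znorm u = absz (u 0%R i).
Proof.
move=> n0; rewrite /znorm; have [|i ->] := @bigop.eq_bigmax _ (fun i : 'I_n => absz (u 0%R i)).
  by rewrite card_ord.
by exists i.
Qed.

Lemma znM (k : nat) u : znorm (u *+ k) = (k * znorm u)%N.
Proof.
apply/eqP; rewrite eqn_leq; apply/andP; split.
  apply/zn_leP => i; have := zn_coord u i; rewrite zE; nia.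
have h i : (k * absz (u 0%R i) <= znorm (u *+ k))%N.
  have := zn_coord (u *+ k) i; rewrite zE; nia.
have [n0|n0] := posnP n; last by have [i ->] := zn_max_coord u n0; exact: h.
suff -> : znorm u = 0%N by rewrite muln0.
by apply/eqP; rewrite -leqn0; apply/zn_leP => i; have := ltn_ord i; lia.
Qed.

Definition zbasis (i : 'I_n) : 'rV[int]_n := delta_mx 0 i.

Lemma zeE i j : zbasis i 0%R j = (j == i : nat)%:Z.
Proof. by rewrite mxE eqxx /=; case: (j == i). Qed.

Lemma zn_ze i : (znorm (zbasis i) <= 1)%N.
Proof. by apply/zn_leP => j; rewrite zeE; case: (j == i). Qed.

Definition zbox r : seq 'rV[int]_n :=
  [seq map_mx (fun k : 'I_(r.*2.+1) => (k : nat)%:Z - r%:Z) A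
     | A <- enum {: 'rV['I_(r.*2.+1)]_n}].

Lemma bx_uniq r : uniq (zbox r).
Proof.
rewrite map_inj_uniq ?enum_uniq // => A B /rowP h; apply/rowP => i.
have := h i; rewrite !zE => hh; apply: val_inj => /=; lia.
Qed.

Lemma mem_bx r u : (u \in zbox r) = (znorm u <= r)%N.
Proof.
apply/mapP/idP => [[A _ ->]|h].
  by apply/zn_leP => i; rewrite zE; case: (A 0%R i) => a /= lt; lia.
exists (\row_i inord (absz (u 0%R i + r%:Z)%R)); first by rewrite mem_enum.
apply: zP => i; rewrite !zE mxE inordK; have := zn_coord u i; lia.
Qed.

Lemma size_bx r : size (zbox r) = (r.*2.+1 ^ n)%N.
Proof. by rewrite size_map -cardE card_mx card_ord mul1n. Qed.

Lemma leq_size_bx r s : (r <= s)%N -> (size (zbox r) <= size (zbox s))%N.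
Proof.
move=> rs; rewrite !size_bx; have [->|n0] := posnP n; first by rewrite !expn0.
by rewrite leq_exp2r //; lia.
Qed.

Lemma bx_leq r s : (r <= s)%N -> {subset zbox r <= zbox s}.
Proof. by move=> rs u; rewrite !mem_bx => /leq_trans; apply. Qed.

Definition zcube k : seq 'rV[int]_n :=
  [seq map_mx (fun k : 'I_(2 ^ k) => (k : nat)%:Z) A
     | A <- enum {: 'rV['I_(2 ^ k)]_n}].

Lemma cb_uniq k : uniq (zcube k).
Proof.
rewrite map_inj_uniq ?enum_uniq // => A B /rowP h; apply/rowP => i.
have := h i; rewrite !zE => hh; apply: val_inj => /=; lia.
Qed.

Lemma mem_cb k u : (u \in zcube k) = [forall i, 0 <= u 0 i < (2 ^ k)%N%:Z].
Proof.
apply/mapP/forallP => [[A _ ->] i|h].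
  by rewrite zE; case: (A 0%R i) => a /= lt; lia.
have p : (0 < 2 ^ k)%N by rewrite expn_gt0.
have lt i : (absz (u 0%R i) < 2 ^ k)%N by have := h i; lia.
exists (\row_i Ordinal (lt i)); first by rewrite mem_enum.
apply: zP => i; rewrite !zE mxE /=; have := h i; lia.
Qed.

Lemma size_cb k : size (zcube k) = ((2 ^ k) ^ n)%N.
Proof. by rewrite size_map -cardE card_mx card_ord mul1n. Qed.

Lemma zn_cb k u : u \in zcube k -> (znorm u < 2 ^ k)%N.
Proof.
rewrite mem_cb => /forallP h.
have p : (0 < 2 ^ k)%N by rewrite expn_gt0.
rewrite -(prednK p) ltnS; apply/zn_leP => i; have := h i; lia.
Qed.

Lemma zn_cbB k u v : u \in zcube k -> v \in zcube k -> (znorm (u - v) < 2 ^ k)%N.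
Proof.
rewrite !mem_cb => /forallP h /forallP h'.
have p : (0 < 2 ^ k)%N by rewrite expn_gt0.
rewrite -(prednK p) ltnS; apply/zn_leP => i; rewrite !zE.
have := h i; have := h' i; lia.
Qed.

(** Splitting off the leading binary digit; this refinement is behind every telescoping over dyadic
    cubes. *)
Lemma cbS k : perm_eq (zcube k.+1) [seq c + e *+ 2 ^ k | e <- zcube 1, c <- zcube k].
Proof.
set P := (2 ^ k)%N; have p : (0 < P)%N by rewrite expn_gt0.
have P2 : (2 ^ k.+1 = 2 * P)%N by rewrite expnS.
have digit (x x' y y' : int) : 0 <= x < 2 -> 0 <= x' < 2 -> 0 <= y < P%:Z ->
    0 <= y' < P%:Z -> y + x * P%:Z = y' + x' * P%:Z -> x = x' /\ y = y'.
  move=> hx hx' hy hy'.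
  have [->|->] : x = 0 \/ x = 1 by lia.
    (have [->|->] : x' = 0 \/ x' = 1 by lia); lia.
  (have [->|->] : x' = 0 \/ x' = 1 by lia); lia.
apply: uniq_perm; first exact: cb_uniq.
  apply: allpairs_uniq; rewrite ?cb_uniq //.
  move=> [e c] [e' c'] /allpairsP[[x y] /= [xe yc [-> ->]]].
  move=> /allpairsP[[x' y'] /= [xe' yc' [-> ->]]] h.
  have hh i : x 0 i = x' 0 i /\ y 0 i = y' 0 i.
    have : (y + x *+ P) 0 i = (y' + x' *+ P) 0 i by rewrite h.
    rewrite !zE; move: xe yc xe' yc'; rewrite !mem_cb expn1.
    move=> /forallP/(_ i) h1 /forallP/(_ i) h2 /forallP/(_ i) h3 /forallP/(_ i) h4.
    exact: digit.
  by congr pair; apply: zP => i; case: (hh i).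
move=> u; apply/idP/allpairsP => [|[[e c] /= [he hc ->]]].
  rewrite mem_cb P2 => /forallP h.
  exists (map_mx (fun x => (x %/ P%:Z)%Z) u, map_mx (fun x => (x %% P%:Z)%Z) u).
  have p' : (P%:Z != 0) by lia.
  have p'' : 0 < P%:Z by lia.
  split => /=.
  - rewrite mem_cb expn1; apply/forallP => i; rewrite zE; have := h i.
    move: (u 0%R i) => a; have := divz_eq a P%:Z; have := modz_ge0 a p'.
    have := ltz_pmod a p''; nia.
  - by rewrite mem_cb; apply/forallP => i; rewrite zE modz_ge0 //= ltz_pmod.
  - by apply: zP => i; rewrite !zE addrC -divz_eq.
rewrite mem_cb P2; apply/forallP => i; rewrite !zE.
move: he hc; rewrite !mem_cb expn1 => /forallP/(_ i) h1 /forallP/(_ i).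
rewrite -/P; move: (e 0%R i) (c 0%R i) h1 => a b h1 h2.
(have [->|->] : a = 0 \/ a = 1 by lia); lia.
Qed.

End lattice.

Section lattice_sums.
Context (R : realType) (n : nat).
Implicit Types (w : 'rV[int]_n) (r s : nat).

Lemma sum_bx_leq r s (F : 'rV[int]_n -> R) : (r <= s)%N ->
  (forall u, 0 <= F u) -> \sum_(u <- zbox n r) F u <= \sum_(u <- zbox n s) F u.
Proof.
move=> rs F0; apply: (@ler_sum_inj _ _ _ _ _ id) => //; rewrite ?bx_uniq //.
exact: bx_leq.
Qed.

Lemma sum_bx_shift r s w (F : 'rV[int]_n -> R) : (r + znorm w <= s)%N ->
  (forall u, 0 <= F u) -> \sum_(u <- zbox n r) F (u + w) <= \sum_(u <- zbox n s) F u.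
Proof.
move=> rs F0; apply: (@ler_sum_inj _ _ _ _ _ (+%R^~ w)) => //; rewrite ?bx_uniq //.
  by move=> x y _ _ /addIr.
move=> x; rewrite !mem_bx => xr; apply: leq_trans rs; apply: leq_trans (znD _ _) _.
by rewrite leq_add2r.
Qed.

Lemma sum_bx_opp (V : nmodType) r (F : 'rV[int]_n -> V) :
  \sum_(u <- zbox n r) F (- u) = \sum_(u <- zbox n r) F u.
Proof.
apply: (@eq_sum_inj _ _ _ _ _ (fun u => - u)); rewrite ?bx_uniq //.
- by move=> x y _ _ /oppr_inj.
- by move=> x; rewrite !mem_bx znN.
- by move=> y yr _; exists (- y); rewrite ?opprK // mem_bx znN -mem_bx.
Qed.

Lemma sum_bx_supp (V : nmodType) r s w (F : 'rV[int]_n -> V) :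
  (forall u, F u != 0%R -> (znorm u <= r) && (znorm (u - w) <= s))%N ->
  \sum_(u <- zbox n s) F (u + w) = \sum_(u <- zbox n r) F u.
Proof.
move=> h; apply: (@eq_sum_inj _ _ _ _ _ (+%R^~ w)); rewrite ?bx_uniq //.
- by move=> x y _ _ /addIr.
- by move=> x _ /h /andP[]; rewrite mem_bx.
- move=> y _ /h /andP[_ ?]; exists (y - w); rewrite ?subrK //.
  by rewrite mem_bx.
Qed.

End lattice_sums.

(** * Dorronsoro's estimate on the lattice *)

Section second_differences.
Context (R : realType) (n d : nat) (M : R) (g : 'rV[int]_n -> 'rV[R]_d).
Context (gLip : forall u v, enorm (g u - g v) <= M * (znorm (u - v))%:R).
Implicit Types (u v w z : 'rV[int]_n) (r s k : nat).

Definition D2 u w : 'rV[R]_d := g (u + w) + g (u - w) - g u *+ 2.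

Definition I2 r w : R := \sum_(u <- zbox n r) enorm (g (u + w) - g u) ^+ 2.

(** The parallelogram law for [g (u + w) - g u] and [g (u - w) - g u], whose sum is [D2 u w] and
    whose difference spans a step [2 w]. *)
Lemma D2_parallelogram u w :
  enorm (D2 u w) ^+ 2 + enorm (g (u + w) - g (u - w)) ^+ 2 =
  2 * enorm (g (u + w) - g u) ^+ 2 + 2 * enorm (g (u - w) - g u) ^+ 2.
Proof.
rewrite !enorm_sqr !mulr_sumr -!big_split /=; apply: eq_bigr => i _.
by rewrite /D2 mulr2n !mxE; ring.
Qed.

Lemma I2_leq r s w : (r <= s)%N -> I2 r w <= I2 s w.
Proof. by move=> rs; apply: sum_bx_leq => // u; rewrite sqr_ge0. Qed.

(** Shifting the base point by [w] turns the step [2 w] at [u] into the difference across [u] in the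
    parallelogram law. When the step doubles, the energy of first differences divided by 4 does not
    grow, up to enlarging the box, and the second differences are the loss. *)
Lemma D2_step r s w : (znorm w <= s)%N ->
  \sum_(u <- zbox n r) enorm (D2 u w) ^+ 2 + I2 r (w *+ 2) <= 4 * I2 (r + s.*2) w.
Proof.
move=> ws.
have h1 : I2 r (w *+ 2) <= \sum_(u <- zbox n (r + s)) enorm (g (u + w) - g (u - w)) ^+ 2.
  apply: le_trans (sum_bx_shift (w := w) (r := r) _ _); last 2 first.
  - by rewrite leq_add2l.
  - by move=> u; rewrite sqr_ge0.
  by rewrite le_eqVlt; apply/orP; left; apply/eqP; apply: eq_bigr => u _; rewrite addrK mulr2n addrA.
have h2 : \sum_(u <- zbox n r) enorm (D2 u w) ^+ 2 <=
    \sum_(u <- zbox n (r + s)) enorm (D2 u w) ^+ 2.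
  by apply: sum_bx_leq; rewrite ?leq_addr // => u; rewrite sqr_ge0.
apply: le_trans (lerD h2 h1) _; rewrite -big_split /=.
under eq_bigr do rewrite D2_parallelogram.
rewrite big_split /= -!mulr_sumr.
have h3 : \sum_(u <- zbox n (r + s)) enorm (g (u + w) - g u) ^+ 2 <= I2 (r + s.*2) w.
  by apply: I2_leq; lia.
have h4 : \sum_(u <- zbox n (r + s)) enorm (g (u - w) - g u) ^+ 2 <= I2 (r + s.*2) w.
  apply: le_trans (sum_bx_shift (w := - w) (r := (r + s)%N) _ _); last 2 first.
  - by rewrite znN; lia.
  - by move=> u; rewrite sqr_ge0.
  by rewrite le_eqVlt; apply/orP; left; apply/eqP; apply: eq_bigr => u _; rewrite subrK enormB.
lra.
Qed.

Lemma I2_le r w : I2 r w <= (size (zbox n r))%:R * (M * (znorm w)%:R) ^+ 2.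
Proof.
apply: sum_le_const => u _; have := gLip (u + w) u.
have -> : u + w - u = w by rewrite addrAC subrr add0r.
by move=> h; rewrite lerXn2r ?nnegrE ?enorm_ge0 // (le_trans _ h) ?enorm_ge0.
Qed.

Lemma D2_telescope K r z :
  \sum_(k < K) 4^-1 ^+ k * \sum_(u <- zbox n r) enorm (D2 u (z *+ 2 ^ k)) ^+ 2 +
    4 * 4^-1 ^+ K * I2 r (z *+ 2 ^ K)
  <= 4 * I2 (r + 2 ^ K.+1 * znorm z) z.
Proof.
elim: K r => [|K IH] r.
  by rewrite big_ord0 add0r expr0 mulr1 expn0 mulr1n ler_wpM2l // I2_leq // leq_addr.
rewrite big_ord_recr /=.
have zs : (znorm (z *+ 2 ^ K) <= 2 ^ K * znorm z)%N by rewrite znM.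
have := D2_step r zs; rewrite -mulrnA -expnSr => st.
have p : 0 <= (4^-1 : R) ^+ K by rewrite exprn_ge0 // invr_ge0.
have := ler_wpM2l p st.
have {IH} := IH (r + (2 ^ K * znorm z).*2)%N.
have -> : (r + (2 ^ K * znorm z).*2 + 2 ^ K.+1 * znorm z = r + 2 ^ K.+2 * znorm z)%N.
  by rewrite !expnS; lia.
have le : \sum_(i < K) 4^-1 ^+ i * (\sum_(u <- zbox n r) enorm (D2 u (z *+ 2 ^ i)) ^+ 2) <=
  \sum_(k < K) 4^-1 ^+ k * (\sum_(u <- zbox n (r + (2 ^ K * znorm z).*2))
             enorm (D2 u (z *+ 2 ^ k)) ^+ 2).
  apply: ler_sum => i _; rewrite ler_wpM2l ?exprn_ge0 ?invr_ge0 //.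
  by apply: sum_bx_leq; rewrite ?leq_addr // => u; rewrite sqr_ge0.
rewrite exprS; lra.
Qed.

(** Steps of norm at most 2 suffice: the second differences met below run along [a + b] or [a - b]
    with [a], [b] of norm at most 1, or along twice a basis vector. *)
Definition D2_energy k r : R :=
  \sum_(z <- zbox n 2) \sum_(u <- zbox n r) enorm (D2 u (z *+ 2 ^ k)) ^+ 2.

Lemma q2_ge0 k r : 0 <= D2_energy k r.
Proof.
by apply: sumr_ge0 => z _; apply: sumr_ge0 => u _; rewrite sqr_ge0.
Qed.

Lemma q2_leq k r s : (r <= s)%N -> D2_energy k r <= D2_energy k s.
Proof.
move=> rs; apply: ler_sum => z _; apply: sum_bx_leq => // u; exact: sqr_ge0.
Qed.

Lemma q2_sum K r :
  \sum_(k < K) 4^-1 ^+ k * D2_energy k r <=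
  16 * (size (zbox n 2))%:R * M ^+ 2 * (size (zbox n (r + 2 ^ K.+2)))%:R.
Proof.
under eq_bigr do rewrite /D2_energy mulr_sumr; rewrite exchange_big /=.
have -> : 16 * (size (zbox n 2))%:R * M ^+ 2 * (size (zbox n (r + 2 ^ K.+2)))%:R =
  (size (zbox n 2))%:R * (4 * ((size (zbox n (r + 2 ^ K.+2)))%:R * (M * 2) ^+ 2)).
  by ring.
apply: sum_le_const => z; rewrite mem_bx => z2.
have := D2_telescope K r z.
have I0 : 0 <= 4 * 4^-1 ^+ K * I2 r (z *+ 2 ^ K).
  rewrite !mulr_ge0 ?exprn_ge0 ?invr_ge0 //.
  by apply: sumr_ge0 => u _; rewrite sqr_ge0.
have h1 : I2 (r + 2 ^ K.+1 * znorm z) z <= I2 (r + 2 ^ K.+2) z.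
  by apply: I2_leq; rewrite leq_add2l [X in (_ <= X)%N]expnSr leq_mul2l z2 orbT.
have h2 := I2_le (r + 2 ^ K.+2) z.
have h3 : (size (zbox n (r + 2 ^ K.+2)))%:R * (M * (znorm z)%:R) ^+ 2 <=
   (size (zbox n (r + 2 ^ K.+2)))%:R * (M * 2) ^+ 2.
  rewrite ler_wpM2l // !exprMn ler_wpM2l ?sqr_ge0 // lerXn2r ?nnegrE //.
  by rewrite ler_nat.
lra.
Qed.

Definition slope k u (i : 'I_n) : 'rV[R]_d := 2^-1 ^+ k *: (g (u + zbasis i *+ 2 ^ k) - g u).

Definition lin_comb (a : 'I_n -> 'rV[R]_d) (x : 'I_n -> R) : 'rV[R]_d :=
  \sum_i x i *: a i.

Definition real_coord w (i : 'I_n) : R := (w 0 i)%:~R.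

(** The deviation at [u + w] from the affine map that interpolates [g] at [u] and at the [n] points
    [u + 2 ^ k e_i]. *)
Definition taylor_rem k u w : 'rV[R]_d := g (u + w) - g u - lin_comb (slope k u) (real_coord w).

Definition mix u a b : 'rV[R]_d := g (u + a + b) - g (u + a) - g (u + b) + g u.

(** The diagonals of the parallelogram with sides [2 a] and [2 b] share the midpoint [u + a + b],
    and the mixed difference compares them. The sides are even so that the midpoint is a lattice
    point; hence scale [k.+1] is controlled by the energy of scale [k]. *)
Lemma mix_D2 u a b :
  mix u (a *+ 2) (b *+ 2) = D2 (u + a + b) (a + b) - D2 (u + a + b) (a - b).
Proof.
rewrite /mix /D2.
have e1 : u + a + b + (a + b) = u + a *+ 2 + b *+ 2 by apply: zP => i; rewrite !zE; lia.
have e2 : u + a + b - (a + b) = u by apply: zP => i; rewrite !zE; lia.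
have e3 : u + a + b + (a - b) = u + a *+ 2 by apply: zP => i; rewrite !zE; lia.
have e4 : u + a + b - (a - b) = u + b *+ 2 by apply: zP => i; rewrite !zE; lia.
rewrite e1 e2 e3 e4.
move: (g (u + a *+ 2)) (g (u + b *+ 2)) (g (u + a *+ 2 + b *+ 2)) => A B E.
by rewrite mulr2n; apply/rowP => i; rewrite !mxE; ring.
Qed.

Lemma gr_le k u i : enorm (slope k u i) <= `|M|.
Proof.
rewrite enormZ ger0_norm ?exprn_ge0 ?invr_ge0 //.
rewrite exprVn mulrC ler_pdivrMr ?exprn_gt0 //.
apply: le_trans (gLip _ _) _; have -> : u + zbasis i *+ 2 ^ k - u = zbasis i *+ 2 ^ k.
  by rewrite addrAC subrr add0r.
apply: le_trans (ler_wpM2r _ (ler_norm _)) _ => //.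
by rewrite ler_wpM2l // -natrX ler_nat znM -[leqRHS]muln1 leq_mul2l zn_ze orbT.
Qed.

Lemma iv_le w i : `|real_coord w i| <= (znorm w)%:R.
Proof. by rewrite /real_coord -intr_norm -natr_absz ler_nat zn_coord. Qed.

Lemma lin_le a (x : 'I_n -> R) (B X : R) : (forall i, enorm (a i) <= B) ->
  (forall i, `|x i| <= X) -> 0 <= X -> enorm (lin_comb a x) <= n%:R * (X * B).
Proof.
move=> aB xX X0; apply: le_trans (enorm_sum _ _) _.
have -> : n%:R * (X * B) = \sum_(i < n) X * B by rewrite sumr_const card_ord mulr_natl.
by apply: ler_sum => i _; rewrite enormZ ler_pM ?enorm_ge0.
Qed.

Lemma linD a (x y : 'I_n -> R) : lin_comb a (fun i => x i + y i) = lin_comb a x + lin_comb a y.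
Proof. by rewrite -big_split /=; apply: eq_bigr => i _; rewrite scalerDl. Qed.

Lemma linZ a (c : R) (x : 'I_n -> R) : lin_comb a (fun i => c * x i) = c *: lin_comb a x.
Proof. by rewrite scaler_sumr; apply: eq_bigr => i _; rewrite scalerA. Qed.

Lemma taylor_rem_le k u w : enorm (taylor_rem k u w) <= (n.+1)%:R * (`|M| * (znorm w)%:R).
Proof.
apply: le_trans (enormD _ _) _; rewrite enormN -natr1 mulrDl addrC.
apply: lerD.
  rewrite (mulrC `|M|); apply: lin_le => //; [exact: gr_le|exact: iv_le].
apply: le_trans (gLip _ _) _; rewrite mul1r.
have -> : u + w - u = w by rewrite addrAC subrr add0r.
by rewrite ler_wpM2r // ler_norm.
Qed.

End second_differences.

Section dorronsoro.
Context (R : realType) (n d : nat) (M : R) (g : 'rV[int]_n -> 'rV[R]_d).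
Context (gLip : forall u v, enorm (g u - g v) <= M * (znorm (u - v))%:R).
Implicit Types (u v w z a b : 'rV[int]_n) (r s k : nat) (c : R).
Implicit Types F : 'rV[int]_n -> 'rV[R]_d.

(** All boxes at once, so that the bound can be used on each of the nested boxes of an induction
    over scales. *)
Definition D2_controlled k c F := forall r,
  \sum_(u <- zbox n r) enorm (F u) ^+ 2 <= c * D2_energy g k (r + 2 ^ k.+2).

Lemma eq_ctl k c F G : F =1 G -> D2_controlled k c F -> D2_controlled k c G.
Proof. by move=> FG h r; under eq_bigr do rewrite -FG. Qed.

Lemma ctl_D2 k v z : (znorm v <= 2 ^ k.+2)%N -> (znorm z <= 2)%N ->
  D2_controlled k 1 (fun u => D2 g (u + v) (z *+ 2 ^ k)).
Proof.
move=> vk z2 r; rewrite mul1r.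
apply: le_trans (sum_bx_shift (w := v) (s := (r + 2 ^ k.+2)%N)
  (F := fun u => enorm (D2 g u (z *+ 2 ^ k)) ^+ 2) _ _) _.
- by rewrite leq_add2l.
- by move=> u; rewrite sqr_ge0.
apply: (ler_sum_term (F := fun z => \sum_(u <- zbox n (r + 2 ^ k.+2)) enorm (D2 g u (z *+ 2 ^ k)) ^+ 2)).
  by rewrite mem_bx.
by move=> y; apply: sumr_ge0 => u _; rewrite sqr_ge0.
Qed.

Lemma ctl_add k c1 c2 F G : D2_controlled k c1 F -> D2_controlled k c2 G ->
  D2_controlled k (2 * c1 + 2 * c2) (fun u => F u + G u).
Proof.
move=> hF hG r; have := hF r; have := hG r.
have : \sum_(u <- zbox n r) enorm (F u + G u) ^+ 2 <=
    2 * (\sum_(u <- zbox n r) enorm (F u) ^+ 2) + 2 * \sum_(u <- zbox n r) enorm (G u) ^+ 2.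
  by rewrite !mulr_sumr -big_split /=; apply: ler_sum => u _; exact: enorm_sqrD.
lra.
Qed.

Lemma ctl_scale k c (x : R) F : `|x| <= 1 -> D2_controlled k c F -> D2_controlled k c (fun u => x *: F u).
Proof.
move=> x1 h r; apply: le_trans (h r); apply: ler_sum => u _.
rewrite enormZ lerXn2r ?nnegrE ?mulr_ge0 ?enorm_ge0 //.
by rewrite ler_piMl ?enorm_ge0.
Qed.

Lemma ctl_sum k c (F : 'I_n -> 'rV[int]_n -> 'rV[R]_d) :
  (forall i, D2_controlled k c (F i)) -> D2_controlled k (n%:R * n%:R * c) (fun u => \sum_i F i u).
Proof.
move=> h r.
have : \sum_(u <- zbox n r) enorm (\sum_i F i u) ^+ 2 <=
    n%:R * \sum_(i < n) \sum_(u <- zbox n r) enorm (F i u) ^+ 2.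
  rewrite exchange_big mulr_sumr; apply: ler_sum => u _.
  apply: le_trans (enorm_sum_sqr _ _) _; rewrite le_eqVlt; apply/orP; left; apply/eqP.
  by congr (_%:R * _); rewrite /index_enum -enumT -cardE card_ord.
move/le_trans; apply; rewrite -!mulrA ler_wpM2l //.
apply: le_trans (ler_sum _ (fun i _ => h i r)) _.
by rewrite sumr_const card_ord mulr_natl.
Qed.

Lemma ctl_mix k a b : (znorm a <= 1)%N -> (znorm b <= 1)%N ->
  D2_controlled k 4 (fun u => mix g u (a *+ 2 ^ k.+1) (b *+ 2 ^ k.+1)).
Proof.
move=> a1 b1.
have kk : (2 * 2 ^ k <= 2 ^ k.+2)%N by rewrite !expnS; lia.
have ab1 : (znorm (a + b) <= 2)%N by have := znD a b; lia.
have ab2 : (znorm (a - b) <= 2)%N by have := znD a (- b); rewrite znN; lia.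
have vk : (znorm ((a + b) *+ 2 ^ k) <= 2 ^ k.+2)%N by rewrite znM; nia.
have h1 := ctl_D2 vk ab1; have h2 := ctl_D2 vk ab2.
have h3 : D2_controlled k 1 (fun u => -1 *: D2 g (u + (a + b) *+ 2 ^ k) ((a - b) *+ 2 ^ k)).
  by apply: ctl_scale => //; rewrite normrN1.
have := ctl_add h1 h3; have -> : 2 * 1 + 2 * 1 = 4 :> R by lra.
move=> h; apply: (eq_ctl _ h) => u; rewrite scaleN1r !expnSr !mulrnA mix_D2.
by rewrite !mulrnDl mulNrn !addrA.
Qed.

Lemma linB (x : 'I_n -> R) (A B : 'I_n -> 'rV[R]_d) :
  lin_comb A x - lin_comb B x = lin_comb (fun i => A i - B i) x.
Proof. by rewrite -sumrB; apply: eq_bigr => i _; rewrite scalerBr. Qed.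

Lemma ivD u v i : real_coord R (u + v) i = real_coord R u i + real_coord R v i.
Proof. by rewrite /real_coord -intrD zDE. Qed.

Lemma ivMn u k i : real_coord R (u *+ k) i = real_coord R u i * k%:R.
Proof. by rewrite /real_coord zMnE intrM. Qed.

Lemma lin_ivD (A : 'I_n -> 'rV[R]_d) u v : lin_comb A (real_coord R (u + v)) = lin_comb A (real_coord R u) + lin_comb A (real_coord R v).
Proof. by rewrite -linD; apply: eq_bigr => i _; rewrite ivD. Qed.

(* [taylor_rem] at a point all of whose coordinates are [0] or [+- 2 ^ k.+1]: change one
   coordinate at a time. *)
Lemma D2_controlled_taylor_rem k w : (znorm w <= 1)%N ->
  D2_controlled k (n%:R * n%:R * 4) (fun u => taylor_rem g k.+1 u (w *+ 2 ^ k.+1)).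
Proof.
move=> w1; set s := (2 ^ k.+1)%N.
pose tr l := \row_(i < n) (if (i < l)%N then w 0 i else 0) : 'rV[int]_n.
have tr1 l : (znorm (tr l) <= 1)%N.
  apply/zn_leP => i; rewrite zE; case: ifP => _ //; have := zn_coord w i; lia.
pose F (l : 'I_n) u := g (u + tr l.+1 *+ s) - g (u + tr l *+ s)
   - real_coord R w l *: (g (u + zbasis l *+ s) - g u).
have trS (l i : 'I_n) : tr l.+1 0 i = tr l 0 i + (i == l : nat)%:Z * w 0 l.
  rewrite !zE ltnS leq_eqVlt; have [->|il] := eqVneq i l.
    by rewrite eqxx ltnn /=; lia.
  by have -> : (i == l :> nat) = false by [exact: negbTE|]; case: ifP => /=; lia.
have trl0 (l : 'I_n) : tr l 0 l = 0 by rewrite zE ltnn.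
have wl (l : 'I_n) : w 0%R l = 0 \/ w 0%R l = 1 \/ w 0%R l = -1.
  have := zn_coord w l; lia.
have trl (l : 'I_n) : (znorm (tr l - zbasis l) <= 1)%N.
  apply/zn_leP => i; rewrite zBE zeE; have := zn_coord (tr l) i; have := tr1 l.
  by have [->|il] := eqVneq i l; rewrite ?trl0 /=; lia.
have hF l : D2_controlled k 4 (F l).
  rewrite /F; case: (wl l) => [|[|]] w0.
  - have e : tr l.+1 = tr l by apply: zP => i; rewrite trS w0; lia.
    move=> r; rewrite big1 ?mulr_ge0 ?q2_ge0 // => u _.
    by rewrite e subrr /real_coord w0 scale0r subr0 enorm0 expr0n.
  - have e : tr l.+1 = tr l + zbasis l.
      by apply: zP => i; rewrite trS zDE zeE w0; lia.
    apply: (eq_ctl _ (@ctl_mix k _ _ (tr1 l) (zn_ze l))) => u; rewrite /mix -/s e /real_coord w0 scale1r.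
    by rewrite mulrnDl addrA opprB addrA addrAC.
  - have e : tr l.+1 = tr l - zbasis l.
      by apply: zP => i; rewrite trS zBE zeE w0; lia.
    have := ctl_scale (x := -1) _ (@ctl_mix k _ _ (trl l) (zn_ze l)).
    rewrite normrN1 => /(_ (lexx _)) h; apply: (eq_ctl _ h) => u; rewrite /mix -/s e /real_coord w0.
    rewrite mulrnBl addrA subrK !scaleN1r.
    by move: (g _) (g _) (g _) (g _) => A B C D; apply/rowP => i; rewrite !mxE; ring.
apply: (eq_ctl _ (ctl_sum hF)) => u; rewrite /F sumrB /taylor_rem; congr (_ - _).
  rewrite -(big_mkord xpredT (fun l => g (u + tr l.+1 *+ s) - g (u + tr l *+ s))).
  rewrite telescope_sumr //; congr (g (_ + _) - g _).
    by congr (_ *+ _); apply: zP => i; rewrite zE ltn_ord.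
  have -> : tr 0 = 0 by apply: zP => i; rewrite !zE.
  by rewrite mul0rn addr0.
apply: eq_bigr => i _; rewrite /slope ivMn -scalerA; congr (_ *: _).
by rewrite scalerA exprVn -natrX -/s mulfV ?scale1r // pnatr_eq0 expn_eq0.
Qed.

(** Passing from the affine map at [u], scale [k.+2], to the one at [u + v], scale [k.+1], changes
    the slope twice: the base point moves (mixed differences, [T2]) and the scale halves (second
    differences, [T3]). What is left is the remainder at [v], whose coordinates are 0 or plus or
    minus [2 ^ k.+1]. *)
Lemma er_step k w : (znorm w <= 2 ^ k.+2)%N ->
  exists v w' : 'rV[int]_n, [/\ (znorm v <= 2 ^ k.+1)%N, (znorm w' <= 2 ^ k.+1)%N &
   D2_controlled k (2 * (2 * (n%:R * n%:R * 4) + 2 * (n%:R * n%:R * 1)) + 2 * (n%:R * n%:R * 4))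
     (fun u => taylor_rem g k.+2 u w - taylor_rem g k.+1 (u + v) w')].
Proof.
move=> wk; set s := (2 ^ k.+1)%N.
have s0 : (0 < s)%N by rewrite expn_gt0.
have s2 : (2 ^ k.+2 = 2 * s)%N by rewrite expnS.
(* Coordinates exceeding [s] in absolute value are reduced by [s] towards 0, which leaves a rest of
   norm at most [s]. *)
pose o := \row_(i < n) (if (absz (w 0%R i) <= s)%N then 0 else if (0 <= w 0%R i) then 1 else -1) : 'rV[int]_n.
have o1 : (znorm o <= 1)%N by apply/zn_leP => i; rewrite zE; do 2?case: ifP.
pose v := o *+ s; pose w' := w - v.
have wE : w = v + w' by rewrite addrC subrK.
have vs : (znorm v <= s)%N by rewrite /v znM; nia.
have ws : (znorm w' <= s)%N.
  apply/zn_leP => i; rewrite /w' /v !zE; have := zn_coord w i.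
  by case: ifP => h; [|case: ifP => h']; lia.
exists v, w'; split => //.
pose T2 (i : 'I_n) u := (real_coord R w' i * s%:R^-1) *: mix g u (o *+ s) (zbasis i *+ s).
pose T3 (i : 'I_n) u := - (real_coord R w i * (2 * s)%:R^-1) *: D2 g (u + zbasis i *+ s) ((zbasis i *+ 2) *+ 2 ^ k).
have c2 i : D2_controlled k 4 (T2 i).
  apply: ctl_scale; last exact: ctl_mix o1 (zn_ze i).
  rewrite normrM normfV ler_pdivrMr ?normr_gt0 ?pnatr_eq0 -?lt0n // mul1r.
  by apply: le_trans (iv_le _ _ _) _; rewrite normr_nat ler_nat.
have c3 i : D2_controlled k 1 (T3 i).
  apply: ctl_scale; last first.
    apply: ctl_D2; rewrite znM; have := zn_ze i; nia.
  rewrite normrN normrM normfV ler_pdivrMr ?normr_gt0 ?pnatr_eq0 -?lt0n ?muln_gt0 // mul1r.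
  by apply: le_trans (iv_le _ _ _) _; rewrite normr_nat ler_nat -s2.
have h := ctl_add (ctl_add (ctl_sum c2) (ctl_sum c3)) (D2_controlled_taylor_rem k o1).
apply: (eq_ctl _ h) => u /= {h}.
have hT2 : \sum_i T2 i u = lin_comb (slope g k.+1 (u + v)) (real_coord R w') - lin_comb (slope g k.+1 u) (real_coord R w').
  rewrite linB.
rewrite -[RHS]/(\sum_i real_coord R w' i *: (_ - _)). apply: eq_bigr => i _. rewrite /T2 -scalerA; congr (_ *: _).
  rewrite /slope -scalerBr -/s exprVn -natrX -/s; congr (_ *: _); rewrite /mix -/v.
  by rewrite opprB !addrA; move: (g _) (g _) (g _) (g _) => A B C D; apply/rowP => j; rewrite !mxE; ring.
have hT3 : \sum_i T3 i u = lin_comb (slope g k.+1 u) (real_coord R w) - lin_comb (slope g k.+2 u) (real_coord R w).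
  rewrite linB; apply: eq_bigr => i _; rewrite /T3 scaleNr -scalerA -scalerN; congr (_ *: _).
  have -> : zbasis i *+ 2 *+ 2 ^ k = zbasis i *+ s by rewrite -mulrnA -expnS.
  rewrite /slope !exprVn -!natrX -/s s2 /D2 addrK.
  have -> : u + zbasis i *+ s + zbasis i *+ s = u + zbasis i *+ (2 * s) by rewrite -addrA -mulrnDr addnn mul2n.
  have sn : (s%:R : R) != 0 by rewrite pnatr_eq0 -lt0n.
  apply/rowP => j; rewrite mulr2n !mxE natrM; field; exact: sn.
have hA : lin_comb (slope g k.+1 u) (real_coord R w) = lin_comb (slope g k.+1 u) (real_coord R v) + lin_comb (slope g k.+1 u) (real_coord R w').
  by rewrite -lin_ivD -wE.
have hg : u + w = u + v + w' by rewrite -addrA -wE.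
rewrite hT2 hT3 hA /taylor_rem -/s -/v hg; clearbody v w'.
move: (g (u + v + w')) (g (u + v)) (g u) => A B C.
move: (lin_comb _ (real_coord R w')) (lin_comb _ (real_coord R w')) (lin_comb _ (real_coord R v)) (lin_comb _ (real_coord R w)) => D E F G.
by apply/rowP => j; rewrite !mxE; ring.
Qed.

End dorronsoro.

(** Iterating [er_step] from unit scale, where the Lipschitz bound is used, each square of a sum
    doubles the previous error while the normalization [4 ^ k.+1] quadruples. The recursion for [x]
    thus contracts by one half, and its sum is controlled by the sum of the energies. *)
Lemma dorronsoro (R : realType) (n d : nat) : exists2 C : R, 0 < C &
  forall (M : R) (g : 'rV[int]_n -> 'rV[R]_d),
  (forall u v, enorm (g u - g v) <= M * (znorm (u - v))%:R) ->
  forall K r, exists x : nat -> R, [/\ forall k, 0 <= x k,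
    forall k w, (k <= K)%N -> (znorm w <= 2 ^ k.+1)%N ->
      \sum_(u <- zbox n r) enorm (taylor_rem g k.+1 u w) ^+ 2 <= 4 ^+ k.+1 * x k
  & \sum_(k < K.+1) x k <= C * M ^+ 2 * (size (zbox n (r + 2 ^ (K + 5))))%:R].
Proof.
pose c : R := 2 * (2 * (n%:R * n%:R * 4) + 2 * (n%:R * n%:R * 1)) + 2 * (n%:R * n%:R * 4).
have c0 : 0 <= c by rewrite /c !addr_ge0 ?mulr_ge0 ?addr_ge0 ?mulr_ge0.
exists (2 * (n.+1)%:R ^+ 2 + 4 * c * (size (zbox n 2))%:R + 1).
  rewrite ltr_wpDl // addr_ge0 // ?mulr_ge0 //; exact: exprn_ge0.
move=> M g gLip K r.
set r' := (r + 2 ^ K.+4)%N.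
pose x0 := (n.+1)%:R ^+ 2 * M ^+ 2 * (size (zbox n r'))%:R.
pose y k := 2 * c * (4^-1 ^+ k * D2_energy g k r') / 16.
pose x := fix x k := if k is k'.+1 then 2^-1 * x k' + y k' else x0.
have y0 k : 0 <= y k.
  by rewrite /y !mulr_ge0 ?exprn_ge0 ?invr_ge0 ?q2_ge0.
have x0_ge0 : 0 <= x0 by rewrite /x0 !(sqr_ge0, mulr_ge0).
have x_ge0 k : 0 <= x k.
  elim: k => [//|k IH]; apply: addr_ge0 (y0 k); rewrite mulr_ge0 // invr_ge0.
have bound k rho w : (rho + 2 ^ k.+4 <= r')%N -> (znorm w <= 2 ^ k.+1)%N ->
    \sum_(u <- zbox n rho) enorm (taylor_rem g k.+1 u w) ^+ 2 <= 4 ^+ k.+1 * x k.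
  elim: k rho w => [|k IH] rho w hr hw.
    apply: le_trans (_ : (size (zbox n rho))%:R * ((n.+1)%:R * (`|M| * 2)) ^+ 2 <= _).
      apply: sum_le_const => u _; rewrite lerXn2r ?nnegrE ?enorm_ge0 ?mulr_ge0 //.
      apply: le_trans (taylor_rem_le gLip _ _ _) _; rewrite ler_wpM2l // ler_wpM2l //.
      by rewrite ler_nat.
    have le : (size (zbox n rho))%:R <= (size (zbox n r'))%:R :> R.
      by rewrite ler_nat leq_size_bx //; lia.
    rewrite /= /x0 !exprMn real_normK ?num_real //.
    have A0 : 0 <= (n.+1)%:R ^+ 2 * (M ^+ 2 * 2 ^+ 2) :> R.
      by rewrite !(sqr_ge0, mulr_ge0).
    have := ler_wpM2r A0 le; lra.
  have [v [w' [hv hw' hc]]] := er_step g hw.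
  have h1 : \sum_(u <- zbox n rho) enorm (taylor_rem g k.+1 (u + v) w') ^+ 2 <= 4 ^+ k.+1 * x k.
    apply: le_trans (IH (rho + 2 ^ k.+1)%N w' _ hw'); last first.
      by apply: leq_trans hr; rewrite !expnS; lia.
    apply: (sum_bx_shift (F := fun u => enorm (taylor_rem g k.+1 u w') ^+ 2)).
      by rewrite leq_add2l.
    by move=> u; rewrite sqr_ge0.
  have h2 : \sum_(u <- zbox n rho) enorm (taylor_rem g k.+2 u w - taylor_rem g k.+1 (u + v) w') ^+ 2 <=
      c * D2_energy g k r'.
    apply: le_trans (hc rho) _; rewrite -/c ler_wpM2l //; apply: q2_leq.
    by apply: leq_trans hr; rewrite !expnS; lia.
  have h3 : \sum_(u <- zbox n rho) enorm (taylor_rem g k.+2 u w) ^+ 2 <=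
     2 * (\sum_(u <- zbox n rho) enorm (taylor_rem g k.+1 (u + v) w') ^+ 2) +
     2 * (\sum_(u <- zbox n rho) enorm (taylor_rem g k.+2 u w - taylor_rem g k.+1 (u + v) w') ^+ 2).
    rewrite !mulr_sumr -big_split /=; apply: ler_sum => u _.
    by rewrite -{1}(subrK (taylor_rem g k.+1 (u + v) w') (taylor_rem g k.+2 u w)) addrC enorm_sqrD.
  have e : 4 ^+ k * y k = c * D2_energy g k r' / 8.
    by rewrite /y exprVn; field; rewrite expf_neq0.
  rewrite /= !exprS in h1 *; lra.
exists x; split => // [k w kK hw|].
  apply: bound => //; rewrite leq_add2l leq_exp2l //; lia.
have sumx k : \sum_(i < k.+1) x i + x k <= 2 * x0 + 2 * \sum_(i < k) y i.
  elim: k => [|k IH]; first by rewrite big_ord_recr !big_ord0 /=; lra.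
  by rewrite big_ord_recr [\sum_(i < k.+1) y i]big_ord_recr /=; lra.
have sumy : \sum_(i < K) y i <= 2 * c / 16 * (16 * (size (zbox n 2))%:R * M ^+ 2 * (size (zbox n (r + 2 ^ (K + 5))))%:R).
  have -> : \sum_(i < K) y i = 2 * c / 16 * \sum_(i < K) 4^-1 ^+ i * D2_energy g i r'.
    by rewrite mulr_sumr; apply: eq_bigr => i _; rewrite /y; ring.
  apply: ler_wpM2l; first by rewrite !mulr_ge0 ?invr_ge0.
  apply: le_trans (q2_sum gLip _ _) _; apply: ler_wpM2l.
    by rewrite !(sqr_ge0, mulr_ge0).
  by rewrite ler_nat leq_size_bx // /r' expnD !expnS; lia.
have hx0 : x0 <= (n.+1)%:R ^+ 2 * M ^+ 2 * (size (zbox n (r + 2 ^ (K + 5))))%:R.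
  rewrite /x0 ler_wpM2l //; first by rewrite !(sqr_ge0, mulr_ge0).
  by rewrite ler_nat leq_size_bx // /r' expnD !expnS; lia.
have := sumx K; have := x_ge0 K.
have : 0 <= M ^+ 2 * (size (zbox n (r + 2 ^ (K + 5))))%:R by rewrite !(sqr_ge0, mulr_ge0).
lra.
Qed.

(** * Sharp cutoffs and their jumps *)

Section truncation.
Context (R : realType) (d : nat).
Implicit Types (a b : 'rV[R]_d) (t rho : R).

Definition phi t a : 'rV[R]_d := if enorm a < t then a else 0.

Lemma phiN t a : phi t (- a) = - phi t a.
Proof. by rewrite /phi enormN; case: ifP => //; rewrite oppr0. Qed.

Lemma phi_le t a : 0 <= t -> enorm (phi t a) <= t.
Proof. by rewrite /phi; case: ifP => [/ltW|]; rewrite ?enorm0. Qed.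

(** If only one of the two vectors is cut off, its length is at most [t] and [enorm a] lies within
    [rho] of [t]. *)
Lemma phi_close t rho a b : 0 <= t -> enorm (a - b) <= rho ->
  enorm (phi t a - phi t b) <= rho + t * (`|enorm a - t| <= rho)%R%:R.
Proof.
move=> t0 ab; have r0 : 0 <= rho by apply: le_trans ab; rewrite enorm_ge0.
have := le_trans (enorm_lip a b) ab; rewrite ler_norml => /andP[h1 h2].
rewrite /phi; case: ltP => ha; case: ltP => hb.
- by apply: le_trans ab _; rewrite lerDl mulr_ge0.
- have -> : `|enorm a - t| <= rho by rewrite ler_norml; apply/andP; split; lra.
  by rewrite subr0 mulr1 (le_trans (ltW ha)) // lerDr.
- have -> : `|enorm a - t| <= rho by rewrite ler_norml; apply/andP; split; lra.
  by rewrite sub0r enormN mulr1 (le_trans (ltW hb)) // lerDr.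
- by rewrite subr0 enorm0 addr_ge0 // mulr_ge0.
Qed.

Lemma phi_close0 t rho a b : enorm (a - b) <= rho -> t + rho <= enorm a ->
  phi t a - phi t b = 0.
Proof.
move=> ab ta; have := le_trans (enorm_lip a b) ab; rewrite ler_norml => /andP[h1 h2].
have := enorm_ge0 (a - b) => e0.
have -> : phi t a = 0 by rewrite /phi; case: ltP => // h; exfalso; lra.
have -> : phi t b = 0 by rewrite /phi; case: ltP => // h; exfalso; lra.
by rewrite subr0.
Qed.

End truncation.

(** * Truncated kernels *)

Section shells.
Context (R : realType).

Lemma sum_pred_count (T : Type) (s : seq T) (P : pred T) :
  \sum_(x <- s) (P x)%:R = (count P s)%:R :> R.
Proof.
elim: s => [|x s IH]; first by rewrite big_nil.
by rewrite big_cons IH /= natrD.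
Qed.

Lemma count_near (alpha rho : R) (a b : nat) : 0 <= rho ->
  \sum_(a <= t < b) (`|alpha - t%:R| <= rho)%R%:R <= 2 * rho + 1.
Proof.
(* The identity clamped to an interval of length [2 * rho + 1]: it increases by 1 over each counted
   [t], so the count telescopes. *)
move=> r0; pose h (s : R) := Order.min (Order.max s (alpha - rho)) (alpha + rho + 1).
have hb s : alpha - rho <= h s <= alpha + rho + 1.
  rewrite /h; apply/andP; split; last by rewrite ge_min lexx orbT.
  by rewrite le_min le_max lexx orbT /=; lra.
have [ba|/ltnW ab] := leqP b a; first by rewrite big_geq //; lra.
apply: le_trans (_ : \sum_(a <= t < b) (h t.+1%:R - h t%:R) <= _).
  apply: ler_sum => t _; have hm : h t%:R <= h t.+1%:R.
    rewrite /h le_min ge_min; apply/andP; split; last by rewrite ge_min lexx orbT.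
    by rewrite ge_max !le_max lexx orbT ler_nat leqnSn.
  case: (boolP (`|alpha - t%:R| <= rho)) => [|_]; last by rewrite subr_ge0.
  rewrite ler_norml => /andP[h1 h2].
  have e1 : h t%:R = t%:R.
    by rewrite /h max_l ?min_l //; lra.
  have e2 : h t.+1%:R = t.+1%:R.
    by rewrite /h -natr1 max_l ?min_l //; lra.
  by rewrite e1 e2 -[t.+1%:R]natr1 addrAC subrr add0r.
rewrite telescope_sumr //; have /andP[? ?] := hb b%:R; have /andP[? ?] := hb a%:R; lra.
Qed.

(** The jump has size about [2 ^ k] but occurs for at most [2 * rho + 1] values of [t]; averaged
    over the block it costs as much as the displacement plus a constant. *)
Lemma block_shell (alpha rho : R) (k : nat) : 0 <= rho ->
  \sum_(2 ^ k <= t < 2 ^ k.+1) (rho + t%:R * (`|alpha - t%:R| <= rho)%R%:R) <=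
  2 ^+ k * (5 * rho + 2).
Proof.
move=> r0; rewrite big_split /= sumr_const_nat.
have -> : (2 ^ k.+1 - 2 ^ k = 2 ^ k)%N by rewrite expnS; lia.
have h : \sum_(2 ^ k <= t < 2 ^ k.+1) t%:R * (`|alpha - t%:R| <= rho)%R%:R <=
    2 ^+ k.+1 * (2 * rho + 1).
  apply: le_trans (_ : 2 ^+ k.+1 * \sum_(2 ^ k <= t < 2 ^ k.+1) (`|alpha - t%:R| <= rho)%R%:R <= _).
    rewrite mulr_sumr; apply: ler_sum_nat => t /andP[_ tk].
    by rewrite ler_wpM2r // -natrX ler_nat ltnW.
  by rewrite ler_wpM2l ?exprn_ge0 ?count_near.
move: h; rewrite -[rho *+ _]mulr_natl natrX exprS; lra.
Qed.

Lemma sum_block_const (k : nat) (c : R) :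
  \sum_(2 ^ k <= t < 2 ^ k.+1) c = 2 ^+ k * c.
Proof.
rewrite sumr_const_nat -[LHS]mulr_natl; congr (_ * _).
by rewrite -natrX expnS; congr _%:R; lia.
Qed.

(* The dilations [w |-> floor ((J + j) w / J)], [j < J], map the shell injectively
   into disjoint shells. *)
Lemma shell_count (n d : nat) (a : 'I_n -> 'rV[R]_d) (B c sig : R) (rho : nat) :
  (0 < n)%N -> 0 < B -> (forall i, enorm (a i) <= B) -> 0 <= c -> 0 <= sig ->
  c * (count (fun w => `|enorm (lin_comb a (real_coord R w)) - c| <= sig) (zbox n rho))%:R <=
  2 * (4 * sig + 2 * n%:R * B) * (size (zbox n (2 * rho)))%:R.
Proof.
move=> n0 B0 aB c0 s0; set P := (X in count X _); set q := 4 * sig + _.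
have nR : (0 : R) < n%:R by rewrite ltr0n.
have q0 : 0 < q by rewrite /q ltr_wpDl ?mulr_ge0 // !mulr_gt0.
(* Without room for several disjoint dilates, [c] is comparable to [q] and counting the whole box is
   enough. *)
have [cq|cq] := leP c (2 * q).
  apply: ler_pM => //; rewrite ler_nat.
  by apply: leq_trans (count_size P _) _; apply: leq_size_bx; lia.
(* The dilated shells are centred at [(J + j) * c / J], hence spaced by [c / J >= q]. Each has
   half-width at most [2 * sig] plus a rounding error below [n * B], which explains the value of
   [q]. *)
pose J := Num.truncn (c / q).
have /andP[J1 J2] : J%:R * q <= c < J.+1%:R * q.
  by rewrite -ler_pdivlMr // -ltr_pdivrMr // truncn_itv // divr_ge0 // ltW.
have J0 : (0 < J)%N.
  rewrite lt0n; apply/eqP => J00; move: J2; rewrite J00; lra.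
have J0R : (0 : R) < J%:R by rewrite ltr0n.
pose S := [seq w <- zbox n rho | P w].
pose f (p : nat * 'rV[int]_n) : 'rV[int]_n :=
  map_mx (fun x : int => (((J + p.1)%N%:Z * x) %/ J%:Z)%Z) p.2.
pose pairs := [seq (j, w) | j <- iota 0 J, w <- S].
have main : (J * size S <= size (zbox n (2 * rho)))%N.
  have -> : (J * size S = size (map f pairs))%N by rewrite size_map size_allpairs size_iota.
  apply: uniq_leq_size; last first.
    move=> _ /mapP[p /allpairsP[[j w] /= [hj hw ->]] ->].
    move: hw; rewrite mem_filter => /andP[_]; rewrite !mem_bx => hw.
    apply/zn_leP => i; rewrite /f zE /=; have := zn_coord w i.
    move: hj; rewrite mem_iota add0n => /andP[_ hj].
    move: (w 0%R i) => x hx; set y := (J + j)%N%:Z * x.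
    have JZ : J%:Z != 0 by lia.
    have JZ0 : 0 < J%:Z by lia.
    have := divz_eq y J%:Z; have := modz_ge0 y JZ; have := ltz_pmod y JZ0.
    move: (y %/ J%:Z)%Z (y %% J%:Z)%Z => Q r hr1 hr2 hy.
    rewrite leqNgt; apply/negP => hQ.
    have hx' : (x <= rho%:Z) && (- rho%:Z <= x) by lia.
    have [Qp|Qn] := leP 0 Q.
      have : 2 * rho%:Z + 1 <= Q by lia.
      by rewrite /y PoszD in hy; nia.
    have : Q <= - (2 * rho%:Z) - 1 by lia.
    by rewrite /y PoszD in hy; nia.
  have fspec p i : exists r : int, [/\ 0 <= r, r < J%:Z &
      (J%:Z * (f p 0%R i) = (J + p.1)%N%:Z * (p.2 0%R i) - r)].
    have JZ : J%:Z != 0 by lia.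
    have JZ0 : 0 < J%:Z by lia.
    rewrite /f zE; pose y := (J + p.1)%N%:Z * p.2 0%R i; rewrite -/y.
    exists (y %% J%:Z)%Z; split; [exact: modz_ge0|exact: ltz_pmod|].
    have := divz_eq y J%:Z; lia.
  have fnorm p : `|J%:R * enorm (lin_comb a (real_coord R (f p))) - (J + p.1)%:R * enorm (lin_comb a (real_coord R p.2))|
      <= n%:R * ((J%:R - 1) * B).
    rewrite -[J%:R * _]ger0_norm ?mulr_ge0 ?enorm_ge0 // normrM (ger0_norm (enorm_ge0 _)) -enormZ.
    rewrite -[(J + p.1)%:R * _]ger0_norm ?mulr_ge0 ?enorm_ge0 //.
    rewrite (normrM (J + p.1)%:R) (ger0_norm (enorm_ge0 (lin_comb a (real_coord R p.2)))) -enormZ.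
    apply: le_trans (enorm_lip _ _) _; rewrite -!linZ -scaleN1r -linZ -linD.
    apply: lin_le => // [i|]; last by rewrite subr_ge0 ler1n.
    have [r [r0 rJ e]] := fspec p i.
    have -> : J%:R * real_coord R (f p) i + -1 * ((J + p.1)%:R * real_coord R p.2 i) = (- r)%:~R.
      rewrite mulN1r /real_coord -[J%:R]/((J%:Z)%:~R) -[(J + p.1)%:R]/(((J + p.1)%N%:Z)%:~R).
      by rewrite -!intrM -intrB e; congr _%:~R; rewrite addrAC subrr add0r.
    rewrite mulrNz normrN ger0_norm ?ler0z // -[1]/(1%:~R) -[J%:R]/((J%:Z)%:~R) -intrB ler_int.
    by move: rJ; clear; lia.
  rewrite map_inj_in_uniq; last first.
    move=> p p' /allpairsP[[j w] /= [hj hw ->]] /allpairsP[[j' w'] /= [hj' hw' ->]] ef.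
    have := fnorm (j, w); have := fnorm (j', w'); rewrite -ef /=.
    move: hw hw' hj hj'; rewrite !mem_filter !mem_iota !add0n => /andP[hw _] /andP[hw' _] hj hj'.
    set X := J%:R * _; set Y := enorm (lin_comb a (real_coord R w)); set Y' := enorm (lin_comb a (real_coord R w')).
    move: hw hw'; rewrite /P -/Y -/Y' !ler_norml => /andP[y1 y2] /andP[y1' y2'] /andP[z1 z2] /andP[z1' z2'].
    have jJ : j%:R <= J%:R :> R by rewrite ler_nat; case/andP: hj => _ /ltnW.
    have jJ' : j'%:R <= J%:R :> R by rewrite ler_nat; case/andP: hj' => _ /ltnW.
    have j0 : 0 <= j%:R :> R by [].
    have j0' : 0 <= j'%:R :> R by [].
    have c_lt : (c : R) > 0 by lra.
    have dil (l : nat) (y : R) : l%:R <= J%:R :> R -> c - sig <= y -> y <= c + sig ->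
        (J + l)%:R * c - 2 * J%:R * sig <= (J + l)%:R * y /\
        (J + l)%:R * y <= (J + l)%:R * c + 2 * J%:R * sig.
      move=> lJ ya yb; have l0 : 0 <= l%:R :> R by [].
      have l2 : (J + l)%:R * sig <= 2 * J%:R * sig by rewrite ler_wpM2r // natrD; lra.
      have := ler_wpM2l (ler0n R (J + l)) ya; have := ler_wpM2l (ler0n R (J + l)) yb.
      by move: l2; clear; rewrite mulrBr mulrDr; lra.
    have key : `|j%:R * c - j'%:R * c| < c.
      have [d1 d2] := dil j Y jJ ltac:(lra) ltac:(lra).
      have [d1' d2'] := dil j' Y' jJ' ltac:(lra) ltac:(lra).
      have nB : 0 < n%:R * B by rewrite mulr_gt0.
      move: z1 z2 z1' z2' d1 d2 d1' d2' J1 nB; rewrite /q !natrD; clear => z1 z2 z1' z2' d1 d2 d1' d2' J1 nB.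
      by rewrite ltr_norml; apply/andP; split; lra.
    have jj : j = j'.
      move: key; rewrite -mulrBl normrM (gtr0_norm c_lt) -[X in _ < X]mul1r ltr_pM2r //.
      rewrite -[j%:R]/((j%:Z)%:~R) -[j'%:R]/((j'%:Z)%:~R) -intrB -intr_norm -[1]/(1%:~R) ltr_int.
      by clear; lia.
    rewrite -jj in ef *; congr pair; apply: zP => i.
    have [r [r0 rJ e]] := fspec (j, w) i; have [r' [r0' rJ' e']] := fspec (j, w') i.
    move: e e'; rewrite ef /=; move: (w 0%R i) (w' 0%R i) (f _ 0%R i) => x x' F e e'.
    move: e e' r0 r0' rJ rJ'; rewrite PoszD; clear => e e' r0 r0' rJ rJ'.
    have [xx|xx|//] := ltgtP x x'; nia.
  apply: allpairs_uniq; rewrite ?iota_uniq ?filter_uniq ?bx_uniq //.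
  by move=> [x1 x2] [y1 y2] _ _ [-> ->].
have main' : J%:R * (count P (zbox n rho))%:R <= (size (zbox n (2 * rho)))%:R :> R.
  by rewrite -natrM ler_nat -size_filter.
have c2 : c <= 2 * q * J%:R.
  have : (1 : R) <= J%:R by rewrite ler1n.
  by move: J2; rewrite -natr1; nra.
have := ler_wpM2r (ler0n R (count P (zbox n rho))) c2.
have := ler_wpM2l (ltW (mulr_gt0 (ltr0n _ 2) q0)) main'.
lra.
Qed.

End shells.

Section odd_sums.
Context (R : realType) (n d : nat).

Lemma iv_opp (w : 'rV[int]_n) i : real_coord R (- w) i = - 1 * real_coord R w i.
Proof. by rewrite /real_coord zNE intrN mulN1r. Qed.

Lemma lin_iv_opp (A : 'I_n -> 'rV[R]_d) w : lin_comb A (real_coord R (- w)) = - lin_comb A (real_coord R w).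
Proof.
by rewrite -[RHS]scaleN1r -linZ; apply: eq_bigr => i _; rewrite iv_opp.
Qed.

Lemma odd_sum0 (V : lmodType R) r (F : 'rV[int]_n -> V) :
  (forall w, F (- w) = - F w) -> \sum_(w <- zbox n r) F w = 0.
Proof.
move=> h; set S := \sum_(w <- _) _; have e : S = - S.
  by rewrite {1}/S -sum_bx_opp (eq_bigr _ (fun w _ => h w)) sumrN.
have : 2%:R *: S = 0 by rewrite scaler_nat mulr2n {1}e addNr.
by move/eqP; rewrite scaler_eq0 pnatr_eq0 /= => /eqP.
Qed.

End odd_sums.

(** With the linear map in place of [a] the sum vanishes by oddness, the cut being even;
    displacements [e w] and jumps remain. In the square of the jump sum, a pair with [e w' <= e w]
    jumping at a common [t] satisfies [|N w' - N w| <= 2 * e w]. Then [shell_count] bounds the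
    number of such [w'] by about [(e w + 1) / 2 ^ k] of the box, and [count_near] the number of [t]
    by [2 * e w + 1]. *)
Lemma theta_lin (R : realType) (n d : nat) (B : R) : (0 < n)%N -> 0 < B ->
  exists2 C : R, 0 < C & forall (A : 'I_n -> 'rV[R]_d) (a : 'rV[int]_n -> 'rV[R]_d)
    (cut : nat -> 'rV[int]_n -> bool) (k rho : nat),
  (forall i, enorm (A i) <= B) -> (forall t w, cut t (- w) = cut t w) ->
  \sum_(2 ^ k <= t < 2 ^ k.+1)
     enorm (\sum_(w <- zbox n rho) if cut t w then phi t%:R (a w) else 0) ^+ 2 <=
  C * 2 ^+ k * (size (zbox n (2 * rho)))%:R *
    \sum_(w <- zbox n rho) (enorm (a w - lin_comb A (real_coord R w)) ^+ 2 + 1).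
Proof.
move=> n0 B0; pose b := n%:R * B; have b0 : 0 < b by rewrite mulr_gt0 ?ltr0n.
exists (2 + 16 * (60 + 16 * b)); first by lra.
move=> A a cut k rho AB cutN.
pose e w := enorm (a w - lin_comb A (real_coord R w)); pose N w := enorm (lin_comb A (real_coord R w)).
pose I w (t : nat) : R := (`|N w - t%:R| <= e w)%R%:R.
set N2 := (size _)%:R; set E := \sum_(w <- _) (_ + 1).
have e0 w : 0 <= e w by apply: enorm_ge0.
have I0 w t : 0 <= I w t by [].
have I1 w t : I w t <= 1 by rewrite /I; case: (`|_| <= _).
have p2 : 0 <= 2 ^+ k :> R by rewrite exprn_ge0.

have h1 (t : nat) :
    enorm (\sum_(w <- zbox n rho) if cut t w then phi t%:R (a w) else 0) <=
    \sum_(w <- zbox n rho) e w + t%:R * \sum_(w <- zbox n rho) I w t.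
  have z : \sum_(w <- zbox n rho) (if cut t w then phi t%:R (lin_comb A (real_coord R w)) else 0) = 0.
    apply: odd_sum0 => w; rewrite cutN lin_iv_opp phiN; case: ifP => //.
    by rewrite oppr0.
  rewrite -[X in enorm X]subr0 -[X in _ - X]z -sumrB; apply: le_trans (enorm_sum _ _) _.
  rewrite mulr_sumr -big_split /=; apply: ler_sum => w _; case: ifP => _.
    rewrite enormB; apply: phi_close => //; by rewrite enormB.
  by rewrite subr0 enorm0 addr_ge0 // mulr_ge0.
have h3 : (\sum_(w <- zbox n rho) e w) ^+ 2 <= N2 * \sum_(w <- zbox n rho) e w ^+ 2.
  apply: le_trans (sum_sqr_le _ _) _; rewrite ler_wpM2r ?sumr_ge0 //.
    by move=> w _; rewrite sqr_ge0.
  by rewrite ler_nat leq_size_bx //; lia.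
pose Q w w' := \sum_(2 ^ k <= t < 2 ^ k.+1) I w t * I w' t.
have Q0 w w' : 0 <= Q w w' by apply: sumr_ge0 => t _; rewrite mulr_ge0.
have h5 : \sum_(2 ^ k <= t < 2 ^ k.+1) (\sum_(w <- zbox n rho) I w t) ^+ 2 <=
    2 * \sum_(w <- zbox n rho) \sum_(w' <- zbox n rho) (e w' <= e w)%R%:R * Q w w'.
  have -> : \sum_(2 ^ k <= t < 2 ^ k.+1) (\sum_(w <- zbox n rho) I w t) ^+ 2 =
      \sum_(w <- zbox n rho) \sum_(w' <- zbox n rho) Q w w'.
    rewrite /Q; under [RHS]eq_bigr do rewrite exchange_big /=.
    rewrite [RHS]exchange_big /=; apply: eq_bigr => t _.
    by rewrite expr2 mulr_suml; apply: eq_bigr => w _; rewrite mulr_sumr.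
  have -> : 2 * \sum_(w <- zbox n rho) \sum_(w' <- zbox n rho) (e w' <= e w)%R%:R * Q w w' =
     \sum_(w <- zbox n rho) \sum_(w' <- zbox n rho) ((e w' <= e w)%R%:R * Q w w' + (e w <= e w')%R%:R * Q w w').
    under [RHS]eq_bigr do rewrite big_split /=.
    rewrite big_split /= mulr_natl mulr2n; congr (_ + _).
    rewrite [RHS]exchange_big /=; apply: eq_bigr => w _; apply: eq_bigr => w' _.
    by congr (_ * _); apply: eq_bigr => t _; rewrite mulrC.
  apply: ler_sum => w _; apply: ler_sum => w' _; rewrite -mulrDl.
  apply: ler_peMl => //; have [ee|/ltW ee] := leP (e w') (e w).
    by rewrite lerDl.
  by rewrite ee lerDr.
have h6 w : 2 ^+ k * (\sum_(w' <- zbox n rho) (e w' <= e w)%R%:R * Q w w') <=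
    (60 + 16 * b) * (e w ^+ 2 + 1) * N2.
  have N20 : 0 <= N2 by [].
  (* If [N w + e w] lies below the block, [w] jumps nowhere in it; otherwise the factor [2 ^ k] is
     traded for the radius of the shell. *)
  have [hN|hN] := leP (2 ^+ k) (N w + e w); last first.
    rewrite big1 ?mulr0 ?mulr_ge0 //; first by have := sqr_ge0 (e w); lra.
      by have := sqr_ge0 (e w); lra.
    move=> w' _; rewrite /Q big_nat big1 ?mulr0 // => t /andP[tk _].
    have kt : 2 ^+ k <= t%:R :> R by rewrite -natrX ler_nat.
    rewrite /I; case: (boolP (`|N w - t%:R| <= e w)); rewrite ?mul0r //.
    by rewrite ler_norml => /andP[x1 x2]; exfalso; lra.
  pose S := count (fun w' => `|N w' - N w| <= 2 * e w) (zbox n rho).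
  have hS : \sum_(w' <- zbox n rho) (e w' <= e w)%R%:R * Q w w' <= (2 * e w + 1) * S%:R.
    rewrite -sum_pred_count mulr_sumr; apply: ler_sum => w' _.
    case: (boolP (e w' <= e w)) => ee; last by rewrite mul0r mulr_ge0 // addr_ge0 ?mulr_ge0.
    rewrite mul1r; case: (boolP (`|N w' - N w| <= 2 * e w)) => NN.
      rewrite mulr1; apply: le_trans (count_near (N w) (2 ^ k) (2 ^ k.+1) (e0 w)).
      by apply: ler_sum => t _; rewrite -[leRHS]mulr1 ler_wpM2l // I1.
    rewrite mulr0 /Q big1 // => t _; rewrite /I.
    case: (boolP (`|N w - t%:R| <= e w)) => h1'; rewrite ?mul0r //.
    case: (boolP (`|N w' - t%:R| <= e w')) => h2'; rewrite ?mulr0 //.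
    exfalso; move: NN; rewrite -ltNge; apply/negP; rewrite -leNgt.
    move: h1' h2'; rewrite !ler_norml => /andP[x1 x2] /andP[x3 x4].
    by apply/andP; split; lra.
  have hc : N w * S%:R <= 2 * (4 * (2 * e w) + 2 * n%:R * B) * N2.
    by apply: shell_count => //; [exact: enorm_ge0|rewrite mulr_ge0].
  have SN : S%:R <= N2.
    rewrite ler_nat; apply: leq_trans (count_size _ _) _; apply: leq_size_bx; lia.
  have ew := e0 w.
  have h7 : 2 ^+ k * S%:R <= (17 * e w + 4 * b) * N2.
    have h8 := ler_wpM2r (ler0n R S) hN; have h9 := ler_wpM2l ew SN.
    by move: h8 h9 hc; rewrite /b; clear; lra.
  have e21 : 0 <= 2 * e w + 1 by rewrite addr_ge0 ?mulr_ge0.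

  have h10 := ler_wpM2l p2 hS; have h11 := ler_wpM2l e21 h7.
  apply: le_trans h10 _; rewrite mulrCA; apply: le_trans h11 _.
  rewrite mulrA ler_wpM2r //; move: b0 ew; clear => b0 ew.
  have := sqr_ge0 (e w - 1); nra.
have h7 : 2 ^+ k * (\sum_(2 ^ k <= t < 2 ^ k.+1) (\sum_(w <- zbox n rho) I w t) ^+ 2) <=
   2 * (60 + 16 * b) * N2 * E.

  apply: le_trans (ler_wpM2l p2 h5) _; rewrite mulrCA -!mulrA ler_wpM2l // mulr_sumr /E.
  rewrite mulrA mulr_sumr; apply: ler_sum => w _; apply: le_trans (h6 w) _.
  by rewrite -/(e w) le_eqVlt; apply/orP; left; apply/eqP; ring.
have tot : \sum_(2 ^ k <= t < 2 ^ k.+1)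
     enorm (\sum_(w <- zbox n rho) if cut t w then phi t%:R (a w) else 0) ^+ 2 <=
   2 ^+ k * (2 * (\sum_(w <- zbox n rho) e w) ^+ 2) +
   2 * (2 ^+ k.+1) ^+ 2 * \sum_(2 ^ k <= t < 2 ^ k.+1) (\sum_(w <- zbox n rho) I w t) ^+ 2.
  rewrite -sum_block_const mulr_sumr -big_split /=; apply: ler_sum_nat => t /andP[_ tk].
  apply: le_trans (_ : (\sum_(w <- zbox n rho) e w + t%:R * \sum_(w <- zbox n rho) I w t) ^+ 2 <= _).
    by rewrite lerXn2r ?nnegrE ?enorm_ge0 // (le_trans _ (h1 t)) ?enorm_ge0.
  set x := \sum_(w <- _) e w; set y := \sum_(w <- _) I w t.
  have tk' : t%:R <= 2 ^+ k.+1 :> R by rewrite -natrX ler_nat ltnW.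
  have ty : (t%:R * y) ^+ 2 <= (2 ^+ k.+1) ^+ 2 * y ^+ 2.
    by rewrite exprMn ler_wpM2r ?sqr_ge0 // lerXn2r ?nnegrE ?exprn_ge0.
  by have := sqr_ge0 (x - t%:R * y); move: ty; clear; nra.
have E1 : \sum_(w <- zbox n rho) e w ^+ 2 <= E.
  by apply: ler_sum => w _; rewrite lerDl.

have N20 : 0 <= N2 by [].
have h8 := ler_wpM2l p2 (ler_wpM2l N20 E1); have h9 := ler_wpM2l p2 h3.
have h10 := ler_wpM2l p2 h7.
apply: le_trans tot _; rewrite [2 ^+ k.+1]exprS; move: h8 h9 h10; clear; lra.
Qed.

Section kernel.
Context (R : realType) (n d : nat) (M : R) (g : 'rV[int]_n -> 'rV[R]_d) (C0 : nat).
Context (gLip : forall u v, enorm (g u - g v) <= M * (znorm (u - v))%:R).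
Context (M0 : 0 <= M) (C0p : (0 < C0)%N).
Implicit Types (u v w z : 'rV[int]_n) (r s k rho t : nat) (F q : 'rV[int]_n -> R).

(** The cutoff in the parameter keeps the support finite, since a Lipschitz [g] may return near
    [g u] far from [u]. Its radius is proportional to [t], so its jump is averaged over a block like
    that of the sphere. *)
Definition psi t u w : 'rV[R]_d :=
  if (znorm w < C0 * t)%N then phi t%:R (g (u + w) - g u) else 0.

Lemma psi_le t u w : enorm (psi t u w) <= t%:R.
Proof. by rewrite /psi; case: ifP => _; rewrite ?phi_le ?enorm0. Qed.

Lemma psi_neq0 t u w : psi t u w != 0 -> (znorm w < C0 * t)%N.
Proof. by rewrite /psi; case: ifP => //; rewrite eqxx. Qed.

Lemma psi_diff t u w z s : (znorm z <= s)%N ->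
  enorm (psi t u w - psi t u (w + z)) <=
    (M * s%:R + t%:R * (`|enorm (g (u + w) - g u) - t%:R| <= M * s%:R)%R%:R) +
    (s%:R + t%:R * (`|(znorm w)%:R / C0%:R - t%:R| <= s%:R :> R)%R%:R).
Proof.
move=> zs; set J2 := (X in _ + (_ + _ * X)).
have Ms : 0 <= M * s%:R by rewrite mulr_ge0.
have ab : enorm ((g (u + w) - g u) - (g (u + (w + z)) - g u)) <= M * s%:R.
  have -> : (g (u + w) - g u) - (g (u + (w + z)) - g u) = g (u + w) - g (u + (w + z)).
    by rewrite opprB addrA subrK.
  apply: le_trans (gLip _ _) _; rewrite ler_wpM2l // ler_nat.
  have -> : u + w - (u + (w + z)) = - z by apply: zP => i; rewrite !zE; lia.
  by rewrite znN.
have J20 : 0 <= s%:R + t%:R * J2 by rewrite addr_ge0 ?mulr_ge0 ?/J2.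
have h := phi_close (ler0n R t) ab.
have J1 : 0 <= M * s%:R + t%:R * (`|enorm (g (u + w) - g u) - t%:R| <= M * s%:R)%R%:R.
  by rewrite addr_ge0 ?mulr_ge0.
have aux (a : nat) : `|a%:R - C0%:R * t%:R| <= s%:R :> R -> `|a%:R / C0%:R - t%:R| <= s%:R :> R.
  have c1 : 1 <= C0%:R :> R by rewrite ler1n.
  have -> : a%:R / C0%:R - t%:R = (a%:R - C0%:R * t%:R) / C0%:R :> R.
    by field; rewrite pnatr_eq0 -lt0n.
  move=> h1; rewrite normrM normfV (ger0_norm (ler0n R C0)) ler_pdivrMr ?ltr0n //.
  by apply: le_trans h1 _; rewrite ler_peMr.
rewrite /psi; case: (ltnP (znorm w)) => h1; case: (ltnP (znorm (w + z))) => h2.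
- by apply: le_trans h _; rewrite lerDl.
- have -> : J2 = 1.
    rewrite /J2 aux // -natrM distrC ger0_norm ?subr_ge0 ?ler_nat; last exact: ltnW.
    rewrite lerBlDr -natrD ler_nat; apply: leq_trans h2 _.
    by apply: leq_trans (znD _ _) _; rewrite addnC leq_add2r.
  by rewrite subr0 mulr1; have := phi_le (g (u + w) - g u) (ler0n R t); move: J1; have := ler0n R s; lra.
- have -> : J2 = 1.
    rewrite /J2 aux // -natrM ger0_norm ?subr_ge0 ?ler_nat //.
    rewrite lerBlDr -natrD ler_nat; have := znD (w + z) (- z).
    by rewrite addrK znN; move: zs h2; clear; lia.
  by rewrite sub0r enormN mulr1; have := phi_le (g (u + (w + z)) - g u) (ler0n R t); move: J1; have := ler0n R s; lra.
- by rewrite subr0 enorm0 addr_ge0.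
Qed.

(** Summation by parts moves the difference onto the kernel, and Cauchy-Schwarz is taken with weight
    [del]. Over [w] the weight is summed trivially; over [t] its sum is of order [s * 2 ^ k]. The
    gain over [kernel_osc] is the factor [s / 2 ^ k]. *)
Lemma kernel_diff k s r rho z F : (znorm z <= s)%N -> (0 < s)%N ->
  (C0 * 2 ^ k.+1 + s <= rho)%N ->
  \sum_(u <- zbox n r) \sum_(2 ^ k <= t < 2 ^ k.+1)
    enorm (\sum_(w <- zbox n rho) (F (u + w) - F (u + w - z)) *: psi t u w) ^+ 2 <=
  4 * (5 * M + 9) * s%:R * (4 ^+ k) * (size (zbox n rho))%:R ^+ 2 *
    \sum_(v <- zbox n (r + rho)) F v ^+ 2.
Proof.
move=> zs s0 hrho; set N := (size (zbox n rho))%:R; set FF := (X in _ <= _ * X).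
have s1 : 1 <= s%:R :> R by rewrite ler1n.
pose del t u w := enorm (psi t u w - psi t u (w + z)).
have del0 t u w : 0 <= del t u w by apply: enorm_ge0.
have step1 u t : (2 ^ k <= t < 2 ^ k.+1)%N ->
    enorm (\sum_(w <- zbox n rho) (F (u + w) - F (u + w - z)) *: psi t u w) ^+ 2 <=
    N * (4 * 2 ^+ k) * \sum_(w <- zbox n rho) del t u w * F (u + w) ^+ 2.
  move=> /andP[_ tk].
  have -> : \sum_(w <- zbox n rho) (F (u + w) - F (u + w - z)) *: psi t u w =
      \sum_(w <- zbox n rho) F (u + w) *: (psi t u w - psi t u (w + z)).
    under eq_bigr do rewrite scalerBl; under [RHS]eq_bigr do rewrite scalerBr.
    rewrite !sumrB; congr (_ - _).
    have h := @sum_bx_supp n 'rV[R]_d rho rho z (fun w => F (u + w - z) *: psi t u w).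
    rewrite -h; first by apply: eq_bigr => w _; rewrite addrA addrK.
    move=> w; rewrite scaler_eq0 negb_or => /andP[_ /psi_neq0 hw].
    have hw' : (znorm w < C0 * 2 ^ k.+1)%N by apply: leq_trans hw _; rewrite leq_mul2l ltnW ?orbT.
    by have := znD w (- z); rewrite znN; move: hw' hrho zs; clear; lia.
  have e1 : enorm (\sum_(w <- zbox n rho) F (u + w) *: (psi t u w - psi t u (w + z))) <=
      \sum_(w <- zbox n rho) del t u w * `|F (u + w)|.
    apply: le_trans (enorm_sum _ _) _; apply: ler_sum => w _.
    by rewrite enormZ mulrC.
  apply: le_trans (_ : (\sum_(w <- zbox n rho) del t u w * `|F (u + w)|) ^+ 2 <= _).
    by rewrite lerXn2r ?nnegrE ?enorm_ge0 // (le_trans _ e1) ?enorm_ge0.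
  apply: le_trans (wcauchy_schwarz _ _ (del0 t u)) _.
  have -> : \sum_(w <- zbox n rho) del t u w * `|F (u + w)| ^+ 2 = \sum_(w <- zbox n rho) del t u w * F (u + w) ^+ 2.
    by apply: eq_bigr => w _; rewrite real_normK ?num_real.
  apply: ler_wpM2r; first by apply: sumr_ge0 => w _; rewrite mulr_ge0 ?sqr_ge0.
  apply: sum_le_const => w _; apply: le_trans (enormD _ _) _; rewrite enormN.
  have := psi_le t u w; have := psi_le t u (w + z).
  have : t%:R <= 2 * 2 ^+ k :> R by rewrite -exprS -natrX ler_nat ltnW.
  by clear; lra.
have step2 u w : \sum_(2 ^ k <= t < 2 ^ k.+1) del t u w <= 2 ^+ k * ((5 * M + 9) * s%:R).
  apply: le_trans (ler_sum _ (fun t _ => psi_diff t u w zs)) _.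
  rewrite big_split /=.
  have Ms : 0 <= M * s%:R by rewrite mulr_ge0.
  have h1 := block_shell (enorm (g (u + w) - g u)) k Ms.
  have h2 := block_shell ((znorm w)%:R / C0%:R) k (ler0n R s).
  have p2 : 0 <= 2 ^+ k :> R by rewrite exprn_ge0.
  have h3 := ler_wpM2l p2 s1.
  by move: h1 h2 h3; clear; lra.
apply: le_trans (_ : N * (4 * 2 ^+ k) * (2 ^+ k * ((5 * M + 9) * s%:R)) *
    (\sum_(w <- zbox n rho) \sum_(u <- zbox n r) F (u + w) ^+ 2) <= _); last first.
  have h : \sum_(w <- zbox n rho) \sum_(u <- zbox n r) F (u + w) ^+ 2 <= N * FF.
    apply: sum_le_const => w; rewrite mem_bx => hw.
    apply: (@sum_bx_shift _ _ _ _ w (fun u => F u ^+ 2)); first by rewrite leq_add2l.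
    by move=> u; rewrite sqr_ge0.
  have c0 : 0 <= N * (4 * 2 ^+ k) * (2 ^+ k * ((5 * M + 9) * s%:R)).
    by rewrite !mulr_ge0 ?exprn_ge0 ?addr_ge0 ?mulr_ge0.
  apply: le_trans (ler_wpM2l c0 h) _; rewrite le_eqVlt; apply/orP; left; apply/eqP.
  have -> : (4 : R) ^+ k = 2 ^+ k * 2 ^+ k by rewrite -exprMn; congr (_ ^+ _); ring.
  ring.
rewrite [X in _ <= _ * X]exchange_big /= mulr_sumr; apply: ler_sum => u _.
apply: le_trans (ler_sum_nat (G := fun t => N * (4 * 2 ^+ k) * \sum_(w <- zbox n rho) del t u w * F (u + w) ^+ 2) (fun t ht => step1 u t ht)) _.
rewrite -mulr_sumr -[leRHS]mulrA; apply: ler_wpM2l; first by rewrite !mulr_ge0 ?exprn_ge0.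
rewrite exchange_big /= mulr_sumr; apply: ler_sum => w _; rewrite -mulr_suml; apply: ler_wpM2r (step2 u w).
exact: sqr_ge0.
Qed.

Lemma kernel_osc k r rho q (X : R) :
  (forall w, (znorm w <= rho)%N -> \sum_(u <- zbox n r) (q (u + w) - q u) ^+ 2 <= X) ->
  \sum_(u <- zbox n r) \sum_(2 ^ k <= t < 2 ^ k.+1)
    enorm (\sum_(w <- zbox n rho) (q (u + w) - q u) *: psi t u w) ^+ 2 <=
  4 * 8 ^+ k * (size (zbox n rho))%:R ^+ 2 * X.
Proof.
move=> hX; set N := (size (zbox n rho))%:R.
have step u t : (2 ^ k <= t < 2 ^ k.+1)%N ->
   enorm (\sum_(w <- zbox n rho) (q (u + w) - q u) *: psi t u w) ^+ 2 <=
   N * (4 * 4 ^+ k * \sum_(w <- zbox n rho) (q (u + w) - q u) ^+ 2).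
  move=> /andP[_ tk]; apply: le_trans (enorm_sum_sqr _ _) _; rewrite ler_wpM2l //.
  rewrite mulr_sumr; apply: ler_sum => w _; rewrite enormZ exprMn real_normK ?num_real //.
  rewrite mulrC ler_wpM2r ?sqr_ge0 //.
  have -> : 4 * 4 ^+ k = (2 ^+ k.+1) ^+ 2 :> R by rewrite -exprM mulnC exprM -exprS expr2; congr (_ ^+ _); ring.
  rewrite lerXn2r ?nnegrE ?enorm_ge0 ?exprn_ge0 //; apply: le_trans (psi_le _ _ _) _.
  by rewrite -natrX ler_nat ltnW.
apply: le_trans (_ : \sum_(u <- zbox n r) 2 ^+ k * (N * (4 * 4 ^+ k * \sum_(w <- zbox n rho) (q (u + w) - q u) ^+ 2)) <= _).
  by apply: ler_sum => u _; rewrite -sum_block_const; apply: ler_sum_nat => t; apply: step.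
rewrite -!mulr_sumr exchange_big /=.
have h : \sum_(w <- zbox n rho) \sum_(u <- zbox n r) (q (u + w) - q u) ^+ 2 <= N * X.
  by apply: sum_le_const => w; rewrite mem_bx => /hX.
have c0 : 0 <= 2 ^+ k * (N * (4 * 4 ^+ k)) :> R.
  by rewrite !mulr_ge0 ?exprn_ge0.
have := ler_wpM2l c0 h; have -> : (8 : R) ^+ k = 2 ^+ k * 4 ^+ k by rewrite -exprMn; congr (_ ^+ _); ring.
by clear; lra.
Qed.

End kernel.

Lemma kernel_one (R : realType) (n d : nat) (M : R) : (0 < n)%N -> exists2 C : R, 0 < C &
  forall (g : 'rV[int]_n -> 'rV[R]_d) (C0 : nat),
  (forall u v, enorm (g u - g v) <= M * (znorm (u - v))%:R) ->
  forall k l r rho, 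
  \sum_(u <- zbox n r) \sum_(2 ^ k <= t < 2 ^ k.+1)
    enorm (\sum_(w <- zbox n rho) psi g C0 t u w) ^+ 2 <=
  C * 2 ^+ k * (size (zbox n (2 * rho)))%:R *
    \sum_(w <- zbox n rho) \sum_(u <- zbox n r) (enorm (taylor_rem g l u w) ^+ 2 + 1).
Proof.
move=> n0; have B0 : 0 < `|M| + 1 by rewrite ltr_wpDl.
have [C Cp h] := theta_lin d n0 B0.
exists C => // g C0 gLip k l r rho; rewrite [X in _ <= _ * X]exchange_big /= mulr_sumr.
apply: ler_sum => u _.
apply: (h (slope g l u) (fun w => g (u + w) - g u) (fun t w => znorm w < C0 * t)%N).
  by move=> i; apply: le_trans (gr_le gLip l u i) _; rewrite lerDl.
by move=> t w; rewrite znN.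
Qed.

Lemma sum_pair_sqr (R : realType) (T : Type) (s : seq T) (x : T -> R) :
  \sum_(e <- s) \sum_(e' <- s) (x e - x e') ^+ 2 =
  2 * (size s)%:R * (\sum_(e <- s) x e ^+ 2) - 2 * (\sum_(e <- s) x e) ^+ 2.
Proof.
transitivity (\sum_(e <- s) \sum_(e' <- s) (x e ^+ 2 + x e' ^+ 2 - 2 * (x e * x e'))).
  by apply: eq_bigr => e _; apply: eq_bigr => e' _; ring.
under eq_bigr do rewrite sumrB big_split /= sum_const_seq -!mulr_sumr.
rewrite sumrB big_split /= sum_const_seq -!mulr_sumr -mulr_suml.
by rewrite expr2; ring.
Qed.

Lemma sqr_avg_le (R : realType) (T : eqType) (s : seq T) (F : T -> R) (X : R) :
  (0 < size s)%N -> (size s)%:R^-1 * \sum_(x <- s) F x ^+ 2 <= X ->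
  ((size s)%:R^-1 * \sum_(x <- s) F x) ^+ 2 <= X.
Proof.
move=> s0; apply: le_trans; rewrite exprMn expr2 -mulrA ler_wpM2l ?invr_ge0 //.
by rewrite ler_pdivrMl ?ltr0n // sum_sqr_le.
Qed.

Lemma avg_le (R : realType) (T : eqType) (s : seq T) (F : T -> R) (X : R) :
  (0 < size s)%N -> (forall x, x \in s -> F x <= X) ->
  (size s)%:R^-1 * \sum_(x <- s) F x <= X.
Proof.
by move=> s0 h; rewrite ler_pdivrMl ?ltr0n // sum_le_const.
Qed.

(** * Density at dyadic scales *)

Section density.
Context (R : realType) (n : nat) (I : finType) (m : I -> R) (pos : I -> 'rV[int]_n).
Context (lev : I -> nat) (m0 : forall i, 0 <= m i).
Implicit Types (u v w x z e : 'rV[int]_n) (r k j : nat) (i : I).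

Let W k : R := (size (zcube n k))%:R.

Let W_gt0 k : 0 < W k.
Proof. by rewrite ltr0n size_cb !expn_gt0. Qed.

Let W_neq0 k : W k != 0.
Proof. by rewrite gt_eqF. Qed.

Let WS k : W k.+1 = W 1 * W k.
Proof. by rewrite /W -natrM !size_cb -expnMn -expnS. Qed.

Lemma sum_cbS (V : nmodType) (F : 'rV[int]_n -> V) k :
  \sum_(c <- zcube n k.+1) F c = \sum_(e <- zcube n 1) \sum_(c <- zcube n k) F (c + e *+ 2 ^ k).
Proof. by rewrite (perm_big _ (cbS n k)) /= big_allpairs_dep. Qed.

(** The mean density, over the cube of side [2 ^ k] with lower corner [v], of the masses whose level
    is at most [k]. *)
Definition dens k v : R :=
  (W k)^-1 * \sum_(i | (lev i <= k)%N) m i * \sum_(c <- zcube n k) (v == pos i - c)%:R.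

Definition tent k v : R := (W k)^-1 * \sum_(c <- zcube n k) dens k (v - c).

(** The transpose of [tent]: the same weights applied to a test function, as [tent_pair]
    expresses. *)
Definition smear (V : lmodType R) k (psi : 'rV[int]_n -> V) x : V :=
  (W k ^+ 2)^-1 *: \sum_(c <- zcube n k) \sum_(c' <- zcube n k) psi (x + c - c').

Lemma dens_ge0 k v : 0 <= dens k v.
Proof.
rewrite mulr_ge0 ?invr_ge0 //; apply: sumr_ge0 => i _; rewrite mulr_ge0 //.
by apply: sumr_ge0 => c _.
Qed.

Lemma pair_delta (V : lmodType R) rho (psi : 'rV[int]_n -> V) u x :
  (forall w, psi w != 0 -> (znorm w <= rho)%N) ->
  \sum_(w <- zbox n rho) (u + w == x)%:R *: psi w = psi (x - u).
Proof.
move=> h; have E w : (u + w == x) = (w == x - u) by rewrite [RHS]eq_sym subr_eq (addrC w) eq_sym.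
under eq_bigr do rewrite E.
have [xin|xout] := boolP (x - u \in zbox n rho).
  rewrite (big_rem _ xin) /= eqxx scale1r big_seq big1 ?addr0 // => w.
  by rewrite mem_rem_uniq ?bx_uniq // inE => /andP[/negbTE -> _]; rewrite scale0r.
have -> : psi (x - u) = 0.
  by apply/eqP; apply: contraNT xout => /h; rewrite mem_bx.
rewrite big_seq big1 // => w wb; case: eqP => [wx|_]; last by rewrite scale0r.
by rewrite -wx wb in xout.
Qed.

Lemma tentE k v : tent k v = \sum_(i | (lev i <= k)%N) m i *
  ((W k ^+ 2)^-1 * \sum_(c <- zcube n k) \sum_(c' <- zcube n k) (v == pos i + c - c')%:R).
Proof.
rewrite /tent /dens -mulr_sumr mulrA -invfM -expr2 exchange_big mulr_sumr /=.
apply: eq_bigr => i _; rewrite -mulr_sumr mulrCA; congr (_ * (_ * _)).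
apply: eq_bigr => c _; apply: eq_bigr => c' _; congr (nat_of_bool _)%:R.
by rewrite subr_eq addrAC.
Qed.

Lemma tent_pair (V : lmodType R) k rho (psi : 'rV[int]_n -> V) u :
  (forall w, psi w != 0 -> (znorm w <= rho)%N) ->
  \sum_(w <- zbox n rho) tent k (u + w) *: psi w =
  \sum_(i | (lev i <= k)%N) m i *: smear k psi (pos i - u).
Proof.
move=> h; under eq_bigr do rewrite tentE scaler_suml.
rewrite exchange_big /=; apply: eq_bigr => i _.
under eq_bigr do rewrite -!scalerA; rewrite -!scaler_sumr; congr (_ *: (_ *: _)).
under eq_bigr do rewrite scaler_suml.
rewrite exchange_big /=; apply: eq_bigr => c _.
under eq_bigr do rewrite scaler_suml.
rewrite exchange_big /=; apply: eq_bigr => c' _.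
by rewrite pair_delta //; congr (psi _); apply: zP => l; rewrite !zE; lia.
Qed.

Lemma smearS (V : lmodType R) k (psi : 'rV[int]_n -> V) x :
  smear k.+1 psi x = (W 1 ^+ 2)^-1 *:
    \sum_(e <- zcube n 1) \sum_(e' <- zcube n 1) smear k psi (x + (e - e') *+ 2 ^ k).
Proof.
rewrite /smear WS exprMn invfM -scalerA; congr (_ *: _).
rewrite sum_cbS scaler_sumr; apply: eq_bigr => e _.
under eq_bigr do rewrite sum_cbS; rewrite exchange_big /= scaler_sumr.
apply: eq_bigr => e' _; congr (_ *: _); apply: eq_bigr => c _; apply: eq_bigr => c' _.
by congr (psi _); apply: zP => l; rewrite !zE; lia.
Qed.

(** Exchanging [e] and [e'] reverses the shift, so the mean over shifts can be symmetrized into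
    second differences. *)
Lemma sum_sym_diff (V : lmodType R) k (F : 'rV[int]_n -> V) x :
  F x - (W 1 ^+ 2)^-1 *: \sum_(e <- zcube n 1) \sum_(e' <- zcube n 1) F (x + (e - e') *+ 2 ^ k) =
  (2 * W 1 ^+ 2)^-1 *: \sum_(e <- zcube n 1) \sum_(e' <- zcube n 1)
     (F x *+ 2 - F (x + (e - e') *+ 2 ^ k) - F (x - (e - e') *+ 2 ^ k)).
Proof.
set S := \sum_(e <- zcube n 1) \sum_(e' <- zcube n 1) F (x + (e - e') *+ 2 ^ k).
have e1 : \sum_(e <- zcube n 1) \sum_(e' <- zcube n 1) F (x - (e - e') *+ 2 ^ k) = S.
  rewrite /S exchange_big /=; apply: eq_bigr => e _; apply: eq_bigr => e' _.
  by rewrite -mulNrn opprB.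
have e2 : \sum_(e <- zcube n 1) \sum_(e' <- zcube n 1) F x *+ 2 = (2 * W 1 ^+ 2) *: F x.
  under eq_bigr do rewrite big_const_seq count_predT iter_addr_0.
  rewrite big_const_seq count_predT iter_addr_0 -!mulrnA -scaler_nat; congr (_ *: _).
  by rewrite /W -natrX -natrM; congr _%:R; lia.
under [X in _ = _ *: X]eq_bigr do rewrite !sumrB.
have w1 := W_neq0 1.
rewrite !sumrB e1 e2 -/S !scalerBr scalerA mulVf; last first.
  by rewrite mulf_neq0 ?expf_neq0 // pnatr_eq0.
rewrite scale1r -addrA -opprD -scalerDl; congr (_ - _ *: _).
by field.
Qed.

(** Half of a second difference: [tdiff j z v - tdiff j z (v - z)] is [2 * tent j v - tent j (v + z)
    - tent j (v - z)]. The outer difference goes to the kernel, the inner one to the energy. *)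
Definition tdiff j z v : R := tent j v - tent j (v + z).

(* Each index enters at its own level [lev i]; the smearing is then coarsened up to
   the common level [K], one scale at a time. *)
Lemma smear_decomp (V : lmodType R) K rho rho' (psi : 'rV[int]_n -> V) u :
  (forall w, psi w != 0 -> (znorm w <= rho)%N) -> (rho <= rho')%N ->
  \sum_(i | (lev i <= K)%N) m i *: smear (lev i) psi (pos i - u) =
  \sum_(w <- zbox n rho) tent K (u + w) *: psi w +
  \sum_(j < K) (2 * W 1 ^+ 2)^-1 *: \sum_(e <- zcube n 1) \sum_(e' <- zcube n 1)
    \sum_(w <- zbox n rho') (tdiff j ((e - e') *+ 2 ^ j) (u + w) -
                           tdiff j ((e - e') *+ 2 ^ j) (u + w - (e - e') *+ 2 ^ j)) *: psi w.
Proof.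
move=> hr rr.
have hr' w : psi w != 0 -> (znorm w <= rho')%N by move=> /hr /leq_trans; apply.
have D j : (2 * W 1 ^+ 2)^-1 *: \sum_(e <- zcube n 1) \sum_(e' <- zcube n 1)
    \sum_(w <- zbox n rho') (tdiff j ((e - e') *+ 2 ^ j) (u + w) -
                           tdiff j ((e - e') *+ 2 ^ j) (u + w - (e - e') *+ 2 ^ j)) *: psi w =
   \sum_(i | (lev i <= j)%N) m i *: (smear j psi (pos i - u) - smear j.+1 psi (pos i - u)).
  under [RHS]eq_bigr => i _.
    rewrite smearS (sum_sym_diff j (smear j psi)) scalerA mulrC -scalerA scaler_sumr; over.
  rewrite -[RHS]scaler_sumr [X in _ = _ *: X]exchange_big /=; congr (_ *: _); apply: eq_bigr => e _.
  under [RHS]eq_bigr do rewrite scaler_sumr.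
  rewrite [RHS]exchange_big /=; apply: eq_bigr => e' _; set z := (e - e') *+ 2 ^ j.
  transitivity (2%:R *: (\sum_(w <- zbox n rho') tent j (u + w) *: psi w) -
     \sum_(w <- zbox n rho') tent j (u - z + w) *: psi w - \sum_(w <- zbox n rho') tent j (u + z + w) *: psi w).
    rewrite scaler_sumr -!sumrB; apply: eq_bigr => w _; rewrite /tdiff subrK scalerA -!scalerBl.
    by congr (_ *: _); rewrite (addrAC u w z) (addrAC u w (- z)); ring.
  rewrite !tent_pair // scaler_sumr -!sumrB; apply: eq_bigr => i _.
  rewrite scalerA mulrC -scalerA -!scalerBr scaler_nat; congr (_ *: (_ - smear _ _ _ - smear _ _ _)).
    by apply: zP => l; rewrite !zE; lia.
  by apply: zP => l; rewrite !zE; lia.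
rewrite tent_pair //.
under [X in _ + X]eq_bigr do rewrite D big_mkcond /=.
rewrite exchange_big /= [X in X + _]big_mkcond [LHS]big_mkcond -big_split /=.
apply: eq_bigr => i _; case: leqP => iK; last first.
  by rewrite add0r big1 // => j _; rewrite leqNgt (leq_trans (ltn_ord j) (ltnW iK)).
rewrite -big_mkcond /= -scaler_sumr -scalerDr; congr (_ *: _).
have -> : \sum_(j < K | (lev i <= j)%N) (smear j psi (pos i - u) - smear j.+1 psi (pos i - u)) =
   \sum_(lev i <= j < K) (smear j psi (pos i - u) - smear j.+1 psi (pos i - u)).
  by rewrite big_geq_mkord.
have := telescope_sumr (fun j => - smear j psi (pos i - u)) iK.
under eq_bigr do rewrite opprK addrC; move=> ->.
by rewrite opprK addrA subrr add0r.
Qed.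

Definition denergy j r : R := \sum_(e <- zcube n 1) \sum_(e' <- zcube n 1)
  \sum_(v <- zbox n r) (dens j (v + e *+ 2 ^ j) - dens j (v + e' *+ 2 ^ j)) ^+ 2.

Lemma denergy_leq j r s : (r <= s)%N -> denergy j r <= denergy j s.
Proof.
move=> rs; apply: ler_sum => e _; apply: ler_sum => e' _.
by apply: sum_bx_leq => // v; rewrite sqr_ge0.
Qed.

Lemma zn_cb1 e k : e \in zcube n 1 -> (znorm (e *+ 2 ^ k) <= 2 ^ k)%N.
Proof.
by move=> /zn_cb h; rewrite znM -[leqRHS]muln1 leq_mul2l -ltnS -(expn1 2) h orbT.
Qed.

Definition fresh j v : R :=
  (W j)^-1 * \sum_(i | (lev i == j)%N) m i * \sum_(c <- zcube n j) (v == pos i - c)%:R.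

Lemma fresh_ge0 j v : 0 <= fresh j v.
Proof.
rewrite mulr_ge0 ?invr_ge0 //; apply: sumr_ge0 => i _; rewrite mulr_ge0 //.
by apply: sumr_ge0 => c _.
Qed.

Lemma sum_delta_le r x : \sum_(v <- zbox n r) (v == x)%:R <= 1 :> R.
Proof.
rewrite sum_pred_count count_uniq_mem ?bx_uniq //.
by case: (_ \in _).
Qed.

Lemma sum_fresh j r : \sum_(v <- zbox n r) fresh j v <= \sum_(i | (lev i == j)%N) m i.
Proof.
rewrite -mulr_sumr exchange_big mulr_sumr /=; apply: ler_sum => i _.
rewrite -mulr_sumr mulrCA ler_piMr // exchange_big /= ler_pdivrMl // mulr1.
apply: le_trans (sum_le_const (c := 1) _) _; last by rewrite mulr1.
by move=> c _; exact: sum_delta_le.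
Qed.

Lemma dens0E v : dens 0 v = fresh 0 v.
Proof. by congr (_ * _); apply: eq_bigl => i; rewrite leqn0. Qed.

Lemma densS j v :
  dens j.+1 v = (W 1)^-1 * \sum_(e <- zcube n 1) dens j (v + e *+ 2 ^ j) + fresh j.+1 v.
Proof.
have e1 : (W 1)^-1 * \sum_(e <- zcube n 1) dens j (v + e *+ 2 ^ j) =
   (W j.+1)^-1 * \sum_(i | (lev i <= j)%N) m i * \sum_(c <- zcube n j.+1) (v == pos i - c)%:R.
  rewrite /dens -mulr_sumr mulrA -invfM -WS exchange_big /=; congr (_ * _).
  apply: eq_bigr => i _; rewrite -mulr_sumr [in RHS]sum_cbS; congr (_ * _).
  apply: eq_bigr => e _; apply: eq_bigr => c _; congr (nat_of_bool _)%:R.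
  by rewrite opprD addrA [in RHS]eq_sym subr_eq eq_sym.
rewrite e1 /fresh -mulrDr; congr (_ * _).
rewrite (bigID (fun i => (lev i <= j)%N)) /=; congr (_ + _); apply: eq_bigl => i.
  by apply/andP/idP => [[]//|h]; rewrite leqW.
by rewrite -ltnNge eqn_leq.
Qed.

(** By [densS], the density at level [j.+1] is the mean over the [2 ^ n] subcubes plus the mass
    entering at that level. The square of a mean is the mean of the squares minus a variance, and
    the variances make up [denergy], so [Phi] telescopes. Since densities are at most [Cf], the
    entering mass raises [Phi] by at most [2 * Cf] times its amount. *)
Lemma denergy_sum (Cf : R) : (forall j v, dens j v <= Cf) ->
  forall K r, \sum_(j < K) denergy j r <= 4 * W 1 ^+ 2 * Cf * \sum_i m i.
Proof.
move=> hf; have Cf0 : 0 <= Cf by apply: le_trans (hf 0%N 0); exact: dens_ge0.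
pose Phi j r := \sum_(v <- zbox n r) dens j v ^+ 2.
have Phi0 j r : 0 <= Phi j r by apply: sumr_ge0 => v _; rewrite sqr_ge0.
have w1 := W_gt0 1; have w1n := W_neq0 1.
have sqS j v : dens j.+1 v ^+ 2 <=
    ((W 1)^-1 * \sum_(e <- zcube n 1) dens j (v + e *+ 2 ^ j)) ^+ 2 + 2 * Cf * fresh j.+1 v.
  have := hf j.+1 v; have := fresh_ge0 j.+1 v; have := densS j v.
  have S0 : 0 <= (W 1)^-1 * \sum_(e <- zcube n 1) dens j (v + e *+ 2 ^ j).
    apply: mulr_ge0; first by rewrite invr_ge0 ltW.
    by apply: sumr_ge0 => e _; exact: dens_ge0.
  move: S0; move: (_ * \sum_(e <- _) _) (dens _ _) (fresh _ _) => S f a S0 -> a0 fC.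
  by nra.
have step j r : denergy j r + 2 * W 1 ^+ 2 * Phi j.+1 r <=
    2 * W 1 ^+ 2 * (Phi j (r + 2 ^ j)%N + 2 * Cf * \sum_(i | (lev i == j.+1)%N) m i).
  have id v : \sum_(e <- zcube n 1) \sum_(e' <- zcube n 1)
      (dens j (v + e *+ 2 ^ j) - dens j (v + e' *+ 2 ^ j)) ^+ 2 =
      2 * W 1 * (\sum_(e <- zcube n 1) dens j (v + e *+ 2 ^ j) ^+ 2) -
      2 * (\sum_(e <- zcube n 1) dens j (v + e *+ 2 ^ j)) ^+ 2.
    exact: (sum_pair_sqr _ (fun e => dens j (v + e *+ 2 ^ j))).
  have e1 : denergy j r = \sum_(v <- zbox n r)
      (2 * W 1 * (\sum_(e <- zcube n 1) dens j (v + e *+ 2 ^ j) ^+ 2) -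
       2 * (\sum_(e <- zcube n 1) dens j (v + e *+ 2 ^ j)) ^+ 2).
    rewrite /denergy; under eq_bigr do rewrite exchange_big /=.
    by rewrite exchange_big /=; apply: eq_bigr => v _; rewrite id.
  have h1 : \sum_(v <- zbox n r) \sum_(e <- zcube n 1) dens j (v + e *+ 2 ^ j) ^+ 2 <=
      W 1 * Phi j (r + 2 ^ j)%N.
    rewrite exchange_big /=; apply: sum_le_const => e he.
    apply: (@sum_bx_shift _ _ _ _ (e *+ 2 ^ j) (fun v => dens j v ^+ 2)).
      by rewrite leq_add2l zn_cb1.
    by move=> v; rewrite sqr_ge0.
  have h2 : Phi j.+1 r <= (W 1 ^+ 2)^-1 * (\sum_(v <- zbox n r) (\sum_(e <- zcube n 1) dens j (v + e *+ 2 ^ j)) ^+ 2) +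
      2 * Cf * \sum_(i | (lev i == j.+1)%N) m i.
    apply: le_trans (_ : \sum_(v <- zbox n r) (((W 1)^-1 * \sum_(e <- zcube n 1) dens j (v + e *+ 2 ^ j)) ^+ 2 + 2 * Cf * fresh j.+1 v) <= _).
      by apply: ler_sum => v _; exact: sqS.
    rewrite big_split /= -mulr_sumr; apply: lerD; last first.
      by apply: ler_wpM2l (sum_fresh _ _); rewrite mulr_ge0.
    by rewrite mulr_sumr; apply: ler_sum => v _; rewrite exprMn exprVn.
  rewrite e1 sumrB -!mulr_sumr.
  have h3 : W 1 ^+ 2 * Phi j.+1 r <= (\sum_(v <- zbox n r) (\sum_(e <- zcube n 1) dens j (v + e *+ 2 ^ j)) ^+ 2) +
     W 1 ^+ 2 * (2 * Cf * \sum_(i | (lev i == j.+1)%N) m i).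
    have := ler_wpM2l (ltW (exprn_gt0 2 w1)) h2; by rewrite mulrDr mulVKf ?expf_neq0 //.
  have h4 := ler_wpM2l (ltW w1) h1.
  by move: h3 h4; clear; lra.
have main K r : \sum_(j < K) denergy j r + 2 * W 1 ^+ 2 * Phi K r <=
    2 * W 1 ^+ 2 * (Phi 0%N (r + 2 ^ K)%N + 2 * Cf * \sum_(i | (lev i <= K)%N && (lev i != 0)%N) m i).
  elim: K r => [|K IH] r.
    rewrite big_ord0 add0r ler_wpM2l //; first by rewrite mulr_ge0 // exprn_ge0 // ltW.
    rewrite big1 ?mulr0 ?addr0; last by move=> i /andP[]; rewrite leqn0 => /eqP ->.
    by apply: sum_bx_leq; rewrite ?leq_addr // => v; rewrite sqr_ge0.
  rewrite big_ord_recr /=.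
  have -> : \sum_(i | (lev i <= K.+1)%N && (lev i != 0)%N) m i =
      \sum_(i | (lev i <= K)%N && (lev i != 0)%N) m i + \sum_(i | (lev i == K.+1)%N) m i.
    rewrite (bigID (fun i => (lev i <= K)%N)) /=; congr (_ + _); apply: eq_bigl => i; lia.
  have := step K r; have := IH (r + 2 ^ K)%N.
  have -> : (r + 2 ^ K + 2 ^ K = r + 2 ^ K.+1)%N by rewrite expnS; lia.
  have : \sum_(j < K) denergy j r <= \sum_(j < K) denergy j (r + 2 ^ K).
    by apply: ler_sum => j _; apply: denergy_leq; rewrite leq_addr.
  by clear; lra.
move=> K r; have := main K r; set A := \sum_(i | _) m i.
have hPhi : Phi 0%N (r + 2 ^ K)%N <= Cf * \sum_(i | (lev i == 0)%N) m i.
  apply: le_trans (ler_wpM2l Cf0 (sum_fresh 0 (r + 2 ^ K))).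
  rewrite mulr_sumr; apply: ler_sum => v _; rewrite expr2 -dens0E ler_wpM2r ?dens_ge0 //.
have hA : A + \sum_(i | (lev i == 0)%N) m i <= \sum_i m i.
  rewrite [leRHS](bigID (fun i => (lev i == 0)%N)) /= [leRHS]addrC lerD2r /A.
  rewrite big_mkcond [leRHS]big_mkcond /=; apply: ler_sum => i _.
  by case: (lev i != 0)%N; rewrite ?andbF ?andbT //; case: ifP.
have z0 : 0 <= \sum_(i | (lev i == 0)%N) m i by apply: sumr_ge0.
have c0 : 0 <= 2 * W 1 ^+ 2 :> R by rewrite mulr_ge0 // exprn_ge0 // ltW.
have P0 := mulr_ge0 c0 (Phi0 K r).
have h5 : Phi 0%N (r + 2 ^ K)%N + 2 * Cf * A <= 2 * Cf * \sum_i m i.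
  have := ler_wpM2l Cf0 hA; have := mulr_ge0 Cf0 z0; move: hPhi; clear; lra.
by have := ler_wpM2l c0 h5; move: P0; clear; lra.
Qed.

Let sW k : (0 < size (zcube n k))%N.
Proof. by rewrite size_cb !expn_gt0. Qed.

Lemma denergy_term j r e e' x : e \in zcube n 1 -> e' \in zcube n 1 -> (znorm x <= 2 ^ j.+1)%N ->
  \sum_(v <- zbox n r) (dens j (v + x + e *+ 2 ^ j) - dens j (v + x + e' *+ 2 ^ j)) ^+ 2 <=
  denergy j (r + 2 ^ j.+1).
Proof.
move=> he he' hx.
apply: le_trans (@sum_bx_shift _ _ _ (r + 2 ^ j.+1)%N x
  (fun v => (dens j (v + e *+ 2 ^ j) - dens j (v + e' *+ 2 ^ j)) ^+ 2) _ _) _.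
- by rewrite leq_add2l.
- by move=> v; rewrite sqr_ge0.
rewrite /denergy; set G := fun e e' => \sum_(v <- zbox n (r + 2 ^ j.+1))
  (dens j (v + e *+ 2 ^ j) - dens j (v + e' *+ 2 ^ j)) ^+ 2.
have G0 a b : 0 <= G a b by apply: sumr_ge0 => v _; rewrite sqr_ge0.
apply: le_trans (_ : \sum_(e' <- zcube n 1) G e e' <= _).
  exact: (ler_sum_term (F := G e)).
apply: (ler_sum_term (F := fun e => \sum_(e' <- zcube n 1) G e e')) => // a.
by apply: sumr_ge0.
Qed.

Lemma tdiff_energy j r e e' : e \in zcube n 1 -> e' \in zcube n 1 ->
  \sum_(v <- zbox n r) tdiff j ((e - e') *+ 2 ^ j) v ^+ 2 <= denergy j (r + 2 ^ j.+1).
Proof.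
move=> he he'; set z := (e - e') *+ 2 ^ j.
apply: le_trans (_ : \sum_(v <- zbox n r) (W j)^-1 * \sum_(c <- zcube n j)
  (dens j (v - c) - dens j (v + z - c)) ^+ 2 <= _).
  apply: ler_sum => v _; rewrite /tdiff /tent -mulrBr -sumrB.
  exact: sqr_avg_le.
rewrite -mulr_sumr exchange_big /=; apply: avg_le => // c hc.
have hx : (znorm (- c - e' *+ 2 ^ j) <= 2 ^ j.+1)%N.
  apply: leq_trans (znD _ _) _; rewrite !znN expnS mul2n -addnn leq_add ?zn_cb1 //.
  exact/ltnW/zn_cb.
apply: le_trans (denergy_term r he' he hx); rewrite le_eqVlt; apply/orP; left; apply/eqP.
apply: eq_bigr => v _; congr ((dens _ _ - dens _ _) ^+ 2).
  by apply: zP => i; rewrite !zE; lia.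
by apply: zP => i; rewrite /z !zE; lia.
Qed.

Lemma sum_cb_mod (V : nmodType) (F : 'rV[int]_n -> V) k w :
  \sum_(c <- zcube n k) F (map_mx (fun a => (a %% (2 ^ k)%N%:Z)%Z) (c - w)) =
  \sum_(c <- zcube n k) F c.
Proof.
have p : (0 < 2 ^ k)%N by rewrite expn_gt0.
set P := (2 ^ k)%N in p *; have P0 : P%:Z != 0 by lia.
have P1 : 0 < P%:Z by lia.
pose rm (x : 'rV[int]_n) := map_mx (fun a => (a %% P%:Z)%Z) x.
have rmcb x : rm x \in zcube n k.
  by rewrite mem_cb; apply/forallP => i; rewrite zE modz_ge0 //= ltz_pmod.
have rmK x y : x \in zcube n k -> rm (rm (x + y) - y) = x.
  rewrite mem_cb => /forallP h; apply: zP => i; rewrite !zE modzDml addrK.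
  by apply: modz_small; have := h i.
apply: (@eq_sum_inj _ _ _ _ _ (fun c => rm (c - w))); rewrite ?cb_uniq //.
  move=> x y hx hy e.
  by rewrite -(rmK x (- w) hx) -(rmK y (- w) hy) e.
by move=> y hy _; exists (rm (y + w)); rewrite ?rmcb // rmK.
Qed.

(** The shift [w] need not be a multiple of [2 ^ K]. Translating the averaging cube modulo [2 ^ K]
    pairs its points so that the two arguments of [dens] in each pair differ by [(e - e') * 2 ^ K]
    with [e], [e'] in [zcube n 1], and such differences are recorded by [denergy]. *)
Lemma tent_osc K r w : (znorm w <= 2 ^ K)%N ->
  \sum_(u <- zbox n r) (tent K (u + w) - tent K u) ^+ 2 <= denergy K (r + 2 ^ K.+1).
Proof.
move=> hw; have p : (0 < 2 ^ K)%N by rewrite expn_gt0.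
set P := (2 ^ K)%N in p hw; have P0 : P%:Z != 0 by lia.
have P1 : 0 < P%:Z by lia.
pose rm (x : 'rV[int]_n) := map_mx (fun a => (a %% P%:Z)%Z) x.
pose dv (x : 'rV[int]_n) := map_mx (fun a => (a %/ P%:Z)%Z) x.
have rmcb x : rm x \in zcube n K.
  by rewrite mem_cb; apply/forallP => i; rewrite zE modz_ge0 //= ltz_pmod.
apply: le_trans (_ : \sum_(u <- zbox n r) (W K)^-1 * \sum_(c <- zcube n K)
  (dens K (u + w - c) - dens K (u - rm (c - w))) ^+ 2 <= _).
  apply: ler_sum => u _; rewrite /tent -(sum_cb_mod (fun c => dens K (u - c)) K w).
  by rewrite -mulrBr -sumrB; exact: sqr_avg_le.
rewrite -mulr_sumr exchange_big /=; apply: avg_le => // c hc.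
pose e := map_mx (fun a : int => if (0 < a) then 1 else 0) (dv (c - w)) : 'rV[int]_n.
pose e' := map_mx (fun a : int => if (a < 0) then 1 else 0) (dv (c - w)) : 'rV[int]_n.
have he : e \in zcube n 1 by rewrite mem_cb; apply/forallP => i; rewrite zE; case: ifP.
have he' : e' \in zcube n 1 by rewrite mem_cb; apply/forallP => i; rewrite zE; case: ifP.
have key (l : 'I_n) : (c - w) 0 l = rm (c - w) 0 l + (e 0 l - e' 0 l) * P%:Z.
  rewrite /rm /e /e' /dv !zmapE.
  have := zn_coord w l; move: hc; rewrite mem_cb => /forallP /(_ l).
  rewrite zBE; move: (c 0%R l) (w 0%R l) => a b ha hb.
  have := divz_eq (a - b) P%:Z; have := modz_ge0 (a - b) P0; have := ltz_pmod (a - b) P1.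
  move: ((a - b) %/ P%:Z)%Z ((a - b) %% P%:Z)%Z => Q S hS1 hS2 hQ.
  have hb' : -(P%:Z) <= b <= P%:Z by move: hb hw; clear; lia.
  rewrite -/P in ha.
  have Q2 : Q < 2.
    rewrite ltNge; apply/negP => Q2; have := ler_wpM2r (ltW P1) Q2.
    by move: hb' ha hS1 hS2 hQ; clear; lia.
  have Q3 : -2 < Q.
    rewrite ltNge; apply/negP => Q3; have := ler_wpM2r (ltW P1) Q3.
    by move: hb' ha hS1 hS2 hQ; clear; lia.
  have [Q1|[Q1|Q1]] : Q = 0 \/ Q = 1 \/ Q = -1.
  - by move: Q2 Q3; clear; lia.
  - by rewrite Q1 in hQ *; move: hQ; clear; rewrite ltxx; lia.
  - by rewrite Q1 in hQ *; rewrite /= in hQ *; move: hQ; clear; lia.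
  - by rewrite Q1 in hQ *; rewrite /= in hQ *; move: hQ; clear; lia.
have hx : (znorm (- rm (c - w)%R - e *+ 2 ^ K) <= 2 ^ K.+1)%N.
  apply: leq_trans (znD _ _) _; rewrite !znN expnS mul2n -addnn leq_add ?zn_cb1 //.
  exact/ltnW/zn_cb.
apply: le_trans (denergy_term r he' he hx); rewrite le_eqVlt; apply/orP; left; apply/eqP.
apply: eq_bigr => v _; congr ((dens _ _ - dens _ _) ^+ 2).
  by apply: zP => i; have := key i; rewrite !zBE !zDE !zNE !zMnE -/P; lia.
by apply: zP => i; rewrite !zE; lia.
Qed.

End density.

(** * Summation over scales and the square function of a smeared measure *)

Section geometric_sums.
Context (R : realType).

Lemma sum_ord_shift (F : nat -> R) L c : (forall k, 0 <= F k) ->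
  \sum_(k < L) F (k + c)%N <= \sum_(k < L + c) F k.
Proof.
move=> F0; rewrite addnC big_split_ord /= addrC.
under eq_bigr do rewrite addnC.
by rewrite lerDl sumr_ge0.
Qed.

Lemma sum_geo_half L : \sum_(k < L) (4^-1 : R) ^+ k <= 2.
Proof.
suff : \sum_(k < L) (4^-1 : R) ^+ k + 2 * 4^-1 ^+ L <= 2.
  have : 0 <= (4^-1 : R) ^+ L by rewrite exprn_ge0 // invr_ge0.
  by lra.
elim: L => [|L IH]; first by rewrite big_ord0 expr0; lra.
have : 0 <= (4^-1 : R) ^+ L by rewrite exprn_ge0 // invr_ge0.
by rewrite big_ord_recr /= exprS; lra.
Qed.

(** Cauchy-Schwarz with weights [(3 / 4) ^ (K - j)], of sum at most 3. The inverse weights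
    [(4 / 3) ^ (K - j)] are affordable because [kernel_diff] gains [2 ^ (j - K)]; the product
    [(2 / 3) ^ (K - j)] is still summable. *)
Lemma enorm_sum_geo d K (D : nat -> 'rV[R]_d) :
  enorm (\sum_(j < K) D j) ^+ 2 <= 3 * \sum_(j < K) (4 / 3) ^+ (K - j) * enorm (D j) ^+ 2.
Proof.
pose a (j : 'I_K) : R := (3 / 4) ^+ (K - j).
have ap (j : 'I_K) : 0 < a j by rewrite exprn_gt0 // divr_gt0.
have a0 (j : 'I_K) : 0 <= a j by rewrite ltW.
have aS : \sum_(j < K) a j <= 3.
  rewrite /a => {a ap a0 D}; elim: K => [|K IH]; first by rewrite big_ord0.
  rewrite big_ord_recr /= subSnn expr1.
  have -> : \sum_(i < K) (3 / 4 : R) ^+ (K.+1 - i) = 3 / 4 * \sum_(i < K) (3 / 4) ^+ (K - i).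
    by rewrite mulr_sumr; apply: eq_bigr => i _; rewrite subSn ?exprS // ltnW.
  lra.
pose b (j : 'I_K) := enorm (D j) / a j.
have h : enorm (\sum_(j < K) D j) <= \sum_(j < K) a j * b j.
  apply: le_trans (enorm_sum _ _) _; apply: ler_sum => j _.
  by rewrite /b mulrC divfK // gt_eqF.
apply: le_trans (_ : (\sum_(j < K) a j * b j) ^+ 2 <= _).
  by rewrite lerXn2r ?nnegrE ?enorm_ge0 // (le_trans _ h) ?enorm_ge0.
apply: le_trans (wcauchy_schwarz _ _ a0) _.
have e : \sum_(j < K) a j * b j ^+ 2 = \sum_(j < K) (4 / 3) ^+ (K - j) * enorm (D j) ^+ 2.
  apply: eq_bigr => j _; rewrite /b exprMn mulrCA mulrC; congr (_ * _).
  have -> : (4 / 3 : R) ^+ (K - j) = (a j)^-1 by rewrite /a -exprVn invf_div.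
  by rewrite expr2 mulrA mulfV ?mul1r // gt_eqF.
rewrite e ler_wpM2r //; apply: sumr_ge0 => j _.
by rewrite mulr_ge0 ?sqr_ge0 // exprn_ge0 // divr_ge0.
Qed.

Lemma sum_geo_conv (E : nat -> R) L : (forall j, 0 <= E j) ->
  \sum_(K < L) \sum_(j < K) (2 / 3) ^+ (K - j) * E j <= 2 * \sum_(j < L) E j.
Proof.
move=> E0; pose a K := \sum_(j < K) (2 / 3) ^+ (K - j) * E j.
have aS K : a K.+1 = 2 / 3 * (a K + E K).
  rewrite /a big_ord_recr /= subSnn expr1 mulrDr; congr (_ + _).
  by rewrite mulr_sumr; apply: eq_bigr => i _; rewrite subSn ?exprS ?mulrA // ltnW.
have a_ge0 K : 0 <= a K.
  by apply: sumr_ge0 => j _; rewrite mulr_ge0 // exprn_ge0 // divr_ge0.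
suff : \sum_(K < L) a K + 3 * a L <= 2 * \sum_(j < L) E j.
  by have := a_ge0 L; rewrite /a; lra.
elim: L => [|L IH]; first by rewrite /a !big_ord0; lra.
by rewrite big_ord_recr [in leRHS]big_ord_recr /= aS; lra.
Qed.

Lemma size_bx_pow n k c : (size (zbox n (2 ^ (k + c))))%:R <= 2 ^+ ((c + 2) * n) * 2 ^+ (k * n) :> R.
Proof.
rewrite -exprD -natrX ler_nat size_bx -mulnDl expnM.
have [->|n0] := posnP n; first by rewrite !expn0.
have p : (0 < 2 ^ (k + c))%N by rewrite expn_gt0.
rewrite leq_exp2r // (_ : (c + 2 + k = (k + c).+2)%N) ?expnS; lia.
Qed.

Lemma scale_id n k : (2^-1 : R) ^+ (k * (2 * n + 3)) * (8 ^+ k * (2 ^+ (k * n)) ^+ 2) = 1.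
Proof.
have -> : (8 : R) ^+ k = 2 ^+ (k * 3) by rewrite mulnC exprM; congr (_ ^+ _); rewrite !exprS expr0; lra.
rewrite -exprM -exprD exprVn (_ : (k * 3 + k * n * 2 = k * (2 * n + 3))%N) ?mulVf ?expf_neq0 //.
by lia.
Qed.

End geometric_sums.

(** The kernel sum is split by [smear_decomp] into three parts: the density at [u] times a sum of
    constant density ([V0], bounded by Dorronsoro's estimate), the oscillation of the density over
    the support of the kernel ([V1], energy of level [K]), and second differences at levels [j < K]
    ([DD], energy of level [j] with the gain of [kernel_diff]). *)
Lemma smear_square (R : realType) (n d : nat) (M Cf : R) (c : nat) :
  (0 < n)%N -> 0 <= M -> 0 <= Cf -> exists2 C : R, 0 < C &
  forall (g : 'rV[int]_n -> 'rV[R]_d),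
  (forall u v, enorm (g u - g v) <= M * (znorm (u - v))%:R) ->
  forall (I : finType) (m : I -> R) (pos : I -> 'rV[int]_n) (lev : I -> nat),
  (forall i, 0 <= m i) -> (forall j v, dens m pos lev j v <= Cf) ->
  forall L r,
  \sum_(k < L) 2^-1 ^+ (k * (2 * n + 3)) * \sum_(u <- zbox n r) \sum_(2 ^ k <= t < 2 ^ k.+1)
    enorm (\sum_(i | (lev i <= (k + c).+1)%N)
       m i *: smear (lev i) (psi g (2 ^ c) t u) (pos i - u)) ^+ 2 <=
  C * ((size (zbox n (r + 2 ^ (L + c + 5))))%:R + \sum_i m i).
Proof.
move=> n0 M0 Cf0.
have [C1 C1p hone] := kernel_one d M n0.
have [C2 C2p hdor] := dorronsoro R n d.
pose W : R := (size (zcube n 1))%:R.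
have Wp : 0 < W by rewrite ltr0n size_cb !expn_gt0.
pose D : R := 2 ^+ ((c + 4) * n).
have D0 : 0 < D by rewrite exprn_gt0.
pose c4 : R := 4 ^+ c.+1.
pose a0 : R := 4 * (Cf ^+ 2 * C1 * D ^+ 2).
pose a1 : R := 4 * (4 * D ^+ 2).
pose a2 : R := 2 * (3 * ((5 * M + 9) * D ^+ 2 * 2 ^+ c.+1)).
have c40 : 0 <= c4 by rewrite exprn_ge0.
have a00 : 0 <= a0 by rewrite /a0 !mulr_ge0 ?sqr_ge0 // ltW.
have a10 : 0 <= a1 by rewrite /a1 !mulr_ge0 ?sqr_ge0 // ltW.
have a20 : 0 <= a2 by rewrite /a2 !mulr_ge0 ?sqr_ge0 ?exprn_ge0 ?addr_ge0 ?mulr_ge0 // ltW.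
exists (a0 * (c4 * (C2 * M ^+ 2) + 2) + (a1 + a2 * 2) * (4 * W ^+ 2 * Cf) + 1).
  apply: ltr_wpDl => //; rewrite !(sqr_ge0, addr_ge0, mulr_ge0) //; exact: ltW.
move=> g gLip I m pos lev m0 hf L r.
have [x [x0 hx sx]] := hdor M g gLip (L + c)%N r.
set B := (size _)%:R; set mI := \sum_i m i.
pose r' := (r + 2 ^ (L + c + 5))%N.
pose E j := denergy m pos lev j r'.
have E0 j : 0 <= E j.
  by do 3![apply: sumr_ge0 => ? _]; rewrite sqr_ge0.
have sE K : \sum_(j < K) E j <= 4 * W ^+ 2 * Cf * mI.
  exact: denergy_sum.
have tent_bound k v : 0 <= tent m pos lev k v <= Cf.
  rewrite /tent; apply/andP; split.
    rewrite mulr_ge0 ?invr_ge0 //; apply: sumr_ge0 => e _; exact: dens_ge0.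
  by apply: avg_le => //; rewrite size_cb !expn_gt0.
pose geo k := \sum_(j < (k + c).+1) (2 / 3) ^+ ((k + c).+1 - j) * E j.
have per k : (k < L)%N -> 2^-1 ^+ (k * (2 * n + 3)) * (\sum_(u <- zbox n r) \sum_(2 ^ k <= t < 2 ^ k.+1)
    enorm (\sum_(i | (lev i <= (k + c).+1)%N)
       m i *: smear (lev i) (psi g (2 ^ c) t u) (pos i - u)) ^+ 2) <=
   a0 * (c4 * x (k + c)%N + 4^-1 ^+ k * B) + a1 * E (k + c).+1 + a2 * geo k.
  (* For every [t] of the block [2 ^ c * t < 2 ^ K], so the kernel is supported in the box of radius
     [2 ^ K]. *)
  move=> kL; set K := (k + c).+1; set nk := 2^-1 ^+ _.
  have nk0 : 0 <= nk by rewrite exprn_ge0 // invr_ge0.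
  pose T : R := 2 ^+ k; pose S : R := 2 ^+ (k * n).
  have T0 : 0 < T by rewrite exprn_gt0.
  have S0 : 0 < S by rewrite exprn_gt0.
  have T4 : 4 ^+ k = T ^+ 2 :> R by rewrite /T exprAC; congr (_ ^+ _); ring.
  have T8 : 8 ^+ k = T ^+ 3 :> R by rewrite /T exprAC; congr (_ ^+ _); ring.
  have nkE : nk * (T ^+ 3 * S ^+ 2) = 1 by rewrite -T8 scale_id.
  have [rho rhoE] : {rho | rho = (2 ^ K)%N} by exists (2 ^ K)%N.
  have [rho' rhoE'] : {rho' | rho' = (2 ^ K.+1)%N} by exists (2 ^ K.+1)%N.
  have N1 : (size (zbox n rho))%:R <= D * S :> R.
    rewrite rhoE /K -addnS; apply: le_trans (size_bx_pow _ _ _ _) _.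
    by apply: (ler_wpM2r (ltW S0)); rewrite /D ler_eXn2l ?ltr1n // leq_mul2r; clear; lia.
  have N2 : (size (zbox n rho'))%:R <= D * S :> R.
    rewrite rhoE' /K -!addnS; apply: le_trans (size_bx_pow _ _ _ _) _.
    by apply: (ler_wpM2r (ltW S0)); rewrite /D ler_eXn2l ?ltr1n // leq_mul2r; clear; lia.
  have rho2 : (2 * rho = rho')%N by rewrite rhoE rhoE' [RHS]expnS.
  have supp t u w : (t < 2 ^ k.+1)%N -> psi g (2 ^ c) t u w != 0 -> (znorm w <= rho)%N.
    move=> tk /psi_neq0 h; apply: leq_trans (ltnW h) _.
    rewrite rhoE /K -addSn expnD mulnC leq_mul2r ltnW ?orbT //.
  pose V0 u t := tent m pos lev K u *: \sum_(w <- zbox n rho) psi g (2 ^ c) t u w.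
  pose V1 u t := \sum_(w <- zbox n rho) (tent m pos lev K (u + w) - tent m pos lev K u) *: psi g (2 ^ c) t u w.
  pose Y j e e' u t := \sum_(w <- zbox n rho') (tdiff m pos lev j ((e - e') *+ 2 ^ j) (u + w) -
           tdiff m pos lev j ((e - e') *+ 2 ^ j) (u + w - (e - e') *+ 2 ^ j)) *: psi g (2 ^ c) t u w.
  pose DD j u t := (2 * W ^+ 2)^-1 *: \sum_(e <- zcube n 1) \sum_(e' <- zcube n 1) Y j e e' u t.
  have dec u t : (2 ^ k <= t < 2 ^ k.+1)%N ->
    \sum_(i | (lev i <= K)%N) m i *: smear (lev i) (psi g (2 ^ c) t u) (pos i - u) =
    V0 u t + V1 u t + \sum_(j < K) DD j u t.
    move=> /andP[_ tk].
    rewrite (smear_decomp (rho := rho) (rho' := rho') m pos lev K u (supp t u ^~ tk)) ?rhoE ?rhoE' ?leq_exp2l //.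
    rewrite -rhoE -rhoE'; congr (_ + _); rewrite /V0 /V1 scaler_sumr -big_split /=.
    by apply: eq_bigr => w _; rewrite -scalerDl [X in _ = X *: _]addrC subrK.
  have h3 u t : (2 ^ k <= t < 2 ^ k.+1)%N -> enorm (\sum_(i | (lev i <= K)%N)
       m i *: smear (lev i) (psi g (2 ^ c) t u) (pos i - u)) ^+ 2 <=
     4 * enorm (V0 u t) ^+ 2 + 4 * enorm (V1 u t) ^+ 2 +
     2 * (3 * \sum_(j < K) (4 / 3) ^+ (K - j) * enorm (DD j u t) ^+ 2).
    move=> tk; rewrite dec //.
    have := enorm_sqrD (V0 u t + V1 u t) (\sum_(j < K) DD j u t).
    have := enorm_sqrD (V0 u t) (V1 u t).
    have := enorm_sum_geo K (fun j => DD j u t).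
    by clear; lra.
  have b0 : nk * (\sum_(u <- zbox n r) \sum_(2 ^ k <= t < 2 ^ k.+1) 4 * enorm (V0 u t) ^+ 2) <=
      a0 * (c4 * x (k + c)%N + 4^-1 ^+ k * B).
    have e1 : \sum_(u <- zbox n r) \sum_(2 ^ k <= t < 2 ^ k.+1) 4 * enorm (V0 u t) ^+ 2 <=
       4 * Cf ^+ 2 * \sum_(u <- zbox n r) \sum_(2 ^ k <= t < 2 ^ k.+1)
          enorm (\sum_(w <- zbox n rho) psi g (2 ^ c) t u w) ^+ 2.
      rewrite mulr_sumr; apply: ler_sum => u _; rewrite mulr_sumr; apply: ler_sum => t _.
      rewrite -mulrA ler_wpM2l // /V0 enormZ exprMn ler_wpM2r ?sqr_ge0 //.
      by have /andP[q0 q1] := tent_bound K u; rewrite ger0_norm // lerXn2r ?nnegrE.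
    have e2 := hone g (2 ^ c)%N gLip k K r rho; rewrite rho2 in e2.
    have e3 : \sum_(w <- zbox n rho) \sum_(u <- zbox n r) (enorm (taylor_rem g K u w) ^+ 2 + 1) <=
        D * S * (c4 * T ^+ 2 * x (k + c)%N + B).
      apply: le_trans (_ : (size (zbox n rho))%:R * (c4 * T ^+ 2 * x (k + c)%N + B) <= _).
        apply: sum_le_const => w; rewrite mem_bx rhoE => hw.
        rewrite big_split /= sum_const_seq mulr1 lerD //; last first.
          by rewrite ler_nat leq_size_bx // leq_addr.
        apply: le_trans (hx (k + c)%N w _ hw) _; first by rewrite leq_add2r ltnW.
        by rewrite -T4 /c4 -exprD [(c.+1 + k)%N]addnC addnS.
      by apply: ler_wpM2r N1; rewrite !(sqr_ge0, addr_ge0, mulr_ge0) ?x0.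
    have c0 : 0 <= 4 * Cf ^+ 2 :> R by rewrite mulr_ge0 ?sqr_ge0.
    have e4 : \sum_(u <- zbox n r) \sum_(2 ^ k <= t < 2 ^ k.+1)
          enorm (\sum_(w <- zbox n rho) psi g (2 ^ c) t u w) ^+ 2 <=
       C1 * T * (D * S) * (D * S * (c4 * T ^+ 2 * x (k + c)%N + B)).
      apply: le_trans e2 _; apply: ler_pM e3.
      - by rewrite !mulr_ge0 // ltW.
      - by do 2![apply: sumr_ge0 => ? _]; rewrite addr_ge0 ?sqr_ge0.
      - by rewrite ler_wpM2l // mulr_ge0 // ltW.
    apply: le_trans (ler_wpM2l nk0 (le_trans e1 (ler_wpM2l c0 e4))) _.
    have T2 : 4^-1 ^+ k = (T ^+ 2)^-1 by rewrite -T4 exprVn.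
    rewrite le_eqVlt; apply/orP; left; apply/eqP; rewrite T2.
    transitivity (nk * (T ^+ 3 * S ^+ 2) * (a0 * (c4 * x (k + c)%N + (T ^+ 2)^-1 * B))).
      by rewrite /a0; field; rewrite gt_eqF.
    by rewrite nkE mul1r.
  have b1 : nk * (\sum_(u <- zbox n r) \sum_(2 ^ k <= t < 2 ^ k.+1) 4 * enorm (V1 u t) ^+ 2) <= a1 * E K.
    have e1 := @kernel_osc R n d g (2 ^ c)%N k r rho (tent m pos lev K) (E K).
    have {}e1 : \sum_(u <- zbox n r) \sum_(2 ^ k <= t < 2 ^ k.+1) enorm (V1 u t) ^+ 2 <=
       4 * 8 ^+ k * (size (zbox n rho))%:R ^+ 2 * E K.
      apply: e1 => w hw; rewrite rhoE in hw; apply: le_trans (tent_osc m pos lev r hw) _.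
      apply: denergy_leq; rewrite leq_add2l leq_exp2l //; move: kL; rewrite /K; clear; lia.
    have e2 : (size (zbox n rho))%:R ^+ 2 <= D ^+ 2 * S ^+ 2.
      by rewrite -exprMn lerXn2r ?nnegrE // mulr_ge0 ?ltW.
    have e3 : \sum_(u <- zbox n r) \sum_(2 ^ k <= t < 2 ^ k.+1) enorm (V1 u t) ^+ 2 <=
       4 * 8 ^+ k * (D ^+ 2 * S ^+ 2) * E K.
      by apply: le_trans e1 _; rewrite ler_wpM2r // ler_wpM2l // mulr_ge0 // exprn_ge0.
    under eq_bigr do rewrite -mulr_sumr; rewrite -mulr_sumr mulrCA.
    have := ler_wpM2l nk0 e3; rewrite T8 /a1.
    have -> : nk * (4 * T ^+ 3 * (D ^+ 2 * S ^+ 2) * E K) = nk * (T ^+ 3 * S ^+ 2) * (4 * D ^+ 2 * E K) by ring.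
    by rewrite nkE; clear; lra.
  have b2 : nk * (\sum_(u <- zbox n r) \sum_(2 ^ k <= t < 2 ^ k.+1)
      2 * (3 * \sum_(j < K) (4 / 3) ^+ (K - j) * enorm (DD j u t) ^+ 2)) <= a2 * geo k.
    have eD j : (j < K)%N -> nk * (\sum_(u <- zbox n r) \sum_(2 ^ k <= t < 2 ^ k.+1) enorm (DD j u t) ^+ 2) <=
        (5 * M + 9) * D ^+ 2 * 2 ^+ j / T * E j.
      move=> jK.
      have eY e e' : e \in zcube n 1 -> e' \in zcube n 1 ->
          \sum_(u <- zbox n r) \sum_(2 ^ k <= t < 2 ^ k.+1) enorm (Y j e e' u t) ^+ 2 <=
          4 * (5 * M + 9) * 2 ^+ j * T ^+ 2 * (D ^+ 2 * S ^+ 2) * E j.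
        move=> he he'.
        have hz : (znorm ((e - e') *+ 2 ^ j) <= 2 ^ j)%N.
          by rewrite znM -[leqRHS]muln1 leq_mul2l -ltnS -{2}(expn1 2) zn_cbB ?orbT.
        have c0p : (0 < 2 ^ c)%N by rewrite expn_gt0.
        have j0p : (0 < 2 ^ j)%N by rewrite expn_gt0.
        have hr : (2 ^ c * 2 ^ k.+1 + 2 ^ j <= rho')%N.
          rewrite -expnD rhoE' [X in (_ <= X)%N]expnS mul2n -addnn leq_add //.
            by rewrite leq_exp2l // /K; clear; lia.
          by rewrite leq_exp2l // ltnW.
        have := kernel_diff gLip M0 c0p (k := k) r (tdiff m pos lev j ((e - e') *+ 2 ^ j)) hz j0p hr.
        move=> h; apply: le_trans h _; rewrite T4 natrX.
        have f0 : 0 <= 4 * (5 * M + 9) * 2 ^+ j * T ^+ 2 :> R.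
          by rewrite !mulr_ge0 ?sqr_ge0 ?exprn_ge0 ?addr_ge0 ?mulr_ge0.
        apply: ler_pM.
        - by rewrite mulr_ge0 ?sqr_ge0.
        - by apply: sumr_ge0 => ? _; rewrite sqr_ge0.
        - by rewrite ler_wpM2l // -exprMn lerXn2r ?nnegrE // mulr_ge0 ?ltW.
        apply: le_trans (tdiff_energy m pos lev j _ he he') _; apply: denergy_leq.
        rewrite -addnA leq_add2l rhoE'.
        have s1 : (2 ^ j.+1 <= 2 ^ K.+1)%N by rewrite leq_exp2l // ltnS ltnW.
        have s2 : (2 ^ K.+2 <= 2 ^ (L + c + 5))%N.
          by rewrite leq_exp2l //; move: kL; rewrite /K; clear; lia.
        by move: s1 s2; rewrite (expnS 2 K.+1); clear; lia.
      have eDD u t : enorm (DD j u t) ^+ 2 <= (4 * W ^+ 2)^-1 *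
          \sum_(e <- zcube n 1) \sum_(e' <- zcube n 1) enorm (Y j e e' u t) ^+ 2.
        rewrite /DD enormZ exprMn.
        have s1 : enorm (\sum_(e <- zcube n 1) \sum_(e' <- zcube n 1) Y j e e' u t) ^+ 2 <=
            W * (W * \sum_(e <- zcube n 1) \sum_(e' <- zcube n 1) enorm (Y j e e' u t) ^+ 2).
          apply: le_trans (enorm_sum_sqr _ _) _; rewrite -/W ler_wpM2l ?(ltW Wp) // mulr_sumr.
          by apply: ler_sum => e _; apply: enorm_sum_sqr.
        apply: le_trans (ler_wpM2l (sqr_ge0 _) s1) _; rewrite real_normK ?num_real //.
        by rewrite le_eqVlt; apply/orP; left; apply/eqP; field; rewrite gt_eqF.
      have eDs : \sum_(u <- zbox n r) \sum_(2 ^ k <= t < 2 ^ k.+1) enorm (DD j u t) ^+ 2 <=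
          (4 * W ^+ 2)^-1 * (W * (W * (4 * (5 * M + 9) * 2 ^+ j * T ^+ 2 * (D ^+ 2 * S ^+ 2) * E j))).
        apply: le_trans (_ : (4 * W ^+ 2)^-1 * \sum_(e <- zcube n 1) \sum_(e' <- zcube n 1)
           \sum_(u <- zbox n r) \sum_(2 ^ k <= t < 2 ^ k.+1) enorm (Y j e e' u t) ^+ 2 <= _).
          apply: le_trans (ler_sum _ (fun u _ => ler_sum _ (fun t _ => eDD u t))) _.
          under eq_bigr do rewrite -mulr_sumr; rewrite -mulr_sumr ler_wpM2l ?invr_ge0 ?mulr_ge0 ?sqr_ge0 //.
          under eq_bigr do rewrite exchange_big /=; rewrite exchange_big /=.
          apply: ler_sum => e _; under eq_bigr do rewrite exchange_big /=.
          by rewrite exchange_big.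
        rewrite ler_wpM2l ?invr_ge0 ?mulr_ge0 ?sqr_ge0 //.
        apply: sum_le_const => e he; apply: sum_le_const => e' he'; exact: eY.
      apply: le_trans (ler_wpM2l nk0 eDs) _; rewrite le_eqVlt; apply/orP; left; apply/eqP.
      transitivity (nk * (T ^+ 3 * S ^+ 2) * ((5 * M + 9) * D ^+ 2 * 2 ^+ j / T * E j)).
        by field; rewrite !gt_eqF.
      by rewrite nkE mul1r.
    have -> : \sum_(u <- zbox n r) \sum_(2 ^ k <= t < 2 ^ k.+1)
        2 * (3 * \sum_(j < K) (4 / 3) ^+ (K - j) * enorm (DD j u t) ^+ 2) =
      6 * \sum_(j < K) (4 / 3) ^+ (K - j) * \sum_(u <- zbox n r) \sum_(2 ^ k <= t < 2 ^ k.+1) enorm (DD j u t) ^+ 2.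
      transitivity (6 * \sum_(u <- zbox n r) \sum_(2 ^ k <= t < 2 ^ k.+1)
         \sum_(j < K) (4 / 3) ^+ (K - j) * enorm (DD j u t) ^+ 2).
        rewrite mulr_sumr; apply: eq_bigr => u _; rewrite mulr_sumr; apply: eq_bigr => t _; ring.
      congr (_ * _); under eq_bigr do rewrite exchange_big /=; rewrite exchange_big /=.
      apply: eq_bigr => j _; rewrite mulr_sumr; apply: eq_bigr => u _; by rewrite mulr_sumr.
    rewrite mulrCA (_ : a2 = 6 * ((5 * M + 9) * D ^+ 2 * 2 ^+ c.+1)); last by rewrite /a2; ring.
    rewrite -mulrA ler_wpM2l // mulr_sumr /geo mulr_sumr; apply: ler_sum => j _.
    have p0 : 0 <= (4 / 3 : R) ^+ (K - j) by rewrite exprn_ge0 // divr_ge0.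
    rewrite mulrCA; apply: le_trans (ler_wpM2l p0 (eD j (ltn_ord j))) _.
    rewrite le_eqVlt; apply/orP; left; apply/eqP.
    have eK : 2 ^+ j * 2 ^+ (K - j) = T * 2 ^+ c.+1 :> R.
      by rewrite /T -!exprD subnKC ?addnS // ltnW.
    have e23 : (4 / 3 : R) ^+ (K - j) = 2 ^+ (K - j) * (2 / 3) ^+ (K - j).
      by rewrite -exprMn; congr (_ ^+ _); clear; lra.
    rewrite e23 -/K.
    transitivity ((5 * M + 9) * D ^+ 2 / T * (2 ^+ j * 2 ^+ (K - j)) * ((2 / 3) ^+ (K - j) * E j)); first by ring.
    by rewrite eK; field; rewrite gt_eqF.
  apply: le_trans (lerD (lerD b0 b1) b2); rewrite -!mulrDr ler_wpM2l // -!big_split /=.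
  apply: ler_sum => u _; rewrite -!big_split /=; apply: ler_sum_nat => t tk; exact: h3.
apply: le_trans (_ : \sum_(k < L) (a0 * (c4 * x (k + c)%N + 4^-1 ^+ k * B) + a1 * E (k + c).+1 + a2 * geo k) <= _).
  by apply: ler_sum => k _; apply: per.
rewrite 2!big_split /= -!mulr_sumr big_split /= -!mulr_sumr -mulr_suml.
have B0 : 0 <= B by [].
have m0I : 0 <= mI by apply: sumr_ge0.
have t1 : \sum_(i < L) x (i + c)%N <= C2 * M ^+ 2 * B.
  apply: le_trans (sum_ord_shift L c x0) _; apply: le_trans sx.
  by rewrite big_ord_recr /= lerDl.
have t2 : (\sum_(i < L) (4^-1 : R) ^+ i) * B <= 2 * B by rewrite ler_wpM2r // sum_geo_half.
have t3 : \sum_(i < L) E (i + c).+1 <= 4 * W ^+ 2 * Cf * mI.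
  under eq_bigr do rewrite -addnS; exact: le_trans (sum_ord_shift L c.+1 E0) (sE _).
have t4 : \sum_(i < L) geo i <= 2 * (4 * W ^+ 2 * Cf * mI).
  pose G K := \sum_(j < K) (2 / 3) ^+ (K - j) * E j.
  have G0 K : 0 <= G K.
    by apply: sumr_ge0 => j _; rewrite mulr_ge0 // exprn_ge0 // divr_ge0.
  rewrite (_ : \sum_(i < L) geo i = \sum_(i < L) G (i + c.+1)%N); last first.
    by apply: eq_bigr => i _; rewrite /geo -addnS.
  apply: le_trans (sum_ord_shift L c.+1 G0) _; apply: le_trans (sum_geo_conv _ E0) _.
  by rewrite ler_wpM2l.
have t5 := ler_wpM2l c40 t1.
have t6 := ler_wpM2l a00 (lerD t5 t2); have t7 := ler_wpM2l a10 t3; have t8 := ler_wpM2l a20 t4.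
apply: le_trans (lerD (lerD t6 t7) t8) _.
set X := C2 * M ^+ 2.
have X0 : 0 <= X by rewrite mulr_ge0 ?sqr_ge0 // ltW.
have W0 : 0 <= 4 * W ^+ 2 * Cf by rewrite !mulr_ge0 ?sqr_ge0.
move: W0 X0; clear - a00 a10 a20 c40 B0 m0I; move: X (4 * W ^+ 2 * Cf) => X Y Y0 X0.
clearbody a0 a1 a2 c4 B mI.
have u1 : 0 <= (a0 * (c4 * X + 2)) * mI by rewrite !(addr_ge0, mulr_ge0).
have u2 : 0 <= (a1 + a2 * 2) * Y * B by rewrite !(addr_ge0, mulr_ge0).
by move: u1 u2 B0 m0I; clear; lra.
Qed.

(** * Square functions of discrete measures *)

Section discrete_measure.
Context (R : realType) (n d : nat) (I : finType) (m : I -> R) (y : I -> 'rV[R]_d).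
Context (m0 : forall i, 0 <= m i).
Implicit Types (x : 'rV[R]_d) (k h a b t : nat).

Definition cvec t x : 'rV[R]_d := \sum_i m i *: phi t%:R (y i - x).

(* The value at [t = 2 ^ k] of the factor [t ^- (2 n + 3)] in [|C^n|^2 dt / t], where [C^n]
   carries [t ^- (n + 1)]. *)
Definition block_weight k : R := 2^-1 ^+ (k * (2 * n + 3)).

Definition sqfun_block k x : R := block_weight k * \sum_(2 ^ k <= t < 2 ^ k.+1) enorm (cvec t x) ^+ 2.

(** Only radii at least 1: the atoms carry no information below the mesh. *)
Definition upper_regular (C1 : R) : Prop := forall x k,
  \sum_(i | enorm (y i - x) <= 2 ^+ k) m i <= C1 * 2 ^+ (k * n).

Lemma nk_ge0 k : 0 <= block_weight k.
Proof. by rewrite exprn_ge0 // invr_ge0. Qed.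

Lemma nkE k : block_weight k * (2 ^+ (k * n) * 2 ^+ k * 2 ^+ k) = 2^-1 ^+ (k * n.+1).
Proof.
rewrite /block_weight (_ : (k * (2 * n + 3) = k * n.+1 + (k * n + k + k))%N); last by clear; lia.
by rewrite -!exprD [X in X * _]exprD -mulrA -exprMn mulVf // expr1n mulr1.
Qed.

Lemma sqfun_block_ge0 k x : 0 <= sqfun_block k x.
Proof.
by rewrite mulr_ge0 ?nk_ge0 //; apply: sumr_ge0 => t _; rewrite sqr_ge0.
Qed.

(** The bounds of [phi_close] summed over the atoms: displacement [rho i], jump when [t] is within
    [rho i] of [alpha i]. *)
Definition errsum (P : pred I) (rho alpha : I -> R) t : R :=
  \sum_(i | P i) m i * (rho i + t%:R * (`|alpha i - t%:R| <= rho i)%R%:R).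

Lemma errsum_ge0 P rho alpha t : (forall i, 0 <= rho i) -> 0 <= errsum P rho alpha t.
Proof.
by move=> r0; apply: sumr_ge0 => i _; rewrite !(mulr_ge0, addr_ge0).
Qed.

(** One factor of the square is bounded by its maximum, through upper regularity; the other is
    averaged over the block by [block_shell]. The outcome is linear in the [m i * rho i], so atoms
    with very different displacements can be summed. *)
Lemma err_block (C1 A : R) h k x (P : pred I) (rho alpha : I -> R) :
  upper_regular C1 -> (forall i, P i -> enorm (y i - x) <= 2 ^+ (k + h)) ->
  (forall i, 1 <= rho i) -> (forall i, P i -> rho i <= A * 2 ^+ k) ->
  block_weight k * \sum_(2 ^ k <= t < 2 ^ k.+1) errsum P rho alpha t ^+ 2 <=
  C1 * 2 ^+ (h * n) * (A + 2) * 7 * 2^-1 ^+ (k * n.+1) * \sum_(i | P i) m i * rho i.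
Proof.
move=> up Px r1 rA; have r0 i : 0 <= rho i by apply: le_trans (r1 i).
pose T : R := 2 ^+ k; have T0 : 0 < T by rewrite exprn_gt0.
set S := \sum_(i | P i) m i * rho i.
have S0 : 0 <= S by apply: sumr_ge0 => i _; rewrite mulr_ge0.
pose X := \sum_(i | P i) m i.
have X0 : 0 <= X by apply: sumr_ge0.
have hX : X <= C1 * 2 ^+ (h * n) * 2 ^+ (k * n).
  apply: le_trans (_ : \sum_(i | enorm (y i - x) <= 2 ^+ (k + h)) m i <= _).
    rewrite /X big_mkcond [leRHS]big_mkcond /=; apply: ler_sum => i _.
    by case: ifP => [/Px ->//|_]; case: ifP.
  by apply: le_trans (up x _) _; rewrite mulnDl exprD; lra.
pose Q := (A + 2) * T * X.
have hQ t : (2 ^ k <= t < 2 ^ k.+1)%N -> errsum P rho alpha t <= Q.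
  move=> /andP[_ tk]; rewrite /errsum /Q mulr_sumr; apply: ler_sum => i Pi.
  rewrite mulrC ler_wpM2r //.
  have tk' : t%:R <= 2 * T :> R by rewrite -exprS -natrX ler_nat ltnW.
  have : t%:R * (`|alpha i - t%:R| <= rho i)%R%:R <= t%:R :> R.
    by rewrite ler_piMr //; case: (`|alpha i - t%:R| <= rho i).
  by move: tk' (rA i Pi); rewrite -/T; clear; lra.
have Q0 : 0 <= Q.
  apply: le_trans (hQ (2 ^ k)%N _); first exact: errsum_ge0.
  by rewrite leqnn ltn_exp2l /=.
have hS : \sum_(2 ^ k <= t < 2 ^ k.+1) errsum P rho alpha t <= T * (7 * S).
  rewrite /errsum exchange_big /= /S !mulr_sumr; apply: ler_sum => i Pi.
  rewrite -mulr_sumr; have := ler_wpM2l (m0 i) (block_shell (alpha i) k (r0 i)).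
  move/le_trans; apply; rewrite -/T.
  have := mulr_ge0 (mulr_ge0 (m0 i) (ltW T0)) (_ : 0 <= 2 * (rho i - 1)).
  have p : 0 <= 2 * (rho i - 1) by rewrite mulr_ge0 // subr_ge0.
  by move/(_ p); clear; lra.
have h1 : \sum_(2 ^ k <= t < 2 ^ k.+1) errsum P rho alpha t ^+ 2 <= Q * (T * (7 * S)).
  apply: le_trans (ler_wpM2l Q0 hS); rewrite mulr_sumr; apply: ler_sum_nat => t ht.
  by rewrite expr2 ler_wpM2r ?hQ // errsum_ge0.
apply: le_trans (ler_wpM2l (nk_ge0 k) h1) _.
have [P0|] := boolP [exists i, P i]; last first.
  rewrite negb_exists => /forallP nP.
  by rewrite /S !big_pred0 ?mulr0 //; move=> i; apply/negbTE/nP.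
have A0 : 0 <= A + 2.
  case/existsP: P0 => i Pi; have := rA i Pi; have := r1 i; rewrite -/T => r1i rAi.
  have : 0 < A * T by apply: lt_le_trans rAi; apply: lt_le_trans r1i.
  rewrite pmulr_lgt0 // => /ltW A1; lra.
have c0 : 0 <= block_weight k * ((A + 2) * T * (T * (7 * S))).
  by rewrite !(mulr_ge0, nk_ge0) // ltW.
have h2 := ler_wpM2l c0 hX.
have -> : block_weight k * (Q * (T * (7 * S))) = block_weight k * ((A + 2) * T * (T * (7 * S))) * X.
  by rewrite /Q; ring.
apply: le_trans h2 _; rewrite -nkE -/T.
by rewrite le_eqVlt; apply/orP; left; apply/eqP; ring.
Qed.

Lemma cvec_close t x x' (rho : R) : enorm (x - x') <= rho ->
  enorm (cvec t x - cvec t x') <=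
  errsum (fun i => enorm (y i - x) < t%:R + rho) (fun=> rho) (fun i => enorm (y i - x)) t.
Proof.
move=> xx; rewrite /cvec -sumrB /errsum [leRHS]big_mkcond /=; apply: le_trans (enorm_sum _ _) _.
apply: ler_sum => i _; rewrite -scalerBr enormZ ger0_norm //.
have xx' : enorm (y i - x - (y i - x')) <= rho.
  have -> : y i - x - (y i - x') = - (x - x') by apply/rowP => l; rewrite !mxE; ring.
  by rewrite enormN.
case: ltP => h; first by rewrite ler_wpM2l // phi_close.
by rewrite (phi_close0 xx') // enorm0 mulr0.
Qed.

End discrete_measure.

Lemma sum_half_tail (R : realType) (j c L : nat) :
  \sum_(k < L) (j <= k + c)%N%:R * (2 ^+ j * 2^-1 ^+ k) <= 2 ^+ c.+1 :> R.
Proof.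
(* A capped multiple of [2 ^- k]: each counted term is at most the decrement of [h], and [h] starts
   below [2 ^ c.+1]. *)
pose h (k : nat) : R := Order.min (2 ^+ c.+1) (2 * (2 ^+ j * 2^-1 ^+ k)).
have h0 k : 0 <= h k.
  by rewrite /h le_min exprn_ge0 //= !mulr_ge0 ?exprn_ge0 ?invr_ge0.
have hS k : (j <= k + c)%N%:R * (2 ^+ j * 2^-1 ^+ k) <= h k - h k.+1.
  have p : 0 <= 2 ^+ j * 2^-1 ^+ k :> R by rewrite mulr_ge0 ?exprn_ge0 ?invr_ge0.
  have hh : h k.+1 <= 2 ^+ j * 2^-1 ^+ k.
    by rewrite /h ge_min; apply/orP; right; rewrite exprS mulrCA mulVKf.
  have hm : h k.+1 <= h k.
    rewrite /h le_min !ge_min lexx /=; apply/orP; right; rewrite exprS mulrCA mulVKf //; lra.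
  case: (leqP j (k + c)) => jk; last by rewrite mul0r subr_ge0.
  have -> : h k = 2 * (2 ^+ j * 2^-1 ^+ k).
    rewrite /h min_r // exprS ler_wpM2l // exprVn ler_pdivrMr ?exprn_gt0 //.
    by rewrite -exprD ler_eXn2l ?ltr1n // addnC.
  by rewrite mul1r; lra.
apply: le_trans (_ : \sum_(k < L) (h k - h k.+1) <= _).
  by apply: ler_sum => k _; exact: hS.
have -> : \sum_(k < L) (h k - h k.+1) = h 0%N - h L.
  rewrite -(big_mkord xpredT (fun k => h k - h k.+1)).
  rewrite (eq_bigr (fun k => (- h k.+1) - (- h k))); last by move=> k _; rewrite opprK addrC.
  by rewrite telescope_sumr // opprK addrC.
have : h 0%N <= 2 ^+ c.+1 by rewrite /h ge_min lexx.
by have := h0 L; lra.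
Qed.

(** At scale [2 ^ k] a displacement [2 ^ a] has relative size [2 ^ (a - k)], so the errors from
    scale [a] upwards form a geometric series, bounded independently of [b]. *)
Lemma tail_compare (R : realType) (n : nat) (C1 : R) : 0 <= C1 -> exists2 C : R, 0 < C &
  forall (d : nat) (I : finType) (m : I -> R) (y : I -> 'rV[R]_d),
  (forall i, 0 <= m i) -> upper_regular n m y C1 ->
  forall a b x x', enorm (x - x') <= 2 ^+ a ->
  \sum_(a <= k < b) block_weight R n k * \sum_(2 ^ k <= t < 2 ^ k.+1)
     enorm (cvec m y t x - cvec m y t x') ^+ 2 <= C.
Proof.
move=> C10; pose A : R := C1 * 2 ^+ (2 * n) * (1 + 2) * 7 * (C1 * 2 ^+ (2 * n)).
have A0 : 0 <= A by rewrite /A !mulr_ge0 ?exprn_ge0.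
exists (A * 2 + 1); first by rewrite ltr_wpDl // mulr_ge0.
move=> d I m y m0 up a b x x' xx.
have per k : (a <= k)%N -> block_weight R n k * (\sum_(2 ^ k <= t < 2 ^ k.+1)
     enorm (cvec m y t x - cvec m y t x') ^+ 2) <= A * (2 ^+ a * 2^-1 ^+ k).
  move=> ak; pose P i := enorm (y i - x) <= 2 ^+ (k + 2).
  have h1 t : (2 ^ k <= t < 2 ^ k.+1)%N -> enorm (cvec m y t x - cvec m y t x') ^+ 2 <=
      errsum m P (fun=> 2 ^+ a) (fun i => enorm (y i - x)) t ^+ 2.
    move=> /andP[_ tk]; suff le : enorm (cvec m y t x - cvec m y t x') <=
        errsum m P (fun=> 2 ^+ a) (fun i => enorm (y i - x)) t.
      by rewrite lerXn2r ?nnegrE ?enorm_ge0 // (le_trans _ le) ?enorm_ge0.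
    apply: le_trans (cvec_close _ m0 t xx) _; rewrite /errsum big_mkcond [leRHS]big_mkcond /=.
    apply: ler_sum => i _; have p : 0 <= m i * (2 ^+ a + t%:R * (`|enorm (y i - x) - t%:R| <= 2 ^+ a)%R%:R).
      by rewrite mulr_ge0 // addr_ge0 ?mulr_ge0 ?exprn_ge0.
    case: ifP => h; case: ifP => h' //; move: h'; rewrite /P => /negbT; rewrite -ltNge => h'.
    exfalso; have : t%:R <= 2 ^+ k.+1 :> R by rewrite -natrX ler_nat ltnW.
    have : 2 ^+ a <= 2 ^+ k :> R by rewrite ler_eXn2l ?ltr1n.
    by have := exprn_ge0 k (ler0n R 2); move: h h'; rewrite addn2 !exprS; clear; lra.
  have h2 := @err_block R n d I m y m0 C1 1 2 k x P (fun=> 2 ^+ a) (fun i => enorm (y i - x)) up.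
  have {}h2 := h2 (fun i Pi => Pi).
  have {}h2 : block_weight R n k * \sum_(2 ^ k <= t < 2 ^ k.+1) errsum m P (fun=> 2 ^+ a) (fun i => enorm (y i - x)) t ^+ 2 <=
     C1 * 2 ^+ (2 * n) * (1 + 2) * 7 * 2^-1 ^+ (k * n.+1) * \sum_(i | P i) m i * 2 ^+ a.
    by apply: h2 => [i|i _]; rewrite ?exprn_ege1 ?ler1n // mul1r ler_eXn2l ?ltr1n.
  apply: le_trans (_ : block_weight R n k * \sum_(2 ^ k <= t < 2 ^ k.+1) errsum m P (fun=> 2 ^+ a) (fun i => enorm (y i - x)) t ^+ 2 <= _).
    by rewrite ler_wpM2l ?nk_ge0 //; apply: ler_sum_nat => t; apply: h1.
  apply: le_trans h2 _; rewrite -mulr_suml.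
  have h3 : \sum_(i | P i) m i <= C1 * (2 ^+ (k * n) * 2 ^+ (2 * n)).
    by rewrite -exprD -mulnDl; exact: up.
  have c0 : 0 <= C1 * 2 ^+ (2 * n) * (1 + 2) * 7 * 2^-1 ^+ (k * n.+1) * 2 ^+ a :> R.
    by rewrite !mulr_ge0 ?exprn_ge0 ?invr_ge0.
  rewrite (mulrC _ (2 ^+ a)) mulrA; apply: le_trans (ler_wpM2l c0 h3) _.
  have e : 2^-1 ^+ (k * n.+1) * 2 ^+ (k * n) = 2^-1 ^+ k :> R.
    by rewrite mulnS exprD -mulrA -exprMn mulVf // expr1n mulr1.
  rewrite -e /A le_eqVlt; apply/orP; left; apply/eqP; ring.
apply: le_trans (_ : \sum_(a <= k < b) A * (2 ^+ a * 2^-1 ^+ k) <= _).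
  by apply: ler_sum_nat => k /andP[ak _]; apply: per.
rewrite -mulr_sumr.
have h : \sum_(a <= k < b) 2 ^+ a * 2^-1 ^+ k <= 2 :> R.
  have := @sum_half_tail R a 0 b; rewrite expr1; apply: le_trans.
  rewrite big_geq_mkord big_mkcond /=; apply: ler_sum => k _.
  by rewrite addn0; case: ifP; rewrite ?mul1r ?mul0r.
by have := ler_wpM2l A0 h; lra.
Qed.

Section dyadic.
Context (R : realType).

Lemma pow2_above (x : R) : exists c : nat, x <= 2 ^+ c.
Proof.
exists (Num.truncn x).+1; apply/ltW; apply: lt_le_trans (truncnS_gt x) _.
by rewrite -natrX ler_nat ltnW // ltn_expl.
Qed.

Lemma dyadic_above (x : R) : 1 <= x -> exists2 j : nat, x < 2 ^+ j & 2 ^+ j <= 2 * x.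
Proof.
move=> x1; have ex : exists j : nat, x < 2 ^+ j.
  have [c hc] := pow2_above x; exists c.+1; apply: le_lt_trans hc _.
  by rewrite ltr_eXn2l ?ltr1n.
exists (ex_minn ex); case: ex_minnP => j hj jmin //.
case: j hj jmin => [|j] hj jmin; first by move: hj; rewrite expr0; lra.
rewrite exprS ler_wpM2l // leNgt; apply/negP => h.
by have := jmin j h; rewrite ltnn.
Qed.

Lemma seq_argmin (T : eqType) (s : seq T) (f : T -> R) : (0 < size s)%N ->
  exists2 u, u \in s & forall v, v \in s -> f u <= f v.
Proof.
elim: s => [//|a s IH] _; have [s0|s0] := posnP (size s).
  exists a; first by rewrite mem_head.
  by move=> v; rewrite (size0nil s0) inE => /eqP ->.
have [u us umin] := IH s0; have [au|ua] := leP (f a) (f u).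
  exists a; first by rewrite mem_head.
  by move=> v; rewrite inE => /orP[/eqP ->//|/umin]; apply: le_trans.
exists u; first by rewrite inE us orbT.
by move=> v; rewrite inE => /orP[/eqP ->|/umin //]; apply: ltW.
Qed.

End dyadic.

(** * Square functions on bi-Lipschitz images of lattice sets *)

Lemma count_bilip (R : realType) (n d : nat) (g : 'rV[int]_n -> 'rV[R]_d) (Cb : R)
    (K : seq 'rV[int]_n) (x : 'rV[R]_d) (rad : R) (r : nat) : uniq K ->
  (forall u v, u \in K -> v \in K -> (znorm (u - v))%:R <= Cb * enorm (g u - g v)) ->
  0 <= Cb -> Cb * (2 * rad) <= r%:R ->
  \sum_(u <- K) (enorm (x - g u) <= rad)%R%:R <= (size (zbox n r))%:R :> R.
Proof.
move=> Ku bil Cb0 hr; rewrite sum_pred_count ler_nat -size_filter.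
set s := [seq u <- K | _]; case E : s => [//|u0 s'].
rewrite -E -(size_map (fun u => u - u0)); apply: uniq_leq_size.
  rewrite map_inj_uniq ?filter_uniq //; exact: addIr.
have : u0 \in s by rewrite E mem_head.
rewrite mem_filter => /andP[h0 u0K].
move=> _ /mapP[u us ->]; rewrite mem_bx.
move: us; rewrite mem_filter => /andP[hu uK].
have := bil u u0 uK u0K => hb.
rewrite -(ler_nat R); apply: le_trans hr; apply: le_trans hb _; rewrite ler_wpM2l //.
apply: le_trans (enorm_triangle x _ _) _; rewrite (enormB (g u)).
by move: h0 hu; clear; lra.
Qed.

Lemma smear_close (R : realType) (n d : nat) (psi : 'rV[int]_n -> 'rV[R]_d) (a : 'rV[R]_d)
    (k : nat) (x : 'rV[int]_n) (e : R) :
  (forall c c', c \in zcube n k -> c' \in zcube n k -> enorm (a - psi (x + c - c')) <= e) ->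
  enorm (a - smear k psi x) <= e.
Proof.
move=> h; pose W : R := (size (zcube n k))%:R.
have Wp : 0 < W by rewrite ltr0n size_cb !expn_gt0.
have -> : a - smear k psi x =
    (W ^+ 2)^-1 *: \sum_(c <- zcube n k) \sum_(c' <- zcube n k) (a - psi (x + c - c')).
  under eq_bigr do rewrite sumrB; rewrite sumrB scalerBr; congr (_ - _).
  under eq_bigr do rewrite big_const_seq count_predT iter_addr_0.
  rewrite big_const_seq count_predT iter_addr_0 -mulrnA -scaler_nat natrM -/W -expr2.
  by rewrite scalerA mulVf ?scale1r // expf_neq0 // gt_eqF.
rewrite enormZ ger0_norm ?invr_ge0 ?sqr_ge0 // ler_pdivrMl ?exprn_gt0 //.
apply: le_trans (enorm_sum _ _) _; rewrite expr2 -mulrA.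
apply: sum_le_const => c hc; apply: le_trans (enorm_sum _ _) _.
by apply: sum_le_const => c' hc'; apply: h.
Qed.

(** Each atom is moved to a nearest point [g (pos i)] of the image of [K] and spread over lattice
    cubes of side [2 ^ lev i], comparable to the distance moved plus 1. No point [g u] with [u] in
    [K] is closer to the atom, so scales well below the level do not see it. The resulting density
    is bounded, because the atoms of level at most [j] attached to a cube of side [2 ^ j] lie in a
    ball of comparable radius. The errors start near scale [lev i] and are summed by
    [sum_half_tail]. *)
Lemma bilip_square (R : realType) (n d : nat) (M C1 Cb : R) :
  (0 < n)%N -> 0 <= M -> 0 <= C1 -> 0 <= Cb -> exists2 C : R, 0 < C &
  forall (I : finType) (m : I -> R) (y : I -> 'rV[R]_d),
  (forall i, 0 <= m i) -> upper_regular n m y C1 ->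
  forall g : 'rV[int]_n -> 'rV[R]_d,
  (forall u v, enorm (g u - g v) <= M * (znorm (u - v))%:R) ->
  forall (b : nat) (K : seq 'rV[int]_n), uniq K -> {subset K <= zbox n (2 ^ b)} ->
  (forall u v, u \in K -> v \in K -> (znorm (u - v))%:R <= Cb * enorm (g u - g v)) ->
  \sum_(u <- K) \sum_(k < b) sqfun_block n m y k (g u) <= C * (2 ^+ (b * n) + \sum_i m i).
Proof.
move=> n0 M0 C10 Cb0.
(* This makes the parameter cutoff of [psi] harmless: beyond [2 ^ c * t], the lower Lipschitz bound
   already puts the atom outside the sphere. *)
have [c0 hc0] := pow2_above (2 * Cb + 4); pose c := c0.+1.
have hc : 2 * Cb + 4 <= 2 ^+ c.
  by apply: le_trans hc0 _; rewrite ler_eXn2l ?ltr1n.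
have [a ha] := pow2_above (1 + M).
pose Cf : R := C1 * 2 ^+ (a * n).
have Cf0 : 0 <= Cf by rewrite /Cf mulr_ge0 ?exprn_ge0.
have [Cs Csp smear_sq] := smear_square d c n0 M0 Cf0.
pose A : R := (1 + 2 * M) * 2 ^+ c.+1.
have A0 : 0 <= A by rewrite /A mulr_ge0 ?exprn_ge0 ?addr_ge0 ?mulr_ge0.
have [h hh] := pow2_above (2 + A).
have [h2 hh2] := pow2_above (Cb * 2 * 2 ^+ h).
pose Ca : R := C1 * 2 ^+ (h * n) * (A + 2) * 7.
have Ca0 : 0 <= Ca by rewrite /Ca !mulr_ge0 ?addr_ge0 ?exprn_ge0.
pose Ce : R := Ca * ((1 + 2 * M) * (2 ^+ ((h2 + 2) * n) * 2 ^+ c.+2)).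
have Ce0 : 0 <= Ce by apply: mulr_ge0 => //; rewrite !(exprn_ge0, addr_ge0, mulr_ge0).
pose B : R := 2 ^+ ((c + 8) * n).
have B0 : 0 <= B by rewrite exprn_ge0.
have Cp : 0 < 2 * (Cs * (B + 1)) + 2 * Ce.
  have : 0 < Cs * (B + 1) by rewrite mulr_gt0 // ltr_wpDl.
  lra.
exists (2 * (Cs * (B + 1)) + 2 * Ce) => //.
move=> I m y m0 up g lip b K Ku Kb bil.
set mI := \sum_i m i; have mI0 : 0 <= mI by apply: sumr_ge0.
have [K0|K0] := posnP (size K).
  by rewrite (size0nil K0) big_nil; apply: (mulr_ge0 (ltW Cp)); rewrite addr_ge0 ?exprn_ge0.
have /choice[pos hpos] : forall i, exists u, u \in K /\
    forall v, v \in K -> enorm (y i - g u) <= enorm (y i - g v).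
  by move=> i; have [u uK hu] := seq_argmin (fun u => enorm (y i - g u)) K0; exists u.
have posK i : pos i \in K by case: (hpos i).
have posmin i v : v \in K -> enorm (y i - g (pos i)) <= enorm (y i - g v).
  by case: (hpos i) => _; apply.
(* Adding 1 gives every atom a level and absorbs the additive constants of the shell bounds. *)
pose D i := enorm (y i - g (pos i)) + 1.
have D1 i : 1 <= D i by rewrite lerDr enorm_ge0.
have /choice[lev hlev] : forall i, exists j : nat, D i < 2 ^+ j /\ 2 ^+ j <= 2 * D i.
  by move=> i; have [j j1 j2] := dyadic_above (D1 i); exists j.
have levD i : D i < 2 ^+ lev i by case: (hlev i).
have levD2 i : 2 ^+ lev i <= 2 * D i by case: (hlev i).
have W k : (size (zcube n k))%:R = 2 ^+ (k * n) :> R by rewrite size_cb -expnM natrX.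
have hf j v : dens m pos lev j v <= Cf.
  rewrite /dens W ler_pdivrMl ?exprn_gt0 //.
  pose P i := (lev i <= j)%N && (pos i - v \in zcube n j).
  have h1 : \sum_(i | (lev i <= j)%N) m i * \sum_(c <- zcube n j) (v == pos i - c)%:R <= \sum_(i | P i) m i.
    rewrite big_mkcond [leRHS]big_mkcond /=; apply: ler_sum => i _; rewrite /P.
    case: (lev i <= j)%N => //=.
    have E e : (v == pos i - e) = (e == pos i - v).
      by rewrite eq_sym subr_eq eq_sym [RHS]eq_sym subr_eq addrC eq_sym.
    under eq_bigr do rewrite E.
    rewrite sum_pred_count count_uniq_mem ?cb_uniq //.
    by case: (_ \in _); rewrite ?mulr1 ?mulr0.
  apply: le_trans h1 _.
  have [/existsP[i0 Pi0]|] := boolP [exists i, P i]; last first.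
    by rewrite negb_exists => /forallP nP; rewrite big_pred0 ?mulr_ge0 ?exprn_ge0 // => i; apply/negbTE/nP.
  have h3 : \sum_(i | P i) m i <= \sum_(i | enorm (y i - g (pos i0)) <= 2 ^+ (j + a)) m i.
    rewrite big_mkcond [leRHS]big_mkcond /=; apply: ler_sum => i _.
    case: ifP => [|_]; last by case: ifP.
    move=> /andP[li ci]; case/andP: Pi0 => li0 ci0.
    rewrite (_ : enorm _ <= _) //; apply: le_trans (enorm_triangle (g (pos i)) _ _) _.
    have hz : (znorm (pos i - pos i0) <= 2 ^ j)%N.
      rewrite (_ : pos i - pos i0 = (pos i - v) - (pos i0 - v)); last by rewrite opprB addrA subrK.
      by rewrite ltnW // zn_cbB.
    have g1 := lip (pos i) (pos i0).
    have g2 : (znorm (pos i - pos i0))%:R <= 2 ^+ j :> R by rewrite -natrX ler_nat.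
    have g3 := ler_wpM2l M0 g2.
    have g4 : 2 ^+ lev i <= 2 ^+ j :> R by rewrite ler_eXn2l ?ltr1n.
    have g5 : (1 + M) * 2 ^+ j <= 2 ^+ a * 2 ^+ j by rewrite ler_wpM2r // exprn_ge0.
    rewrite addnC exprD; have := levD i; rewrite /D; move: g1 g3 g4 g5; clear; lra.
  apply: le_trans h3 _; apply: le_trans (up _ _) _.
  by rewrite mulnDl exprD /Cf; lra.
pose T u t k := \sum_(i | (lev i <= (k + c).+1)%N) m i *: smear (lev i) (psi g (2 ^ c) t u) (pos i - u).
pose rho i := (1 + 2 * M) * D i.
have rho1 i : 1 <= rho i.
  by rewrite /rho; have := mulr_ge0 M0 (ltW (lt_le_trans ltr01 (D1 i))); have := D1 i; lra.
have rho0 i : 0 <= rho i by apply: le_trans (rho1 i).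
pose P u k i := (lev i <= (k + c).+1)%N && (enorm (y i - g u) <= 2 ^+ (k + h)).
have main u t k : u \in K -> (2 ^ k <= t < 2 ^ k.+1)%N ->
    enorm (cvec m y t (g u) - T u t k) <= errsum m (P u k) rho (fun i => enorm (y i - g u)) t.
  move=> uK /andP[tk1 tk2].
  pose Tk : R := 2 ^+ k; have Tk1 : 1 <= Tk by rewrite exprn_ege1 // ler1n.
  have t2 : t%:R <= 2 * Tk :> R by rewrite -exprS -natrX ler_nat ltnW.
  have t1 : Tk <= t%:R :> R by rewrite /Tk -natrX ler_nat.
  have c2 : 2 <= 2 ^+ c :> R by rewrite /c exprS ler_peMr // exprn_ege1 // ler1n.
  have Kk : 2 ^+ (k + c).+1 = 2 * Tk * 2 ^+ c :> R by rewrite exprS exprD mulrA.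
  have Dx i : D i <= enorm (y i - g u) + 1 by rewrite lerD2r posmin.
  have cE : cvec m y t (g u) = \sum_(i | (lev i <= (k + c).+1)%N) m i *: phi t%:R (y i - g u).
    rewrite /cvec (bigID (fun i => (lev i <= (k + c).+1)%N)) /= [X in _ + X]big1 ?addr0 // => i.
    rewrite -ltnNge => li; rewrite /phi ifF ?scaler0 //; apply/negbTE; rewrite -leNgt.
    have e1 : 2 ^+ (k + c).+2 <= 2 ^+ lev i :> R by rewrite ler_eXn2l ?ltr1n.
    have e2 : 2 * Tk * 2 <= 2 * Tk * 2 ^+ c by rewrite ler_wpM2l //; move: Tk1; clear; lra.
    move: e1 (levD2 i) (Dx i); rewrite exprS Kk; move: e2 t2 Tk1; clear; lra.
  rewrite cE -sumrB /errsum big_mkcond [leRHS]big_mkcond /=.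
  apply: le_trans (enorm_sum _ _) _; apply: ler_sum => i _.
  rewrite /P; case: (leqP (lev i) (k + c).+1) => li /=; last by rewrite enorm0.
  rewrite -scalerBr enormZ ger0_norm //.
  have lv : 2 ^+ lev i <= 2 * Tk * 2 ^+ c :> R by rewrite -Kk ler_eXn2l ?ltr1n.
  have Di0 : 0 <= D i by apply: le_trans (D1 i).
  have rhoA : rho i <= A * Tk.
    have : (1 + 2 * M) * D i <= (1 + 2 * M) * (2 * Tk * 2 ^+ c).
      rewrite ler_wpM2l ?addr_ge0 ?mulr_ge0 //; apply: le_trans lv; exact/ltW.
    by rewrite /rho /A exprS; clear; lra.
  have close e e' : e \in zcube n (lev i) -> e' \in zcube n (lev i) ->
      enorm (phi t%:R (y i - g u) - psi g (2 ^ c) t u (pos i - u + e - e')) <=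
      if enorm (y i - g u) <= 2 ^+ (k + h) then
        rho i + t%:R * (`|enorm (y i - g u) - t%:R| <= rho i)%R%:R else 0.
    move=> he he'; set w := pos i - u + e - e'; pose v := u + w.
    have zw : (znorm (v - pos i))%:R <= 2 * D i.
      apply: le_trans (levD2 i); rewrite -natrX ler_nat.
      have -> : v - pos i = e - e' by apply: zP => l; rewrite /v /w !zE; clear; lia.
      by rewrite ltnW // zn_cbB.
    have yv : enorm ((y i - g u) - (g v - g u)) <= rho i.
      rewrite opprB addrA subrK; apply: le_trans (enorm_triangle (g (pos i)) _ _) _.
      have := lip (pos i) v; rewrite znB => l1; have l2 := ler_wpM2l M0 zw.
      have dd : enorm (y i - g (pos i)) <= D i by rewrite /D lerDl.
      by rewrite /rho; move: l1 l2 dd; clear; lra.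
    have ifge : 0 <= if enorm (y i - g u) <= 2 ^+ (k + h) then
        rho i + t%:R * (`|enorm (y i - g u) - t%:R| <= rho i)%R%:R else 0.
      by case: ifP => // _; apply: addr_ge0 => //; rewrite mulr_ge0.
    rewrite /psi -/v; case: ltnP => zwt.
      case: (leP (enorm (y i - g u)) (2 ^+ (k + h))) => yh; first exact: phi_close.
      rewrite (phi_close0 yv) ?enorm0 //.
      have : (2 + A) * Tk <= 2 ^+ h * Tk by rewrite ler_wpM2r // (le_trans ler01 Tk1).
      by move: yh rhoA t2; rewrite addnC exprD -/Tk; clear; lra.
    suff -> : phi t%:R (y i - g u) = 0 by rewrite subrr enorm0.
    rewrite /phi ifF //; apply/negbTE; rewrite -leNgt leNgt; apply/negP => yt.
    have z1 := bil (pos i) u (posK i) uK.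
    have z2 : enorm (g (pos i) - g u) <= 2 * t%:R.
      apply: le_trans (enorm_triangle (y i) _ _) _; rewrite (enormB (g _)).
      by have := posmin i u uK; move: yt; clear; lra.
    have z3 := ler_wpM2l Cb0 z2.
    have z4 : (znorm w)%:R <= (znorm (pos i - u))%:R + 2 * D i.
      apply: le_trans (_ : (znorm (v - pos i) + znorm (pos i - u))%N%:R <= _); last first.
        by rewrite natrD addrC lerD2l.
      rewrite ler_nat; have := zn_triangle (pos i) v u.
      by have -> : v - u = w by rewrite /v addrAC subrr add0r.
    have z5 : (2 * Cb + 4) * t%:R <= 2 ^+ c * t%:R by rewrite ler_wpM2r.
    have z6 : 2 ^+ c * t%:R <= (znorm w)%:R :> R by rewrite -natrX -natrM ler_nat.
    have z7 := Dx i; move: z1 z2 z3 z4 z5 z6 z7 yt t1 Tk1; clear; lra.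
  have := smear_close close; case: ifP => _ sc; first by rewrite ler_wpM2l.
  by rewrite -(mulr0 (m i)) ler_wpM2l.
have step u k : u \in K -> sqfun_block n m y k (g u) <=
    2 * (block_weight R n k * \sum_(2 ^ k <= t < 2 ^ k.+1) enorm (T u t k) ^+ 2) +
    2 * (Ca * 2^-1 ^+ (k * n.+1) * \sum_(i | P u k i) m i * rho i).
  move=> uK; have Tk0 : 0 <= 2 ^+ k :> R by rewrite exprn_ge0.
  have hP i : P u k i -> enorm (y i - g u) <= 2 ^+ (k + h) by case/andP.
  have hrho i : P u k i -> rho i <= A * 2 ^+ k.
    move=> /andP[li _]; have lv : 2 ^+ lev i <= 2 ^+ (k + c).+1 :> R by rewrite ler_eXn2l ?ltr1n.
    have : (1 + 2 * M) * D i <= (1 + 2 * M) * 2 ^+ (k + c).+1.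
      rewrite ler_wpM2l ?addr_ge0 ?mulr_ge0 //; apply: le_trans lv; exact/ltW.
    by rewrite /rho /A -addnS exprD; clear; lra.
  have := err_block m0 (fun i => enorm (y i - g u)) up hP rho1 hrho; rewrite -/Ca => eb.
  apply: le_trans (lerD (lexx _) (ler_wpM2l _ eb)); last by [].
  rewrite /sqfun_block mulrCA (mulrCA 2 (block_weight R n k)) -mulrDr ler_wpM2l ?nk_ge0 //.
  rewrite !mulr_sumr -big_split /=; apply: ler_sum_nat => t tk.
  have := enorm_sqrD (T u t k) (cvec m y t (g u) - T u t k); rewrite (addrC (T u t k)) subrK.
  move/le_trans; apply; rewrite lerD2l ler_wpM2l //.
  by rewrite lerXn2r ?nnegrE ?enorm_ge0 ?main // (le_trans _ (main u t k uK tk)) ?enorm_ge0.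
apply: le_trans (_ : 2 * (Cs * (B * 2 ^+ (b * n) + mI)) + 2 * (Ce * mI) <= _); last first.
  have b0 : 0 <= 2 ^+ (b * n) :> R by rewrite exprn_ge0.
  have e1 := mulr_ge0 (mulr_ge0 (ltW Csp) B0) mI0.
  have e2 := mulr_ge0 (ltW Csp) b0; have e3 := mulr_ge0 Ce0 b0.
  by move: e1 e2 e3; clear; lra.
apply: le_trans (_ : \sum_(u <- K) \sum_(k < b)
    (2 * (block_weight R n k * \sum_(2 ^ k <= t < 2 ^ k.+1) enorm (T u t k) ^+ 2) +
     2 * (Ca * 2^-1 ^+ (k * n.+1) * \sum_(i | P u k i) m i * rho i)) <= _).
  by apply: ler_sum_seq_in => u uK; apply: ler_sum => k _; apply: step.
under eq_bigr do rewrite big_split -!mulr_sumr /=.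
rewrite big_split -!mulr_sumr /=; apply: lerD; rewrite ler_wpM2l //.
  rewrite exchange_big /=.
  have := smear_sq g lip I m pos lev m0 hf b (2 ^ b)%N => sm.
  apply: le_trans (le_trans sm _); last first.
    rewrite ler_wpM2l ?(ltW Csp) // lerD2r.
    apply: le_trans (_ : (size (zbox n (2 ^ (b + (c + 6)))))%:R <= _).
      rewrite ler_nat leq_size_bx // [in leqRHS]addnA.
      have s1 : (2 ^ b <= 2 ^ (b + c + 5))%N by rewrite leq_exp2l // -addnA leq_addr.
      by rewrite (addnS _ 5) expnS; move: s1; clear; lia.
    by apply: le_trans (size_bx_pow _ _ _ _) _; rewrite /B -addnA.
  apply: ler_sum => k _; rewrite -mulr_sumr ler_wpM2l ?exprn_ge0 ?invr_ge0 //.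
  apply: (ler_sum_inj (h := id)) => //; rewrite ?bx_uniq //.
  by move=> u; apply: sumr_ge0 => t _; rewrite sqr_ge0.
under eq_bigr do under eq_bigr do rewrite -mulrA.
under eq_bigr do rewrite -mulr_sumr.
rewrite -mulr_sumr /Ce -mulrA ler_wpM2l //.
have -> : \sum_(u <- K) \sum_(k < b) 2^-1 ^+ (k * n.+1) * \sum_(i | P u k i) m i * rho i =
   \sum_i m i * rho i * \sum_(k < b) 2^-1 ^+ (k * n.+1) * \sum_(u <- K) (P u k i)%:R.
  under eq_bigr do under eq_bigr do rewrite big_mkcond mulr_sumr /=.
  under eq_bigr do rewrite exchange_big /=; rewrite exchange_big /=; apply: eq_bigr => i _.
  rewrite exchange_big /= mulr_sumr; apply: eq_bigr => k _.
  rewrite mulrCA mulr_sumr mulr_sumr; apply: eq_bigr => u _.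
  by case: (P u k i); rewrite ?mulr0 // mulr1 mulrC.
rewrite mulr_sumr; apply: ler_sum => i _.
rewrite -mulrA mulrC ler_wpM2r //.
apply: le_trans (_ : rho i * (2 ^+ ((h2 + 2) * n) * \sum_(k < b) (lev i <= k + c.+1)%N%:R * 2^-1 ^+ k) <= _).
  rewrite ler_wpM2l // mulr_sumr; apply: ler_sum => k _.
  rewrite (addnS k c) /P; case: (leqP (lev i) (k + c).+1) => li /=; last first.
    by rewrite big1 ?mulr0 ?mul0r ?mulr0.
  rewrite mul1r.
  (* By the lower Lipschitz bound, an atom is seen at scale [2 ^ k] from at most a multiple of
     [2 ^ (k * n)] points of [K]. *)
  have cnt : \sum_(u <- K) (enorm (y i - g u) <= 2 ^+ (k + h))%R%:R <= 2 ^+ ((h2 + 2) * n) * 2 ^+ (k * n) :> R.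
    apply: le_trans (size_bx_pow R n k h2); apply: count_bilip bil Cb0 _ => //.
    have Tk0 : 0 <= 2 ^+ k :> R by rewrite exprn_ge0.
    by rewrite natrX !exprD; have := ler_wpM2l Tk0 hh2; clear; lra.
  have z0 : 0 <= 2^-1 ^+ (k * n.+1) :> R by rewrite exprn_ge0 ?invr_ge0.
  apply: le_trans (ler_wpM2l z0 cnt) _.
  rewrite mulrCA ler_wpM2l ?exprn_ge0 // mulnS exprD -mulrA -exprMn mulVf // expr1n mulr1 //.
have sh := sum_half_tail R (lev i) c.+1 b.
have f0 : 0 <= 2 ^+ ((h2 + 2) * n) :> R by rewrite exprn_ge0.
have S0 : 0 <= \sum_(k < b) (lev i <= k + c.+1)%N%:R * 2^-1 ^+ k :> R.
  by apply: sumr_ge0 => k _; rewrite mulr_ge0 // exprn_ge0 ?invr_ge0.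
have M1 : 0 <= 1 + 2 * M by rewrite addr_ge0 ?mulr_ge0.
rewrite /rho -!mulrA ler_wpM2l // mulrCA ler_wpM2l //.
apply: le_trans sh; apply: le_trans (ler_wpM2r S0 (ltW (levD i))) _.
rewrite mulr_sumr le_eqVlt; apply/orP; left; apply/eqP; apply: eq_bigr => k _.
by rewrite mulrCA.
Qed.

(** * Bi-Lipschitz pieces *)

Section colouring.
Context (R : realType) (I F : finType) (P : pred I) (f0 : F).
Context (bad : nat -> I -> bool) (lab : nat -> I -> F).
Let Q : R := #|F|%:R.

Let Q0 : 0 < Q.
Proof. by rewrite ltr0n; apply/card_gt0P; exists f0. Qed.

Lemma average_choice (G : F -> R) (X : R) : Q * X <= \sum_f G f -> exists f, X <= G f.
Proof.
move=> h; apply: contrapT => /forallNP nex.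
have : \sum_f G f < \sum_(f : F) X.
  apply: ltr_sum => [|f _]; last by rewrite ltNge; apply/negP/nex.
  by apply/hasP; exists f0; rewrite ?mem_index_enum.
by rewrite sumr_const -mulr_natl ltNge h.
Qed.

Definition agree (rho : nat -> F) K i :=
  all (fun k => bad k i ==> (lab k i == rho k)) (iota 0 K).

(** An index with [c] bad scales agrees with a uniformly random sequence of colours with probability
    [Q^-1 ^ c]. The colours are fixed one scale at a time without lowering the expected mass; the
    last scale is absorbed into the weights before the induction hypothesis is used. *)
Lemma colouring (K : nat) (m : I -> R) : (forall i, 0 <= m i) ->
  exists rho : nat -> F,
  \sum_(i | P i) m i * Q^-1 ^+ (\sum_(k < K) bad k i)%N <= \sum_(i | P i && agree rho K i) m i.
Proof.
elim: K m => [|K IH] m m0.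
  exists (fun=> f0); rewrite le_eqVlt; apply/orP; left; apply/eqP; apply: eq_big => i.
    by rewrite andbT.
  by move=> _; rewrite big_ord0 expr0 mulr1.
pose c i := (\sum_(k < K) bad k i)%N.
have [f hf] : exists f, \sum_(i | P i) m i * Q^-1 ^+ (c i + bad K i) <=
    \sum_(i | P i) m i * (bad K i ==> (lab K i == f))%:R * Q^-1 ^+ c i.
  apply: average_choice; rewrite exchange_big mulr_sumr /=; apply: ler_sum => i Pi.
  rewrite -mulr_suml -mulr_sumr exprD.
  have e : Q * Q^-1 ^+ bad K i <= \sum_f (bad K i ==> (lab K i == f))%:R.
    case: (bad K i); last by rewrite expr0 mulr1 /= sumr_const.
    rewrite /= expr1 mulfV ?gt_eqF // (bigD1 (lab K i)) //= eqxx lerDl.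
    by apply: sumr_ge0.
  have X0 : 0 <= m i * Q^-1 ^+ c i by rewrite mulr_ge0 // exprn_ge0 // invr_ge0 ltW.
  have := ler_wpM2l X0 e; move: (Q^-1 ^+ c i) (Q^-1 ^+ bad K i) (\sum_f _) => A B S.
  by rewrite -!mulrA (mulrC A S) (mulrCA Q) (mulrCA Q) [in leLHS](mulrCA A).
have m'0 i : 0 <= m i * (bad K i ==> (lab K i == f))%:R by rewrite mulr_ge0.
have [rho hrho] := IH _ m'0.
exists (fun k => if k == K then f else rho k).
apply: le_trans (_ : \sum_(i | P i) m i * Q^-1 ^+ (c i + bad K i) <= _).
  by apply: ler_sum => i _; rewrite big_ord_recr.
apply: le_trans hf _; apply: le_trans hrho _.
rewrite big_mkcond [leRHS]big_mkcond /=; apply: ler_sum => i _.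
case: (P i) => //=.
have -> : agree (fun k => if k == K then f else rho k) K.+1 i =
    agree rho K i && (bad K i ==> (lab K i == f)).
  rewrite /agree -addn1 iotaD all_cat /= add0n eqxx andbT; congr (_ && _).
  apply: eq_in_all => k; rewrite mem_iota add0n => /andP[_ kK].
  by rewrite ltn_eqF.
by case: (agree rho K i); case: (_ ==> _); rewrite ?mulr1 ?mulr0.
Qed.

End colouring.

Section cubes.
Context (n : nat).
Implicit Types (u v w : 'rV[int]_n).

Definition cube_index k u : 'rV[int]_n := map_mx (fun a => (a %/ (2 ^ k)%N%:Z)%Z) u.

Lemma idxS k u : cube_index k.+1 u = cube_index 1 (cube_index k u).
Proof.
apply: zP => i; rewrite /cube_index !zE; move: (u 0%R i) => a.
have p : (0 < 2 ^ k)%N by rewrite expn_gt0.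
have p0 : (2 ^ k)%N%:Z != 0 by lia.
have p1 : 0 < (2 ^ k)%N%:Z by lia.
rewrite expnS expn1; set P := (2 ^ k)%N%:Z in p0 p1 *.
have -> : (2 * 2 ^ k)%N%:Z = 2 * P by rewrite PoszM.
have h1 := divz_eq a P; have h2 := modz_ge0 a p0; have h3 := ltz_pmod a p1.
have q0 : (2 * P) != 0 by lia.
have q1 : 0 < 2 * P by lia.
have h4 := divz_eq a (2 * P); have h5 := modz_ge0 a q0; have h6 := ltz_pmod a q1.
set b := (a %/ P)%Z in h1 *.
have h7 := divz_eq b 2; have h8 := @modz_ge0 b 2 isT; have h9 := @ltz_pmod b 2 isT.
move: (a %/ (2 * P))%Z (a %% (2 * P))%Z (a %% P)%Z (b %/ 2)%Z (b %% 2)%Z h1 h2 h3 h4 h5 h6 h7 h8 h9.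
clear -p1; move=> x1 x2 x3 x4 x5 h1 h2 h3 h4 h5 h6 h7 h8 h9.
have [h|h] : x5 = 0 \/ x5 = 1 by lia.
  have e : a = x4 * (2 * P) + x3 by rewrite h1 h7 h; ring.
  have [lt|lt|//] := ltgtP x1 x4.
    have : (x1 + 1) * (2 * P) <= x4 * (2 * P) by rewrite ler_wpM2r //; lia.
    lia.
  have : (x4 + 1) * (2 * P) <= x1 * (2 * P) by rewrite ler_wpM2r //; lia.
  lia.
have e : a = x4 * (2 * P) + P + x3 by rewrite h1 h7 h; ring.
have [lt|lt|//] := ltgtP x1 x4.
  have : (x1 + 1) * (2 * P) <= x4 * (2 * P) by rewrite ler_wpM2r //; lia.
  lia.
have : (x4 + 1) * (2 * P) <= x1 * (2 * P) by rewrite ler_wpM2r //; lia.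
lia.
Qed.

Lemma idx_close k u v : cube_index k u = cube_index k v -> (znorm (u - v) <= 2 ^ k)%N.
Proof.
move=> /rowP h; apply/zn_leP => i; have := h i; rewrite /cube_index !zE.
have p : (0 < 2 ^ k)%N by rewrite expn_gt0.
have p0 : (2 ^ k)%N%:Z != 0 by lia.
have p1 : 0 < (2 ^ k)%N%:Z by lia.
move: (u 0%R i) (v 0%R i) => a b.
have := divz_eq a (2 ^ k)%N; have := modz_ge0 a p0; have := ltz_pmod a p1.
have := divz_eq b (2 ^ k)%N; have := modz_ge0 b p0; have := ltz_pmod b p1.
move: (a %/ _)%Z (a %% _)%Z (b %/ _)%Z (b %% _)%Z => a1 a2 b1 b2 h1 h2 h3 h4 h5 h6 h7.
by rewrite h7 in h6; move: h1 h2 h3 h4 h5 h6; clear; lia.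
Qed.

Lemma idx_bx k u : (znorm u <= 2 ^ k)%N -> (znorm (cube_index k.+1 u) <= 1)%N.
Proof.
move=> hu; apply/zn_leP => i; rewrite /cube_index zE; have := zn_coord u i.
have p : (0 < 2 ^ k)%N by rewrite expn_gt0.
have p0 : (2 ^ k.+1)%N%:Z != 0 by rewrite expnS; lia.
have p1 : 0 < (2 ^ k.+1)%N%:Z by rewrite expnS; lia.
move: (u 0%R i) => a; have := divz_eq a (2 ^ k.+1)%N; have := modz_ge0 a p0; have := ltz_pmod a p1.
move: (a %/ _)%Z (a %% _)%Z => Q r; rewrite expnS PoszM; set P := (2 ^ k)%N in p hu *.
move=> h1 h2 h3 h4.
have Q1 : Q < 2.
  rewrite ltNge; apply/negP => hQ; have := @ler_wpM2r _ (2%N%:Z * P%:Z) _ _ _ hQ.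
  have p2 : 0 <= 2%N%:Z * P%:Z by lia.
  by move=> /(_ p2); move: h1 h2 h3 h4 hu; clear; lia.
have Q2 : - 2 < Q.
  rewrite ltNge; apply/negP => hQ; have := @ler_wpM2r _ (2%N%:Z * P%:Z) _ _ _ hQ.
  have p2 : 0 <= 2%N%:Z * P%:Z by lia.
  by move=> /(_ p2); move: p h1 h2 h3 h4 hu; clear; lia.
by move: Q1 Q2; clear; lia.
Qed.

(** Residues modulo 3: for points at distance in [[2 ^ k, 2 ^ k.+1)] some coordinate of the cube
    index differs by 1 or 2, and only 1 would be detected modulo 2. *)
Definition cube_label k u : 'rV['I_3]_n := map_mx (fun a : int => inord (absz (a %% 3)%Z)) (cube_index k u).

Lemma lab3_neq k u v : (0 < n)%N ->
  (2 ^ k <= znorm (u - v) < 2 ^ k.+1)%N -> cube_label k u <> cube_label k v.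
Proof.
move=> n0 /andP[h1 h2] /rowP e; have [i hi] := zn_max_coord (u - v) n0.
have := e i; rewrite !mxE; move: hi; rewrite zBE; move: (u 0%R i) (v 0%R i) => a b hab.
have p : (0 < 2 ^ k)%N by rewrite expn_gt0.
have p0 : (2 ^ k)%N%:Z != 0 by lia.
have p1 : 0 < (2 ^ k)%N%:Z by lia.
move/(congr1 (fun x : 'I_3 => (x : nat))).
set x := (a %/ _)%Z; set x' := (b %/ _)%Z.
have m1 := @modz_ge0 x 3 isT; have m2 := @ltz_pmod x 3 isT; have m3 := divz_eq x 3.
have m1' := @modz_ge0 x' 3 isT; have m2' := @ltz_pmod x' 3 isT; have m3' := divz_eq x' 3.
rewrite !inordK; [|by move: m1' m2'; clear; lia|by move: m1 m2; clear; lia].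
move=> ee; have emod : (x %% 3)%Z = (x' %% 3)%Z by move: ee m1 m1'; clear; lia.
have := divz_eq a (2 ^ k)%N; have := modz_ge0 a p0; have := ltz_pmod a p1.
have := divz_eq b (2 ^ k)%N; have := modz_ge0 b p0; have := ltz_pmod b p1.
rewrite -/x -/x'; rewrite expnS in h2; move: h1 h2; rewrite hab; set P := (2 ^ k)%N in p *.
move: (a %% P%:Z)%Z (b %% P%:Z)%Z => r r' g1 g2 g3 g4 g5 g6 g7 g8.
have [z hz] : exists z, x - x' = 3 * z.
  exists ((x %/ 3)%Z - (x' %/ 3)%Z).
  by rewrite {1}m3 {1}m3' emod; ring.
have hd : a - b = 3 * z * P%:Z + (r - r') by rewrite g8 g5 -hz; ring.
have [z0|[z0|z0]] : z = 0 \/ 1 <= z \/ z <= -1 by clear; lia.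
- by move: hd g1 g2 g3 g4 g6 g7; rewrite z0; clear; lia.
- have := @ler_wpM2r _ P%:Z _ _ _ z0; have pp : 0 <= P%:Z by [].
  by move=> /(_ pp); move: hd g1 g2 g3 g4 g6 g7; clear; lia.
- have := @ler_wpM2r _ P%:Z _ _ _ z0; have pp : 0 <= P%:Z by [].
  by move=> /(_ pp); move: hd g1 g2 g3 g4 g6 g7; clear; lia.
Qed.

Lemma count_slice r (l : 'I_n) :
  (r.*2.+1 * count (fun p : 'rV[int]_n => p 0%R l == 0) (zbox n r) <= size (zbox n r))%N.
Proof.
rewrite -size_filter; set s := [seq p <- _ | _].
pose f (q : nat * 'rV[int]_n) := \row_i (if i == l then q.1%:Z - r%:Z else q.2 0 i) : 'rV[int]_n.
pose pairs := [seq (t, p) | t <- iota 0 r.*2.+1, p <- s].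
have -> : (r.*2.+1 * size s = size (map f pairs))%N by rewrite size_map size_allpairs size_iota.
apply: uniq_leq_size.
  rewrite map_inj_in_uniq.
    apply: allpairs_uniq; rewrite ?iota_uniq ?filter_uniq ?bx_uniq //.
    by move=> [x1 x2] [y1 y2] _ _ [-> ->].
  move=> q q' /allpairsP[[t p] /= [ht hp ->]] /allpairsP[[t' p'] /= [ht' hp' ->]] e.
  have ei i : f (t, p) 0 i = f (t', p') 0 i by rewrite e.
  have et : t = t'.
    by have := ei l; rewrite /f !zrowE eqxx /=; clear; lia.
  rewrite et; congr pair; apply: zP => i; have := ei i; rewrite /f !zrowE /=.
  case: eqP => [->|//] _; move: hp hp'; rewrite !mem_filter.
  by move=> /andP[/eqP -> _] /andP[/eqP -> _].
move=> _ /mapP[q /allpairsP[[t p] [ht hp ->]] ->]; rewrite mem_bx; apply/zn_leP => i.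
move: ht hp; rewrite /f zrowE mem_iota add0n => ht; rewrite mem_filter mem_bx => /andP[_ hp] /=.
case: ifP => _; last exact: leq_trans (zn_coord p i) hp.
by move: ht => /=; clear; lia.
Qed.

Lemma count_slice_le r (l : 'I_n) :
  (count (fun p : 'rV[int]_n => p 0%R l == 0) (zbox n r) <= r.*2.+1 ^ n.-1)%N.
Proof.
have := count_slice r l; rewrite size_bx; move: (count _ _) => N.
have [n' nE] : exists n', n = n'.+1 by exists n.-1; rewrite prednK // (leq_ltn_trans _ (ltn_ord l)).
by rewrite nE expnS leq_pmul2l.
Qed.

End cubes.

Lemma sum_fibre_le (R : realType) (I : finType) (T : eqType) (P : pred I) (F : I -> R)
    (f : I -> T) (s : seq T) :
  (forall i, 0 <= F i) -> (forall i, P i -> f i \in s) ->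
  \sum_(i | P i) F i <= \sum_(p <- s) \sum_(i | P i && (f i == p)) F i.
Proof.
move=> F0 fs.
rewrite [leRHS](_ : _ = \sum_(p <- s) \sum_(i | P i) (if f i == p then F i else 0)); last first.
  by apply: eq_bigr => p _; rewrite big_mkcondr.
rewrite exchange_big /=; apply: ler_sum => i Pi.
have := @ler_sum_term R T s (fun p => if f i == p then F i else 0) (f i) (fs i Pi).
by rewrite eqxx; apply => p; case: ifP.
Qed.

Section low_cube.
Context (R : realType) (n : nat) (I : finType) (m : I -> R) (kap : I -> 'rV[int]_n) (J : pred I).
Context (c : R).
Hypotheses (m0 : forall i, 0 <= m i) (c0 : 0 <= c).

Definition low_cube k q : bool := \sum_(i | J i && (cube_index k (kap i) == q)) m i < c * 2 ^+ (k * n).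

Definition sparse K i := has (fun k => low_cube k (cube_index k (kap i))) (iota 0 K.+1).

(** The maximal low cubes are disjoint, so their masses add up to at most [c] times the volume. The
    induction finds them by descending through the [2 ^ n] children until a low cube is met. *)
Lemma sum_sparse K q :
  \sum_(i | [&& J i, cube_index K (kap i) == q & sparse K i]) m i <= c * 2 ^+ (K * n).
Proof.
elim: K q => [|K IH] q.
  case: (boolP (low_cube 0 q)) => [l|l].
    apply: le_trans (ltW l); rewrite big_mkcond [leRHS]big_mkcond; apply: ler_sum => i _.
    by case: (J i) => //=; case: (_ == q) => //=; case: (sparse _ _).
  rewrite big1 ?mulr_ge0 ?exprn_ge0 // => i /and3P[_ /eqP e].
  by rewrite /sparse /= e (negbTE l).
case: (boolP (low_cube K.+1 q)) => [l|l].
  apply: le_trans (ltW l); rewrite big_mkcond [leRHS]big_mkcond; apply: ler_sum => i _.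
  by case: (J i) => //=; case: (_ == q) => //=; case: (sparse _ _).
pose ch (e : 'rV[int]_n) := q *+ 2 + e.
apply: le_trans (_ : \sum_(p <- map ch (zcube n 1))
   \sum_(i | [&& J i, cube_index K (kap i) == p & sparse K i]) m i <= _); last first.
  rewrite big_map; apply: le_trans (sum_le_const _) _; first by move=> e _; apply: IH.
  by rewrite size_cb expn1 natrX mulrCA -exprD mulSn.
apply: le_trans (sum_fibre_le (s := map ch (zcube n 1)) (f := fun i => cube_index K (kap i)) m0 _) _.
  move=> i /and3P[_ /eqP e _]; apply/mapP; exists (cube_index K (kap i) - q *+ 2); last first.
    by rewrite /ch addrC subrK.
  rewrite mem_cb; apply/forallP => j; rewrite -e idxS /cube_index !zE expn1.
  move: (kap i 0%R j) => a; set x := (a %/ _)%Z.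
  have := divz_eq x 2; have := @modz_ge0 x 2 isT; have := @ltz_pmod x 2 isT.
  by clear; lia.
apply: ler_sum => p _; rewrite big_mkcond [leRHS]big_mkcond; apply: ler_sum => i _.
case: (J i) => //=; have [e|] := eqVneq (cube_index K.+1 (kap i)) q; last first.
  by move=> _ /=; case: ifP.
rewrite /sparse -(addn1 K.+1) iotaD has_cat /= e (negbTE l) !orbF /=.
by case: (has _ _); case: (_ == _); rewrite /= ?orbF //; case: (low_cube _ _).
Qed.

End low_cube.

(* If [g] nearly collapses the direction [v - u] at scale [2 ^ k], the image of the whole
   cube around [u] is close to an affine image of a hyperplane slice, so it is covered
   by few balls of radius comparable to [2 ^ (k - s)]. *)
Lemma squash (R : realType) (n d : nat) (M C1 C2 : R) : 0 <= M -> 0 <= C1 -> 0 <= C2 ->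
  exists2 C : R, 0 < C & forall (I : finType) (m : I -> R) (y : I -> 'rV[R]_d),
  (forall i, 0 <= m i) -> upper_regular n m y C1 ->
  forall g : 'rV[int]_n -> 'rV[R]_d,
  (forall u v, enorm (g u - g v) <= M * (znorm (u - v))%:R) ->
  forall (J : pred I) (kap : I -> 'rV[int]_n),
  (forall i, J i -> enorm (y i - g (kap i)) <= C2) ->
  forall u v k s, (s <= k)%N -> (2 ^ k <= znorm (v - u) <= 2 ^ k.+2)%N ->
  (forall w, (znorm w <= 2 ^ k.+2)%N -> enorm (taylor_rem g k.+3 u w) <= 2 ^+ (k - s)) ->
  enorm (g v - g u) <= 2 ^+ (k - s) -> (0 < n)%N ->
  \sum_(i | J i && (znorm (kap i - u) <= 2 ^ k)%N) m i <= C * 2^-1 ^+ s * 2 ^+ (k * n).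
Proof.
move=> M0 C10 C20.
(* The spread of the atoms of one bin in units of [2 ^ (k - s)]: two displacements [C2], two
   remainders, and [4 + n * M] from the linear part. *)
have [a ha] := pow2_above (2 * C2 + 2 + 4 + n%:R * M).
exists (C1 * 2 ^+ (a * n) * 2 ^+ (4 * n) + 1).
  by rewrite ltr_pwDr // !mulr_ge0 // exprn_ge0.
move=> I m y m0 up g gL J kap hJ u v k s sk /andP[z1 z2] her hg n0.
set z := v - u in z1 z2; pose h : R := 2 ^+ (k - s).
have h1 : 1 <= h by rewrite exprn_ege1 // ler1n.
have h0 : 0 < h by apply: lt_le_trans h1.
have [l hl] := zn_max_coord z n0.
have zl1 : 1 <= `|real_coord R z l|.
  rewrite /real_coord -intr_norm -natr_absz ler1n -hl; apply: leq_trans z1; by rewrite expn_gt0.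
have zl0 : real_coord R z l != 0 by rewrite -normr_gt0; apply: lt_le_trans zl1.
have zlj j : `|real_coord R z j| <= `|real_coord R z l|.
  by rewrite /real_coord -!intr_norm -!natr_absz ler_nat -hl zn_coord.
pose A := lin_comb (slope g k.+3 u).
have hAz : enorm (A (real_coord R z)) <= 2 * h.
  have -> : A (real_coord R z) = (g v - g u) - taylor_rem g k.+3 u z.
    have uz : u + z = v by rewrite /z addrC subrK.
    by rewrite /taylor_rem uz -/A opprB addrC subrK.
  apply: le_trans (enormD _ _) _; rewrite enormN; have := her z z2; move: hg; rewrite -/h; clear; lra.
(* Subtracting [tau w] times [z] kills the coordinate [l]. Since [l] is a largest coordinate of [z],
   the residual keeps size of order [2 ^ k]. *)
pose tau w : R := real_coord R w l / real_coord R z l.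
pose res w j : R := real_coord R w j - tau w * real_coord R z j.
have tau1 w : `|tau w| * `|real_coord R z l| = `|real_coord R w l|.
  by rewrite -normrM divfK.
have res_le w j : (znorm w <= 2 ^ k)%N -> `|res w j| <= 2 * 2 ^+ k.
  move=> hw; have b i : `|real_coord R w i| <= 2 ^+ k.
    by apply: le_trans (iv_le R w i) _; rewrite -natrX ler_nat.
  rewrite /res; apply: le_trans (ler_normB _ _) _; rewrite normrM.
  have : `|tau w| * `|real_coord R z j| <= `|tau w| * `|real_coord R z l| by rewrite ler_wpM2l.
  have := tau1 w; have := b j; have := b l; clear; lra.
(* Residuals are rounded at mesh [h]. They lie in a hyperplane, so there are of the order of
   [2 ^ (s * (n - 1))] bins, each of mass at most a multiple of [h ^ n]; the missing dimension is
   the gain [2 ^- s]. *)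
pose bin w : 'rV[int]_n := \row_j Num.floor (res w j / h).
have binE w j : (bin w 0 j)%:~R <= res w j / h < (bin w 0 j)%:~R + 1.
  by rewrite /bin zrowE; have := floor_itv (res w j / h); rewrite intrD.
pose r := (2 ^ (s + 2))%N.
pose bins := seq.filter (fun p : 'rV[int]_n => p 0%R l == 0) (zbox n r).
have kE : 2 ^+ k = h * 2 ^+ s :> R by rewrite -exprD subnK.
have s1 : 1 <= 2 ^+ s :> R by rewrite exprn_ege1 // ler1n.
have rE : r%:R = 4 * 2 ^+ s :> R by rewrite /r natrX exprD; ring.
have inbins w : (znorm w <= 2 ^ k)%N -> bin w \in bins.
  move=> hw; rewrite mem_filter mem_bx; apply/andP; split.
    rewrite /bin zrowE /res /tau divfK // subrr mul0r floor0 //.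
  apply/zn_leP => j; rewrite -(ler_nat R) natr_absz intr_norm.
  have := binE w j; have hr := res_le w j hw.
  have : `|res w j / h| <= 2 * 2 ^+ s.
    rewrite normrM normfV (ger0_norm (ltW h0)) ler_pdivrMr //.
    by apply: le_trans hr _; rewrite kE; clear; lra.
  rewrite rE !ler_norml; move: s1; clear; lra.
have close w w' : bin w = bin w' -> enorm (A (real_coord R (w - w'))) <=
    n%:R * M * h + `|tau w - tau w'| * (2 * h).
  move=> e; have -> : A (real_coord R (w - w')) = (tau w - tau w') *: A (real_coord R z) +
      A (fun j => res w j - res w' j).
    rewrite /A -linZ -linD; apply: eq_bigr => j _; congr (_ *: _).
    by rewrite /res /real_coord zBE intrB; ring.
  apply: le_trans (enormD _ _) _; rewrite enormZ.
  have b2 : enorm (A (fun j => res w j - res w' j)) <= n%:R * (h * M).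
    apply: lin_le => [i|j|]; last exact: ltW.
      by apply: le_trans (gr_le gL _ _ _) _; rewrite ger0_norm.
    have := binE w j; have := binE w' j; rewrite e; move: (bin w' 0 j)%:~R => q q1 q2.
    have -> : res w j - res w' j = h * (res w j / h - res w' j / h) by field; rewrite gt_eqF.
    rewrite normrM (ger0_norm (ltW h0)) -[leRHS]mulr1 ler_wpM2l ?(ltW h0) // ler_norml; move: q1 q2; clear; lra.
  have : `|tau w - tau w'| * enorm (A (real_coord R z)) <= `|tau w - tau w'| * (2 * h) by rewrite ler_wpM2l.
  move: b2; clear; lra.
apply: le_trans (sum_fibre_le (s := bins) (f := fun i => bin (kap i - u)) m0 _) _.
  by move=> i /andP[_ hi]; apply: inbins.
have mass p : \sum_(i | J i && (znorm (kap i - u) <= 2 ^ k)%N && (bin (kap i - u) == p)) m i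
    <= C1 * 2 ^+ ((a + (k - s)) * n).
  case: (pickP (fun i => J i && (znorm (kap i - u) <= 2 ^ k)%N && (bin (kap i - u) == p))) =>
    [i0 /andP[/andP[J0 z0] /eqP b0]|]; last first.
    by move=> e; rewrite big_pred0 // mulr_ge0 // exprn_ge0.
  apply: le_trans (up (y i0) _); rewrite big_mkcond [leRHS]big_mkcond; apply: ler_sum => i _.
  case: ifP => [|_]; last by case: ifP.
  move=> /andP[/andP[Ji zi] /eqP bi]; rewrite ifT //.
  set w := kap i - u in zi bi; set w0 := kap i0 - u in z0 b0.
  have gE i' : g (kap i') = g u + A (real_coord R (kap i' - u)) + taylor_rem g k.+3 u (kap i' - u).
    rewrite /taylor_rem -/A (_ : u + (kap i' - u) = kap i'); last by rewrite addrC subrK.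
    by rewrite addrC -(addrA (g _)) -opprD subrK.
  have hw : (znorm w <= 2 ^ k.+2)%N by apply: leq_trans zi _; rewrite leq_pexp2l // leqW.
  have hw0 : (znorm w0 <= 2 ^ k.+2)%N by apply: leq_trans z0 _; rewrite leq_pexp2l // leqW.
  have e1 := her w hw; have e0 := her w0 hw0.
  have cl : enorm (A (real_coord R (w - w0))) <= (4 + n%:R * M) * h.
    have := close w w0; rewrite bi b0 => /(_ erefl).
    have t1 w1 : (znorm w1 <= 2 ^ k)%N -> `|tau w1| <= 1.
      move=> hw1; rewrite -(ler_pM2r (lt_le_trans ltr01 zl1)) tau1 mul1r.
      apply: le_trans (iv_le R w1 l) _; rewrite /real_coord -intr_norm -natr_absz ler_nat -hl.
      exact: leq_trans z1.
    have tt : `|tau w - tau w0| * (2 * h) <= 2 * (2 * h).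
      rewrite ler_wpM2r ?mulr_ge0 ?(ltW h0) //; apply: le_trans (ler_normB _ _) _.
      have := t1 w zi; have := t1 w0 z0; clear; lra.
    by move: tt; clear; lra.
  have -> : y i - y i0 = (y i - g (kap i)) - (y i0 - g (kap i0)) +
     (taylor_rem g k.+3 u w - taylor_rem g k.+3 u w0) + A (real_coord R (w - w0)).
    have -> : A (real_coord R (w - w0)) = A (real_coord R w) - A (real_coord R w0).
      have := lin_ivD (slope g k.+3 u) (w - w0) w0; rewrite subrK /A => ->.
      by rewrite addrK.
    rewrite !gE -/w -/w0; apply/rowP => j; rewrite !mxE; ring.
  apply: le_trans (enormD _ _) _; apply: le_trans (lerD (enormD _ _) (lexx _)) _.
  apply: le_trans (lerD (lerD (enormD _ _) (enormD _ _)) (lexx _)) _; rewrite !enormN.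
  rewrite exprD -/h.
  have : (2 * C2 + 2 + 4 + n%:R * M) * h <= 2 ^+ a * h by rewrite ler_wpM2r // ltW.
  have : C2 <= C2 * h by rewrite ler_peMr.
  have := hJ _ Ji; have := hJ _ J0; move: e1 e0 cl; rewrite -/h; clear; nra.
apply: le_trans (sum_le_const (c := C1 * 2 ^+ ((a + (k - s)) * n)) _) _ => //.
have sz : (size bins)%:R <= 2 ^+ (s * n) * 2 ^+ (4 * n) * 2^-1 ^+ s :> R.
  have := count_slice_le r l; rewrite -size_filter -/bins => hb.
  apply: le_trans (_ : ((r.*2.+1) ^ n.-1)%N%:R <= _); first by rewrite ler_nat.
  rewrite natrX; apply: le_trans (_ : (2 ^+ (s + 4)) ^+ n.-1 <= _).
    apply: lerXn2r; rewrite ?nnegrE ?exprn_ge0 //.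
    rewrite -muln2 -natr1 natrM rE exprD; move: s1; clear; lra.
  rewrite -exprM.
  have -> : 2 ^+ (s * n) = 2 ^+ (s * n.-1) * 2 ^+ s :> R.
    by rewrite -exprD -mulnSr prednK.
  rewrite mulnDl exprD; rewrite exprVn mulrAC mulfK ?expf_neq0 //.
  by rewrite ler_wpM2l ?exprn_ge0 // ler_eXn2l ?ltr1n // leq_mul2l leq_pred orbT.
have P0 : 0 <= C1 * 2 ^+ ((a + (k - s)) * n) by rewrite mulr_ge0 // exprn_ge0.
apply: le_trans (ler_wpM2r P0 sz) _.
have -> : 2 ^+ (s * n) * 2 ^+ (4 * n) * 2^-1 ^+ s * (C1 * 2 ^+ ((a + (k - s)) * n)) =
   (C1 * 2 ^+ (a * n) * 2 ^+ (4 * n)) * 2^-1 ^+ s * 2 ^+ (k * n) :> R.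
  have -> : 2 ^+ (k * n) = 2 ^+ (s * n) * 2 ^+ ((k - s) * n) :> R.
    by rewrite -exprD -mulnDl subnKC.
  rewrite mulnDl exprD; ring.
by rewrite ler_wpM2r ?exprn_ge0 // ler_wpM2r ?exprn_ge0 ?invr_ge0 // lerDl.
Qed.

(** The box is half as large as what [dorronsoro] allows at scale [k.+3]; the margin is spent in
    [bad_count] on translating [w]. *)
Definition nonflat (R : realType) n d (g : 'rV[int]_n -> 'rV[R]_d) s k u : bool :=
  has (fun w => 2 ^+ (k - s) < enorm (taylor_rem g k.+3 u w)) (zbox n (2 ^ k.+2)).

Lemma taylor_rem_lip (R : realType) n d (M : R) (g : 'rV[int]_n -> 'rV[R]_d) k u w w' : 0 <= M ->
  (forall u v, enorm (g u - g v) <= M * (znorm (u - v))%:R) ->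
  enorm (taylor_rem g k u w - taylor_rem g k u w') <= n.+1%:R * M * (znorm (w - w'))%:R.
Proof.
move=> M0 gL.
have -> : taylor_rem g k u w - taylor_rem g k u w' = (g (u + w) - g (u + w')) - lin_comb (slope g k u) (real_coord R (w - w')).
  have := lin_ivD (slope g k u) (w - w') w'; rewrite subrK /taylor_rem => ->.
  by apply/rowP => j; rewrite !mxE; ring.
apply: le_trans (enormD _ _) _; rewrite enormN -natr1 mulrDl mulrDl mul1r addrC -mulrA.
apply: lerD; last first.
  by apply: le_trans (gL _ _) _; rewrite opprD addrACA subrr add0r.
rewrite (mulrC M); apply: lin_le => // i; last exact: iv_le.
by apply: le_trans (gr_le gL _ _ _) _; rewrite ger0_norm.
Qed.

(** Chebyshev's inequality. The remainder is Lipschitz in [w], so a value above [2 ^ (k - s)] at one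
    point persists, up to a factor 2, on a box of comparable radius [2 ^ q], and this makes the
    square sum at [u] large. The threshold [k0] ensures that [q] is a natural number. *)
Lemma bad_count (R : realType) n d (M : R) s : 0 <= M -> exists k0 : nat, (s <= k0)%N /\
  exists2 C : R, 0 < C & forall g : 'rV[int]_n -> 'rV[R]_d,
  (forall u v, enorm (g u - g v) <= M * (znorm (u - v))%:R) ->
  forall b, \sum_(k < b.+2 | (k0 <= k)%N) \sum_(u <- zbox n (2 ^ b)) (nonflat g s k u)%:R
     <= C * 2 ^+ (b * n).
Proof.
move=> M0; have [C C0 hC] := dorronsoro R n d.
have [a ha] := pow2_above (2 * (n.+1%:R * M)).
exists (s + a)%N; split; first by rewrite leq_addr.
pose C1 : R := 4 * 64 * 4 ^+ s * 2 ^+ (5 * n) * 2 ^+ ((s + a) * n).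
have C10 : 0 <= C1 by rewrite /C1 !mulr_ge0 // exprn_ge0.
exists (C1 * (C * M ^+ 2 * 2 ^+ (11 * n)) + 1).
  by rewrite ltr_pwDr // !mulr_ge0 ?exprn_ge0 ?(ltW C0).
move=> g gL b; have [x [x0 hx sx]] := hC M g gL b.+3 (2 ^ b)%N.
have one (k : nat) : (s + a <= k)%N -> (k < b.+2)%N ->
    \sum_(u <- zbox n (2 ^ b)) (nonflat g s k u)%:R <= C1 * x k.+2.
  move=> hk kb; pose q := (k - (s + a))%N; pose h : R := 2 ^+ (k - s).
  have h0 : 0 < h by rewrite exprn_gt0.
  have qh : h = 2 ^+ a * 2 ^+ q :> R.
    by rewrite -exprD /h; congr (_ ^+ _); move: hk; rewrite /q; clear; lia.
  pose E u : R := \sum_(w <- zbox n (2 ^ k.+3)) enorm (taylor_rem g k.+3 u w) ^+ 2.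
  have bE u : (nonflat g s k u)%:R * (2 ^+ (q * n) * (h ^+ 2 / 4)) <= E u.
    have E0 : 0 <= E u by apply: sumr_ge0 => w _; rewrite sqr_ge0.
    rewrite /nonflat; case: hasP => [[w wbx hw]|_]; last by rewrite mul0r.
    rewrite mul1r; apply: le_trans (_ : \sum_(e <- zbox n (2 ^ q)) enorm (taylor_rem g k.+3 u (e + w)) ^+ 2 <= _); last first.
      apply: (@sum_bx_shift _ _ _ _ _ (fun w => enorm (taylor_rem g k.+3 u w) ^+ 2)); last first.
        by move=> w'; rewrite sqr_ge0.
      move: wbx; rewrite mem_bx => wbx; rewrite (expnS 2 k.+2) mul2n -addnn.
      rewrite leq_add // leq_pexp2l //; move: hk; rewrite /q; clear; lia.
    apply: le_trans (_ : (size (zbox n (2 ^ q)))%:R * (h ^+ 2 / 4) <= _).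
      rewrite ler_wpM2r ?divr_ge0 ?sqr_ge0 // exprM -natrX -natrX ler_nat size_bx.
      by have [->|n0] := posnP n; rewrite ?expn0 // leq_exp2r //; clear; lia.
    rewrite -sum_const_seq; apply: ler_sum_seq_in => e; rewrite mem_bx => ez.
    have le2 : h / 2 <= enorm (taylor_rem g k.+3 u (e + w)).
      have := taylor_rem_lip k.+3 u w (e + w) M0 gL; have -> : w - (e + w) = - e by rewrite opprD addrCA subrr addr0.
      rewrite znN => l1.
      have l2 : n.+1%:R * M * (znorm e)%:R <= h / 2.
        apply: le_trans (_ : n.+1%:R * M * 2 ^+ q <= _).
          by rewrite ler_wpM2l ?mulr_ge0 // -natrX ler_nat.
        have := ler_wpM2r (exprn_ge0 q (ler0n R 2)) ha; rewrite -qh; clear; lra.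
      have := enorm_triangle (taylor_rem g k.+3 u (e + w)) (taylor_rem g k.+3 u w) 0.
      rewrite !subr0; move: hw l1 l2; rewrite -/h; clear; lra.
    have -> : h ^+ 2 / 4 = (h / 2) ^+ 2 by field.
    by rewrite lerXn2r ?nnegrE ?enorm_ge0 // divr_ge0 // ltW.
  have p0 : 0 < 2 ^+ (q * n) * (h ^+ 2 / 4) by rewrite mulr_gt0 ?divr_gt0 ?exprn_gt0.
  rewrite -(ler_pM2r p0) mulr_suml.
  apply: le_trans (ler_sum _ (fun u _ => bE u)) _; rewrite exchange_big /=.
  apply: le_trans (_ : (size (zbox n (2 ^ k.+3)))%:R * (4 ^+ k.+3 * x k.+2) <= _).
    apply: sum_le_const => w; rewrite mem_bx => hw; apply: hx => //.
  have -> : C1 * x k.+2 * (2 ^+ (q * n) * (h ^+ 2 / 4)) =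
      2 ^+ (5 * n) * 2 ^+ (k * n) * (4 ^+ k.+3 * x k.+2).
    have -> : 2 ^+ (k * n) = 2 ^+ (q * n) * 2 ^+ ((s + a) * n) :> R.
      by rewrite -exprD -mulnDl /q subnK.
    have -> : 4 ^+ k.+3 = 64 * (4 ^+ s * h ^+ 2) :> R.
      have -> : 4 = 2 ^+ 2 :> R by ring.
      rewrite /h -!exprM -exprD (_ : (2 * k.+3)%N = (6 + (2 * s + (k - s) * 2))%N).
        by rewrite exprD; congr (_ * _); ring.
      by move: hk; clear; lia.
    by rewrite /C1; field.
  apply: ler_wpM2r; first by apply: mulr_ge0; [apply: exprn_ge0|].
  have := size_bx_pow R n k 3; rewrite addn3.
  exact.
apply: le_trans (_ : \sum_(k < b.+2 | (s + a <= k)%N) C1 * x k.+2 <= _).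
  by apply: ler_sum => k hk; apply: one.
apply: le_trans (_ : \sum_(k < b.+2) C1 * x k.+2 <= _).
  by rewrite big_mkcond; apply: ler_sum => k _; case: ifP => // _; rewrite mulr_ge0.
clearbody C1; rewrite -mulr_sumr.
apply: le_trans (_ : C1 * (C * M ^+ 2 * (size (zbox n (2 ^ b + 2 ^ (b.+3 + 5))))%:R) <= _).
  rewrite ler_wpM2l //; apply: le_trans sx.
  rewrite [leRHS]big_ord_recl [X in _ <= _ + X]big_ord_recl /= addrA lerDr addr_ge0 //.
apply: le_trans (_ : C1 * (C * M ^+ 2 * 2 ^+ (11 * n)) * 2 ^+ (b * n) <= _); last first.
  by rewrite ler_wpM2r ?exprn_ge0 // lerDl.
rewrite -(mulrA C1); apply: (ler_wpM2l C10); rewrite -(mulrA (C * M ^+ 2)).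
apply: ler_wpM2l; first by apply: mulr_ge0 (sqr_ge0 M); apply: ltW.
have e : (size (zbox n (2 ^ (b + 9))))%:R <= 2 ^+ (11 * n) * 2 ^+ (b * n) :> R := size_bx_pow R n b 9.
apply: le_trans e; rewrite ler_nat leq_size_bx //.
have -> : (b + 9 = 8 + b.+1)%N by clear; lia.
rewrite (_ : (b.+3 + 5 = 8 + b)%N); last by clear; lia.
have A0 : (0 < 2 ^ 8)%N by rewrite expn_gt0.
rewrite (expnD 2 8 b) (expnD 2 8 b.+1) (expnS 2 b); move: (2 ^ b)%N (2 ^ 8)%N A0 => B A A0.
have -> : (A * (2 * B) = A * B + A * B)%N by clear; lia.
by rewrite leq_add // leq_pmull.
Qed.

Lemma sum_ltn_ord (N k0 : nat) : (\sum_(k < N) (k < k0) <= k0)%N.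
Proof.
suff -> : (\sum_(k < N) (k < k0) = minn N k0)%N by rewrite geq_minr.
elim: N => [|N IH]; first by rewrite big_ord0 min0n.
by rewrite big_ord_recr /= IH; case: (ltnP N k0); lia.
Qed.

(* Jones' decomposition: Lipschitz images of lattice cubes carrying a fixed proportion of
   mass contain a bi-Lipschitz piece which still carries a fixed proportion. *)
Lemma jones (R : realType) n d (M C1 C2 theta : R) :
  (0 < n)%N -> 0 <= M -> 0 <= C1 -> 0 <= C2 -> 0 < theta ->
  exists Cb eta : R, [/\ 0 <= Cb, 0 < eta &
  forall (I : finType) (m : I -> R) (y : I -> 'rV[R]_d),
  (forall i, 0 <= m i) -> upper_regular n m y C1 ->
  forall g : 'rV[int]_n -> 'rV[R]_d,
  (forall u v, enorm (g u - g v) <= M * (znorm (u - v))%:R) ->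
  forall (J : pred I) (kap : I -> 'rV[int]_n) b,
  (forall i, J i -> (znorm (kap i) <= 2 ^ b)%N) ->
  (forall i, J i -> enorm (y i - g (kap i)) <= C2) ->
  theta * 2 ^+ (b * n) <= \sum_(i | J i) m i ->
  exists J' : pred I, [/\ forall i, J' i -> J i,
    forall i i', J' i -> J' i' ->
      (znorm (kap i - kap i'))%:R <= Cb * enorm (g (kap i) - g (kap i')) &
    eta * 2 ^+ (b * n) <= \sum_(i | J' i) m i]].
Proof.
move=> n0 M0 C10 C20 th0.
have [a ha] := pow2_above (C2 + M).
pose Cm := C1 * 2 ^+ (a * n).
have Cm0 : 0 <= Cm by rewrite mulr_ge0 // exprn_ge0.
have [Csq Csq0 hsq] := squash n d M0 C10 C20.
(* At most [3 ^ n] cubes of level [b.+1] cover the box, each of volume [2 ^ n * 2 ^ (b * n)]; with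
   this threshold the low cubes lose at most [theta / 4 * 2 ^ (b * n)]. *)
pose c := theta / 4 / (3 ^+ n * 2 ^+ n).
have p3 : 0 < 3 ^+ n * 2 ^+ n :> R by rewrite mulr_gt0 // exprn_gt0.
have c0 : 0 < c by rewrite !divr_gt0.
(* With this [s] a squashed cube has density below the threshold [c]. *)
have [s hs] := pow2_above (Csq / c + 1).
have sc : Csq * 2^-1 ^+ s < c.
  rewrite exprVn ltr_pdivrMr ?exprn_gt0 // mulrC -ltr_pdivrMr //.
  by apply: lt_le_trans hs; rewrite ltrDl.
have [k0 [sk0 [C' C'0 hC']]] := @bad_count R n d M s M0.
pose C3 := k0%:R * Cm + Cm * C'.
have C30 : 0 <= C3 by rewrite addr_ge0 ?mulr_ge0 // ltW.
(* Chebyshev's inequality for the number of bad scales: the atoms with more than [N0] of them cost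
   another [theta / 4]. *)
have [N' hN'] := pow2_above (4 * C3 / theta); pose N0 := (2 ^ N')%N.
pose F := 'rV['I_3]_n; pose f0 : F := const_mx ord0.
pose Q : R := #|{: F}|%:R.
have Q1 : 1 <= Q by rewrite ler1n; apply/card_gt0P; exists f0.
have Q0 : 0 < Q by apply: lt_le_trans Q1.
exists (2 ^+ s.+1), (theta / 2 * Q^-1 ^+ N0); split.
- by rewrite exprn_ge0.
- by rewrite mulr_gt0 ?divr_gt0 ?exprn_gt0 ?invr_gt0.
move=> I m y m0 up g gL J kap b hkap hJ hth.
have massJ u k : \sum_(i | J i && (znorm (kap i - u) <= 2 ^ k)%N) m i <= Cm * 2 ^+ (k * n).
  rewrite /Cm -mulrA -exprD -mulnDl.
  apply: le_trans (up (g u) _); rewrite big_mkcond [leRHS]big_mkcond; apply: ler_sum => i _.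
  case: ifP => [/andP[Ji hi]|_]; last by case: ifP.
  rewrite ifT //; apply: le_trans (enorm_triangle (g (kap i)) _ _) _.
  apply: le_trans (lerD (hJ _ Ji) (gL _ _)) _; rewrite exprD.
  have k1 : 1 <= 2 ^+ k :> R by rewrite exprn_ege1 // ler1n.
  have hi' : (znorm (kap i - u))%:R <= 2 ^+ k :> R by rewrite -natrX ler_nat.
  have := ler_wpM2l M0 hi'; have := ler_wpM2l C20 k1.
  have := ler_wpM2r (exprn_ge0 k (ler0n R 2)) ha; clear; lra.
have massT : \sum_(i | J i) m i <= Cm * 2 ^+ (b * n).
  apply: le_trans (massJ 0 b); rewrite le_eqVlt; apply/orP; left; apply/eqP.
  by apply: eq_bigl => i; case: (boolP (J i)) => //= Ji; rewrite subr0 hkap.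
have fib u : \sum_(i | J i && (kap i == u)) m i <= Cm.
  have := massJ u 0%N; rewrite mul0n expr0 mulr1; apply: le_trans.
  rewrite big_mkcond [leRHS]big_mkcond; apply: ler_sum => i _.
  by case: (J i) => //=; case: eqP => [->|_]; rewrite ?subrr ?zn0 //; case: ifP.
pose sp i := sparse m kap J c b.+1 i.
have mass1 : \sum_(i | J i && sp i) m i <= theta / 4 * 2 ^+ (b * n).
  apply: le_trans (sum_fibre_le (s := zbox n 1) (f := fun i => cube_index b.+1 (kap i)) m0 _) _.
    by move=> i /andP[Ji _]; rewrite mem_bx; apply/idx_bx/hkap.
  apply: le_trans (sum_le_const (c := c * 2 ^+ (b.+1 * n)) _) _.
    move=> q _; apply: le_trans (sum_sparse kap J m0 (ltW c0) b.+1 q).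
    by rewrite le_eqVlt; apply/orP; left; apply/eqP/eq_bigl => i; rewrite -andbA (andbC (sp i)).
  rewrite size_bx natrX /c mulSn exprD le_eqVlt; apply/orP; left; apply/eqP.
  by field; rewrite !expf_neq0.
(* The scales below [k0], not covered by [bad_count], are declared bad; they add at most [k0] to the
   count. *)
pose bd k i := (k < k0)%N || nonflat g s k (kap i).
pose cnt i := (\sum_(k < b.+2) bd k i)%N.
have mass2 : \sum_(i | J i) m i * (cnt i)%:R <= C3 * 2 ^+ (b * n).
  have cntE i : (cnt i)%:R <= k0%:R + \sum_(k < b.+2 | (k0 <= k)%N) (nonflat g s k (kap i))%:R :> R.
    apply: le_trans (_ : ((\sum_(k < b.+2) (k < k0)) + \sum_(k < b.+2 | (k0 <= k)%N) nonflat g s k (kap i))%N%:R <= _).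
      rewrite ler_nat [X in (_ <= _ + X)%N]big_mkcond -big_split /=; apply: leq_sum => k _.
      by rewrite /bd; case: ltnP => //= _; rewrite leq_addr.
    by rewrite natrD; apply: lerD; rewrite ?ler_nat ?sum_ltn_ord // natr_sum.
  apply: le_trans (ler_sum _ (fun i _ => ler_wpM2l (m0 i) (cntE i))) _.
  under eq_bigr do rewrite mulrDr mulr_sumr.
  rewrite big_split /= -mulr_suml /C3 mulrDl.
  apply: lerD; first by rewrite mulrC -mulrA ler_wpM2l.
  rewrite exchange_big /= -mulrA; apply: le_trans (ler_wpM2l Cm0 (hC' g gL b)).
  rewrite mulr_sumr; apply: ler_sum => k _.
  have m'0 i : 0 <= m i * (nonflat g s k (kap i))%:R by rewrite mulr_ge0.
  apply: le_trans (sum_fibre_le (s := zbox n (2 ^ b)) (f := kap) m'0 _) _.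
    by move=> i Ji; rewrite mem_bx hkap.
  rewrite mulr_sumr; apply: ler_sum => u _.
  rewrite (eq_bigr (fun i => m i * (nonflat g s k u)%:R)); last by move=> i /andP[_ /eqP ->].
  by rewrite -mulr_suml ler_wpM2r.
have mass3 : \sum_(i | J i && (N0 < cnt i)%N) m i <= theta / 4 * 2 ^+ (b * n).
  have N00 : 0 < N0%:R :> R by rewrite ltr0n expn_gt0.
  rewrite -(ler_pM2r N00) mulr_suml.
  apply: le_trans (_ : C3 * 2 ^+ (b * n) <= _).
    apply: le_trans mass2; rewrite big_mkcondr /=; apply: ler_sum => i _.
    by case: ifP => [h|_]; rewrite ?mulr_ge0 // ler_wpM2l // ler_nat ltnW.
  rewrite mulrAC ler_wpM2r ?exprn_ge0 //.
  move: hN'; rewrite -natrX -/N0 ler_pdivrMr //; clear; lra.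
pose P i := [&& J i, ~~ sp i & (cnt i <= N0)%N].
have massP : theta / 2 * 2 ^+ (b * n) <= \sum_(i | P i) m i.
  have : \sum_(i | J i) m i <= \sum_(i | P i) m i + \sum_(i | J i && sp i) m i +
      \sum_(i | J i && (N0 < cnt i)%N) m i.
    rewrite big_mkcond [X in _ <= X + _ + _]big_mkcond [X in _ <= _ + X + _]big_mkcond.
    rewrite [X in _ <= _ + _ + X]big_mkcond -!big_split /=; apply: ler_sum => i _.
    rewrite /P; have := m0 i; case: (J i) => /=; rewrite ?addr0 //.
    by case: (sp i) => /=; case: ltnP => //= _; rewrite ?add0r ?addr0 // => h; rewrite lerDl.
  move: mass1 mass3 hth; clear; lra.
have [rho hrho] := @colouring R I F P f0 bd (fun k i => cube_label k (kap i)) b.+2 m m0.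
exists (fun i => P i && agree bd (fun k i => cube_label k (kap i)) rho b.+2 i); split.
- by move=> i /andP[/and3P[]].
(* The contrapositive of [squash]: if the distance collapsed at a good scale, [kap i] would lie in a
   low cube, and [P] excludes sparse points. *)
- have nb i i' k : P i -> (k < b.+2)%N ->
      (2 ^ k <= znorm (kap i' - kap i) < 2 ^ k.+1)%N -> ~~ bd k i ->
      (znorm (kap i' - kap i))%:R <= 2 ^+ s.+1 * enorm (g (kap i') - g (kap i)).
    move=> /and3P[Ji nsp _] kb /andP[z1 z2]; rewrite negb_or -leqNgt => /andP[kk0 nbad].
    have sk : (s <= k)%N by apply: leq_trans kk0.
    apply: le_trans (_ : 2 ^+ k.+1 <= _); first by rewrite -natrX ler_nat ltnW.
    have -> : 2 ^+ k.+1 = 2 ^+ s.+1 * 2 ^+ (k - s) :> R.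
      by rewrite -exprD addSn subnKC.
    rewrite ler_wpM2l ?exprn_ge0 // leNgt; apply/negP => hlt.
    have z2' : (2 ^ k <= znorm (kap i' - kap i) <= 2 ^ k.+2)%N.
      by rewrite z1 (leq_trans (ltnW z2)) // leq_pexp2l.
    have ner w : (znorm w <= 2 ^ k.+2)%N -> enorm (taylor_rem g k.+3 (kap i) w) <= 2 ^+ (k - s).
      by rewrite -mem_bx leNgt => hw; apply: (hasPn nbad).
    have := hsq I m y m0 up g gL J kap hJ (kap i) (kap i') k s sk z2' ner (ltW hlt) n0.
    apply/negP; rewrite -ltNge; apply: lt_le_trans (_ : c * 2 ^+ (k * n) <= _).
      by rewrite ltr_pM2r ?exprn_gt0.
    move/hasPn: nsp => /(_ k); rewrite mem_iota add0n => /(_ kb).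
    rewrite /low_cube -leNgt => h; apply: le_trans h _.
    rewrite big_mkcond [leRHS]big_mkcond; apply: ler_sum => j _.
    case: (J j) => //=; case: eqP => [/idx_close ->//|_]; by case: ifP.
  move=> i i' /andP[Pi ai] /andP[Pi' ai'].
  have [->|ne] := eqVneq (kap i) (kap i'); first by rewrite !subrr zn0 enorm0 mulr0.
  have zp : (0 < znorm (kap i - kap i'))%N by rewrite lt0n zn_eq0 subr_eq0.
  have := trunc_log_bounds (isT : (1 < 2)%N) zp; set k := trunc_log _ _ => hk.
  have kb : (k < b.+2)%N.
    rewrite ltnS -(leq_exp2l (m := 2)) //; case/andP: hk => hk _; apply: leq_trans hk _.
    have [/and3P[Ji _ _] /and3P[Ji' _ _]] := (Pi, Pi').
    have := znD (kap i) (- kap i'); rewrite znN; have := hkap _ Ji; have := hkap _ Ji'.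
    by rewrite expnS; clear; lia.
  have hk' := hk; rewrite znB in hk'.
  (* If the scale of the distance is good for one of the two points, [nb] applies. If it is bad for
     both, both carry the colour [rho k], against [lab3_neq]. *)
  have [bi|nbi] := boolP (bd k i); last by rewrite znB enormB; apply: (nb _ _ _ Pi kb hk').
  have [bi'|nbi'] := boolP (bd k i'); last by apply: (nb _ _ _ Pi' kb hk).
  have kin : k \in iota 0 b.+2 by rewrite mem_iota add0n.
  have := allP ai k kin; have := allP ai' k kin; rewrite bi bi' /= => /eqP e' /eqP e.
  by have := lab3_neq n0 hk; rewrite e e'.
- apply: le_trans hrho; rewrite -/Q.
  apply: le_trans (_ : \sum_(i | P i) m i * Q^-1 ^+ N0 <= _).
    by rewrite -mulr_suml mulrAC ler_wpM2r // exprn_ge0 // invr_ge0 ltW.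
  apply: ler_sum => i /and3P[_ _ hc]; rewrite ler_wpM2l //.
  by apply: ler_wiXn2l => //; rewrite ?invr_ge0 ?invf_le1 // ltW.
Qed.

(** * Good-lambda argument *)

Lemma enorm_sqrD_eps (R : realType) d (e : R) (x y : 'rV[R]_d) : 0 < e ->
  enorm (x + y) ^+ 2 <= (1 + e) * enorm x ^+ 2 + (1 + e^-1) * enorm y ^+ 2.
Proof.
move=> e0; have := enormD x y; have := enorm_ge0 (x + y).
have := enorm_ge0 x; have := enorm_ge0 y.
move: (enorm x) (enorm y) (enorm (x + y)) => a b c b0 a0 c0 h.
apply: le_trans (_ : (a + b) ^+ 2 <= _); first by rewrite lerXn2r ?nnegrE // addr_ge0.
have : 0 <= e^-1 * (e * a - b) ^+ 2 by rewrite mulr_ge0 ?sqr_ge0 // invr_ge0 ltW.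
have -> : e^-1 * (e * a - b) ^+ 2 = e * a ^+ 2 - 2 * a * b + e^-1 * b ^+ 2.
  by field; rewrite gt_eqF.
lra.
Qed.

Definition sqfun (R : realType) n d (I : finType) (m : I -> R) (y : I -> 'rV[R]_d) a b x : R :=
  \sum_(a <= k < b) sqfun_block n m y k x.

Section square_function.
Context (R : realType) (n d : nat) (I : finType) (m : I -> R) (y : I -> 'rV[R]_d) (C1 : R).
Hypotheses (m0 : forall i, 0 <= m i) (up : upper_regular n m y C1) (C10 : 0 <= C1).

Lemma sqfun_block_le k x : sqfun_block n m y k x <= C1 ^+ 2 * 4 ^+ n.+1.
Proof.
pose T : R := C1 * 2 ^+ (k.+1 * n) * 2 ^+ k.+1.
have T0 : 0 <= T by rewrite !mulr_ge0 ?exprn_ge0.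
have h t : (2 ^ k <= t < 2 ^ k.+1)%N -> enorm (cvec m y t x) ^+ 2 <= T ^+ 2.
  move=> /andP[_ tk]; rewrite lerXn2r ?nnegrE ?enorm_ge0 //.
  have tk' : t%:R <= 2 ^+ k.+1 :> R by rewrite -natrX ler_nat ltnW.
  apply: le_trans (enorm_sum _ _) _.
  apply: le_trans (_ : \sum_(i | enorm (y i - x) <= 2 ^+ k.+1) m i * 2 ^+ k.+1 <= _).
    rewrite [leRHS]big_mkcond; apply: ler_sum => i _.
    rewrite enormZ ger0_norm // /phi; case: ltP => [lt|_]; last first.
      by rewrite enorm0 mulr0; case: ifP => // _; rewrite mulr_ge0 ?exprn_ge0.
    have le : enorm (y i - x) <= 2 ^+ k.+1 by apply: le_trans (ltW lt) tk'.
    by rewrite le ler_wpM2l.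
  by rewrite -mulr_suml ler_wpM2r ?exprn_ge0.
apply: le_trans (_ : block_weight R n k * (2 ^+ k * T ^+ 2) <= _).
  rewrite ler_wpM2l ?nk_ge0 //.
  apply: le_trans (ler_sum_nat h) _; rewrite sumr_const_nat -[leLHS]mulr_natl.
  by rewrite -natrX ler_wpM2r ?sqr_ge0 // ler_nat expnS; clear; lia.
have e : 2^-1 ^+ (k * n.+1) * (2 ^+ (k * n) * 2 ^+ k) = 1 :> R.
  by rewrite -exprD addnC -mulnS -exprMn mulVf // expr1n.
have e4 : 4 ^+ n.+1 = (2 ^+ n * 2) ^+ 2 :> R.
  have -> : 4 = 2 ^+ 2 :> R by ring.
  by rewrite -exprM mulnC exprM -exprSr.
rewrite le_eqVlt; apply/orP; left; apply/eqP.
have -> : block_weight R n k * (2 ^+ k * T ^+ 2) =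
   C1 ^+ 2 * (2 ^+ n * 2) ^+ 2 * ((block_weight R n k * (2 ^+ (k * n) * 2 ^+ k * 2 ^+ k)) * (2 ^+ (k * n) * 2 ^+ k)).
  by rewrite /T mulSn exprD (exprS 2 k); ring.
by rewrite nkE e mulr1 e4.
Qed.

Lemma sqfun_le a b x : sqfun n m y a b x <= (b - a)%:R * (C1 ^+ 2 * 4 ^+ n.+1).
Proof.
apply: le_trans (_ : \sum_(a <= k < b) C1 ^+ 2 * 4 ^+ n.+1 <= _).
  by apply: ler_sum => k _; apply: sqfun_block_le.
by rewrite sumr_const_nat -[leLHS]mulr_natl.
Qed.

Lemma sqfun_ge0 a b x : 0 <= sqfun n m y a b x.
Proof. by apply: sumr_ge0 => k _; apply: sqfun_block_ge0. Qed.

Lemma sqfun_cat c a b x : (a <= c <= b)%N ->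
  sqfun n m y a b x = sqfun n m y a c x + sqfun n m y c b x.
Proof. by case/andP => ac zcube; rewrite /sqfun (big_cat_nat ac zcube). Qed.

End square_function.

(** The factor [1 + e], bought with a large additive constant, is what [good_lambda] requires: its
    levels grow by [(1 + e) ^ 2], and this must not defeat the decay of the masses. *)
Lemma sqfun_compare (R : realType) n (C1 e : R) : 0 <= C1 -> 0 < e -> exists2 C : R, 0 < C &
  forall (d : nat) (I : finType) (m : I -> R) (y : I -> 'rV[R]_d),
  (forall i, 0 <= m i) -> upper_regular n m y C1 ->
  forall a b x x', enorm (x - x') <= 2 ^+ a ->
  sqfun n m y a b x <= (1 + e) * sqfun n m y a b x' + C.
Proof.
move=> C10 e0; have [C C0 hC] := tail_compare n C10.
have e1 : 0 < 1 + e^-1 by rewrite addr_gt0 ?invr_gt0.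
exists ((1 + e^-1) * C); first by rewrite mulr_gt0.
move=> d I m y m0 up a b x x' xx.
apply: (@le_trans _ _ ((1 + e) * sqfun n m y a b x' + (1 + e^-1) *
  (\sum_(a <= k < b) block_weight R n k * \sum_(2 ^ k <= t < 2 ^ k.+1)
     enorm (cvec m y t x - cvec m y t x') ^+ 2))); last first.
  by rewrite lerD2l (ler_pM2l e1); apply: hC.
rewrite /sqfun !mulr_sumr -big_split /=; apply: ler_sum => k _.
rewrite /sqfun_block !(mulrCA _ (block_weight R n k)) -mulrDr ler_wpM2l ?nk_ge0 //.
rewrite !mulr_sumr -big_split /=; apply: ler_sum => t _.
by have := enorm_sqrD_eps (cvec m y t x') (cvec m y t x - cvec m y t x') e0; rewrite (addrC (cvec _ _ _ x')) subrK.
Qed.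

(** The square function is summed over the piece given by [jones], at the image points by
    [bilip_square] and then at the atoms by [sqfun_compare]; Chebyshev's inequality discards at most
    half of the guaranteed mass. *)
Lemma good_piece (R : realType) n d (M C1 C2 theta : R) :
  (0 < n)%N -> 0 <= M -> 0 <= C1 -> 0 <= C2 -> 0 < theta ->
  exists eta Lam : R, [/\ 0 < eta, 0 < Lam &
  forall (I : finType) (m : I -> R) (y : I -> 'rV[R]_d),
  (forall i, 0 <= m i) -> upper_regular n m y C1 ->
  forall g : 'rV[int]_n -> 'rV[R]_d,
  (forall u v, enorm (g u - g v) <= M * (znorm (u - v))%:R) ->
  forall (J : pred I) (kap : I -> 'rV[int]_n) b,
  (forall i, J i -> (znorm (kap i) <= 2 ^ b)%N) ->
  (forall i, J i -> enorm (y i - g (kap i)) <= C2) ->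
  theta * 2 ^+ (b * n) <= \sum_(i | J i) m i ->
  eta * 2 ^+ (b * n) <= \sum_(i | J i && (sqfun n m y 0 b (y i) <= Lam)) m i].
Proof.
move=> n0 M0 C10 C20 th0.
have [Cb [eta [Cb0 eta0 hj]]] := jones d n0 M0 C10 C20 th0.
have [Cs Cs0 hs] := @bilip_square R n d M C1 Cb n0 M0 C10 Cb0.
have [Ct Ct0 ht] := sqfun_compare n C10 (ltr01 : 0 < 1 :> R).
have [a ha] := pow2_above C2; have [e he] := pow2_above (1 + M + C2).
pose K0 := C1 ^+ 2 * 4 ^+ n.+1.
have K00 : 0 <= K0 by rewrite mulr_ge0 ?exprn_ge0 ?sqr_ge0.
pose Cm := C1 * 2 ^+ (a * n); have Cm0 : 0 <= Cm by rewrite mulr_ge0 ?exprn_ge0.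
pose D := C1 * 2 ^+ (e * n); have D0 : 0 <= D by rewrite mulr_ge0 ?exprn_ge0.
pose C3 := (a%:R * K0 + Ct) * D + 2 * (Cm * (Cs * (1 + D))) + 1.
have C30 : 0 < C3 by rewrite ltr_pwDr // !(mulr_ge0, addr_ge0) // ltW.
exists (eta / 2), (2 * C3 / eta); split; rewrite ?divr_gt0 ?mulr_gt0 //.
move=> I m y m0 up g gL J kap b hkap hJ hth.
have [J' [J'J bil mass]] := hj I m y m0 up g gL J kap b hkap hJ hth.
pose near i := enorm (y i - g 0) <= 2 ^+ (b + e).
(* Since [bilip_square] charges the total mass, only the atoms near [g 0] are kept; the others are
   invisible from the image points when [t < 2 ^ b]. *)
pose m' i := if near i then m i else 0.
have m'0 i : 0 <= m' i by rewrite /m'; case: ifP.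
have b1 : 1 <= 2 ^+ b :> R by rewrite exprn_ege1 // ler1n.
have massD : \sum_i m' i <= D * 2 ^+ (b * n).
  by rewrite -big_mkcond /D -mulrA -exprD -mulnDl addnC; apply: up.
have up' : upper_regular n m' y C1.
  move=> x k; apply: le_trans (up x k); apply: ler_sum => i _.
  by rewrite /m'; case: ifP.
pose K := undup (map kap (enum J')).
have KP u : u \in K -> exists2 i, J' i & u = kap i.
  by rewrite mem_undup => /mapP[i]; rewrite mem_enum => Ji ->; exists i.
have Ksub : {subset K <= zbox n (2 ^ b)}.
  by move=> u /KP[i /J'J Ji ->]; rewrite mem_bx hkap.
have sum1 : \sum_(u <- K) sqfun n m y 0 b (g u) <= Cs * (1 + D) * 2 ^+ (b * n).
  apply: le_trans (_ : \sum_(u <- K) \sum_(k < b) sqfun_block n m' y k (g u) <= _); last first.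
    apply: le_trans (hs I m' y m'0 up' g gL b K (undup_uniq _) Ksub _) _.
      by move=> u v /KP[i Ji ->] /KP[j Jj ->]; apply: bil.
    rewrite -mulrA (mulrDl 1) mul1r; apply: ler_wpM2l; first exact: ltW.
    by rewrite lerD2l.
  apply: ler_sum_seq_in => u uK; rewrite /sqfun big_mkord; apply: ler_sum => k _.
  rewrite le_eqVlt; apply/orP; left; apply/eqP; congr (_ * _); apply: eq_big_nat => t /andP[_ tk].
  congr (_ ^+ 2); congr enorm; apply: eq_bigr => i _; rewrite /m'; case: (boolP (near i)) => // h.
  rewrite /phi ifF ?scaler0 //; apply/negP => lt; move/negP: h; apply.
  have [i' J'i' ue] := KP u uK; have zu := hkap _ (J'J _ J'i'); rewrite -ue in zu.
  apply: le_trans (enorm_triangle (g u) _ _) _; rewrite exprD.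
  have t1 : t%:R <= 2 ^+ b :> R.
    by rewrite -natrX ler_nat; apply: leq_trans (ltnW tk) _; rewrite leq_pexp2l.
  have := gL u 0; rewrite subr0 => g1.
  have : M * (znorm u)%:R <= M * 2 ^+ b by rewrite ler_wpM2l // -natrX ler_nat.
  have := ler_wpM2r (exprn_ge0 b (ler0n R 2)) he; have := ler_wpM2l C20 b1.
  move: C20 lt t1 g1; clear; lra.
(* Below scale [a] an atom and its image point are not comparable, and each of those scales is
   bounded trivially by [K0]. *)
have sqc i : J' i -> sqfun n m y 0 b (y i) <= a%:R * K0 + Ct + 2 * sqfun n m y 0 b (g (kap i)).
  move=> J'i; have close : enorm (y i - g (kap i)) <= 2 ^+ a by apply: le_trans (hJ _ (J'J _ J'i)) ha.
  have q0 a' b' x := @sqfun_ge0 R n d I m y a' b' x.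
  have [ba|ab] := leqP b a.
    apply: le_trans (sqfun_le m0 up C10 0 b _) _; rewrite subn0.
    apply: le_trans (_ : a%:R * K0 <= _); first by rewrite ler_wpM2r // ler_nat.
    by rewrite -addrA lerDl addr_ge0 ?mulr_ge0 // ltW.
  have hab : (0 <= a <= b)%N by rewrite leq0n (ltnW ab).
  rewrite !(sqfun_cat n m y _ hab).
  have := ht d I m y m0 up a b _ _ close; have := sqfun_le m0 up C10 0 a (y i).
  have := q0 0%N a (g (kap i)); rewrite subn0 -/K0; clear; lra.
have sum2 : \sum_(i | J' i) m i * sqfun n m y 0 b (y i) <= C3 * 2 ^+ (b * n).
  apply: le_trans (_ : \sum_(i | J' i) m i * (a%:R * K0 + Ct + 2 * sqfun n m y 0 b (g (kap i))) <= _).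
    by apply: ler_sum => i J'i; rewrite ler_wpM2l // sqc.
  under eq_bigr do rewrite mulrDr; rewrite big_split /= -mulr_suml.
  have s1 : \sum_(i | J' i) m i <= D * 2 ^+ (b * n).
    apply: le_trans massD; rewrite big_mkcond; apply: ler_sum => i _.
    case: (boolP (J' i)) => // J'i; rewrite /m' ifT //.
    have Ji := J'J _ J'i; have zu := hkap _ Ji.
    rewrite /near; apply: le_trans (enorm_triangle (g (kap i)) _ _) _; rewrite exprD.
    have := gL (kap i) 0; rewrite subr0 => g1.
    have : M * (znorm (kap i))%:R <= M * 2 ^+ b by rewrite ler_wpM2l // -natrX ler_nat.
    have := ler_wpM2r (exprn_ge0 b (ler0n R 2)) he; have := ler_wpM2l C20 b1.
    have := hJ _ Ji; move: C20 b1 g1; clear; lra.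
  have s2 : \sum_(i | J' i) m i * sqfun n m y 0 b (g (kap i)) <= Cm * (Cs * (1 + D) * 2 ^+ (b * n)).
    have w0 i : 0 <= m i * sqfun n m y 0 b (g (kap i)) by rewrite mulr_ge0 // sqfun_ge0.
    apply: le_trans (sum_fibre_le (s := K) (f := kap) w0 _) _.
      by move=> i J'i; rewrite mem_undup map_f // mem_enum.
    apply: le_trans (ler_wpM2l Cm0 sum1); rewrite mulr_sumr; apply: ler_sum => u _.
    rewrite (eq_bigr (fun i => m i * sqfun n m y 0 b (g u))); last by move=> i /andP[_ /eqP ->].
    rewrite -mulr_suml ler_wpM2r ?sqfun_ge0 //.
    apply: le_trans (up (g u) a); rewrite big_mkcond [leRHS]big_mkcond; apply: ler_sum => i _.
    case: (boolP (J' i)) => [J'i|_] /=; last by case: ifP.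
    case: eqP => [<-|_]; last by case: ifP.
    by rewrite ifT // (le_trans (hJ _ (J'J _ J'i)) ha).
  have X0 : 0 <= a%:R * K0 + Ct by rewrite addr_ge0 ?mulr_ge0 // ltW.
  under [X in _ + X <= _]eq_bigr do rewrite mulrCA.
  rewrite -mulr_sumr; have := ler_wpM2l X0 s1.
  have p : 0 <= 2 ^+ (b * n) :> R by rewrite exprn_ge0.
  move: s2 p; rewrite /C3; clear; lra.
pose Lam := 2 * C3 / eta; have Lam0 : 0 < Lam by rewrite divr_gt0 ?mulr_gt0.
have bad3 : \sum_(i | J' i && ~~ (sqfun n m y 0 b (y i) <= Lam)) m i <= eta / 2 * 2 ^+ (b * n).
  rewrite -(ler_pM2r Lam0) mulr_suml.
  apply: le_trans (_ : C3 * 2 ^+ (b * n) <= _); last first.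
    by rewrite le_eqVlt; apply/orP; left; apply/eqP; rewrite /Lam; field; rewrite gt_eqF.
  apply: le_trans sum2; rewrite big_mkcondr /=; apply: ler_sum => i _.
  case: ifP => [h|_]; last by rewrite mulr_ge0 // sqfun_ge0.
  by rewrite ler_wpM2l // ltW // ltNge.
have : \sum_(i | J' i) m i <= \sum_(i | J i && (sqfun n m y 0 b (y i) <= Lam)) m i +
    \sum_(i | J' i && ~~ (sqfun n m y 0 b (y i) <= Lam)) m i.
  rewrite [X in X <= _]big_mkcond [X in _ <= X + _]big_mkcond [X in _ <= _ + X]big_mkcond -big_split /=.
  apply: ler_sum => i _; case: (boolP (J' i)) => [/J'J ->|_] /=; last by rewrite addr0; case: ifP.
  by case: ifP; rewrite ?addr0 ?add0r.
move: mass bad3; rewrite -/Lam; clear; lra.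
Qed.

(* A finite Vitali selection, by induction on the family: remove the ball of largest
   radius together with all the balls meeting it. *)
Lemma vitali_mass (R : realType) n d (I : finType) (m : I -> R) (y : I -> 'rV[R]_d) (C1 eta : R)
    (s : I -> nat) (T : pred I) (E : {set I}) :
  (forall i, 0 <= m i) -> upper_regular n m y C1 -> 0 <= C1 -> 0 <= eta ->
  (forall j, j \in E -> eta * 2 ^+ (s j * n) <=
     \sum_(l | T l && (enorm (y l - y j) <= 2 ^+ s j)) m l) ->
  eta * \sum_(i in E) m i <= C1 * 2 ^+ n *
    \sum_(l | T l && [exists j in E, enorm (y l - y j) <= 2 ^+ s j]) m l.
Proof.
move=> m0 up C10 eta0; have [N] := ubnP #|E|; elim: N E => // N IH E.
have [->|] := eqVneq E finset.set0.
  by move=> _ _; rewrite big_set0 mulr0 !mulr_ge0 ?exprn_ge0 // sumr_ge0.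
case/finset.set0Pn => i0 i0E EN hE.
have [i iE imax] : exists2 i, i \in E & forall j, j \in E -> (s j <= s i)%N.
  by case: (arg_maxnP s i0E) => i iE h; exists i.
pose far j := 2 ^+ s i + 2 ^+ s j < enorm (y j - y i).
pose E' := finset (fun j => (j \in E) && far j).
have E'E : E' \subset E by apply/fintype.subsetP => j; rewrite inE => /andP[].
have iE' : i \notin E'.
  rewrite inE iE /= /far subrr enorm0 -leNgt addr_ge0 ?exprn_ge0 //.
have cardE' : (#|E'| < N)%N.
  apply: leq_trans (_ : #|E'| < #|E|)%N _; last by rewrite -ltnS.
  by apply: proper_card; apply/properP; split => //; exists i.
have {}IH := IH E' cardE' (fun j jE' => hE j (fintype.subsetP E'E _ jE')).
(* Centres removed with the largest ball lie within twice its radius, whence the factor [2 ^ n]. *)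
have split_E : \sum_(j in E) m j <= \sum_(j in E') m j + C1 * 2 ^+ n * 2 ^+ (s i * n).
  apply: le_trans (_ : _ <= \sum_(j in E') m j + \sum_(j | enorm (y j - y i) <= 2 ^+ (s i).+1) m j) _.
    rewrite big_mkcond [X in _ <= X + _]big_mkcond [X in _ <= _ + X]big_mkcond -big_split /=.
    apply: ler_sum => j _; rewrite inE; case: (boolP (j \in E)) => jE /=; last first.
      by rewrite add0r; case: ifP.
    case: (boolP (far j)) => [_|]; first by rewrite lerDl; case: ifP.
    rewrite /far -leNgt => h; rewrite add0r ifT // (le_trans h) // exprS.
    have : 2 ^+ s j <= 2 ^+ s i :> R by rewrite ler_eXn2l ?ltr1n // imax.
    clear; lra.
  by rewrite lerD2l; apply: le_trans (up _ _) _; rewrite mulSn exprD mulrA.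
have hi := hE i iE.
apply: le_trans (ler_wpM2l eta0 split_E) _; rewrite mulrDr.
have K0 : 0 <= C1 * 2 ^+ n by rewrite mulr_ge0 ?exprn_ge0.
have h2 := ler_wpM2l K0 hi.
have h3 : \sum_(l | T l && [exists j in E', enorm (y l - y j) <= 2 ^+ s j]) m l +
    \sum_(l | T l && (enorm (y l - y i) <= 2 ^+ s i)) m l <=
    \sum_(l | T l && [exists j in E, enorm (y l - y j) <= 2 ^+ s j]) m l.
  rewrite [X in X + _ <= _]big_mkcond [X in _ + X <= _]big_mkcond [X in _ <= X]big_mkcond -big_split /=.
  apply: ler_sum => l _; case: (T l) => /=; last by rewrite addr0.
  case: (boolP [exists j in E', _]) => [/exists_inP[j jE' hj]|_].
    have jE := fintype.subsetP E'E _ jE'.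
    rewrite [X in _ <= X]ifT; last by apply/exists_inP; exists j.
    rewrite ifF ?addr0 //; apply/negP => hl.
    move: jE'; rewrite inE /far => /andP[_]; apply/negP; rewrite -leNgt.
    by apply: le_trans (enorm_triangle (y l) _ _) _; rewrite (enormB (y j)) addrC lerD.
  rewrite add0r; case: ifP => hl; last by case: ifP.
  by rewrite ifT //; apply/exists_inP; exists i.
have := ler_wpM2l K0 h3; move: IH h2; clear.
move: (C1 * 2 ^+ n) => K; rewrite mulrDr mulrCA; lra.
Qed.

(** Along the levels [ell k.+1 = lam * ell k + A] the gaps are [lam ^ k * A], while the mass above
    [ell k] is at most [r ^ k] times the mass above 0. The layer-cake sum is geometric of ratio
    [r * lam]. *)
Lemma layer_sum (R : realType) (I : finType) (m S : I -> R) (lam A r : R) :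
  (forall i, 0 <= m i) -> 1 <= lam -> 0 < A -> 0 <= r -> r * lam < 1 ->
  (forall l, 0 <= l -> \sum_(i | lam * l + A < S i) m i <= r * \sum_(i | l < S i) m i) ->
  \sum_(i | 0 < S i) m i * S i <= A / (1 - r * lam) * \sum_(i | 0 < S i) m i.
Proof.
move=> m0 lam1 A0 r0 rl dec.
pose ell k := iter k (fun l => lam * l + A) 0.
have ellS k : ell k.+1 - ell k = lam ^+ k * A.
  elim: k => [|k IH]; first by rewrite /ell /= mulr0 add0r subr0 expr0 mul1r.
  have -> : ell k.+2 - ell k.+1 = lam * (ell k.+1 - ell k) by rewrite /ell /=; ring.
  by rewrite IH exprS mulrA.
have ell_ge k : k%:R * A <= ell k.
  elim: k => [|k IH]; first by rewrite mul0r.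
  have := ellS k; have : 1 <= lam ^+ k by rewrite exprn_ege1.
  move=> h1 h2; have := ler_wpM2r (ltW A0) h1; move: IH h2; rewrite -natr1 mulrDl; clear; lra.
have ell0 k : 0 <= ell k by apply: le_trans (ell_ge k); rewrite mulr_ge0 // ltW.
pose mu k := \sum_(i | ell k < S i) m i.
have muS k : mu k <= r ^+ k * mu 0%N.
  elim: k => [|k IH]; first by rewrite expr0 mul1r.
  by apply: le_trans (dec _ (ell0 k)) _; rewrite exprS -mulrA ler_wpM2l.
have [K hK] : exists K, forall i, S i <= ell K.
  pose K := Num.truncn (\sum_i `|S i| / A); exists K.+1 => i.
  apply: le_trans (ell_ge _); rewrite -ler_pdivrMr //; apply: le_trans (ltW (truncnS_gt _)).
  rewrite (bigD1 i) //=; apply: le_trans (_ : `|S i| / A <= _).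
    by rewrite ler_wpM2r ?invr_ge0 ?(ltW A0) // ler_norm.
  by rewrite lerDl sumr_ge0 // => j _; rewrite divr_ge0 // ltW.
have Sle i : S i <= \sum_(k < K) (lam ^+ k * A) * (ell k < S i)%R%:R.
  suff h j : (S i <= ell j) -> S i <= \sum_(k < j) (lam ^+ k * A) * (ell k < S i)%R%:R by apply: h.
  elim: j => [|j IHj] hj; first by rewrite big_ord0.
  rewrite big_ord_recr /=; case: (ltP (ell j) (S i)) => h; last by rewrite mulr0 addr0; apply: IHj.
  apply: le_trans hj _.
  have -> : \sum_(k < j) lam ^+ k * A * (ell k < S i)%R%:R = ell j.
    have mono k : (k <= j)%N -> ell k <= ell j.
      move=> kj; rewrite -(subnK kj); elim: (j - k)%N => [|q IHq] //.
      apply: le_trans IHq _; rewrite addSn -subr_ge0 ellS mulr_ge0 ?(ltW A0) // exprn_ge0 //.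
      exact: le_trans lam1.
    rewrite (eq_bigr (fun k : 'I_j => ell k.+1 - ell k)); last first.
      by move=> k _; rewrite ellS (le_lt_trans (mono k (ltnW (ltn_ord k))) h) mulr1.
    rewrite -(big_mkord xpredT (fun k => ell k.+1 - ell k)).
    by rewrite telescope_sumr // /ell /= subr0.
  by rewrite mulr1 -ellS addrC subrK.
apply: le_trans (_ : \sum_(i | 0 < S i) m i * \sum_(k < K) (lam ^+ k * A) * (ell k < S i)%R%:R <= _).
  by apply: ler_sum => i _; rewrite ler_wpM2l.
under eq_bigr do rewrite mulr_sumr.
rewrite exchange_big /=.
apply: le_trans (_ : \sum_(k < K) (A * mu 0%N) * (r * lam) ^+ k <= _).
  apply: ler_sum => k _.
  have p : 0 <= lam ^+ k * A.
    by apply: mulr_ge0; [apply/exprn_ge0/(le_trans ler01)|apply: ltW].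
  apply: le_trans (_ : lam ^+ k * A * mu k <= _).
    rewrite /mu mulr_sumr big_mkcond [leRHS]big_mkcond; apply: ler_sum => i _.
    case: ifP => _; case: ifP => h; rewrite ?mulr1 ?mulr0 //; first by rewrite mulrC.
    by apply: mulr_ge0.
  by apply: le_trans (ler_wpM2l p (muS k)) _; rewrite exprMn le_eqVlt; apply/orP; left; apply/eqP; ring.
have mu00 : 0 <= mu 0%N by apply: sumr_ge0.
rewrite -mulr_sumr (_ : \sum_(i | 0 < S i) m i = mu 0%N) // [leRHS]mulrAC.
apply: ler_wpM2l; first by apply: mulr_ge0 mu00; apply: ltW.
have d0 : 0 < 1 - r * lam by rewrite subr_gt0.
rewrite -(ler_pM2r d0) mulVf ?gt_eqF //.
have rl0 : 0 <= r * lam by rewrite mulr_ge0 // (le_trans ler01).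
have : \sum_(k < K) (r * lam) ^+ k * (1 - r * lam) = 1 - (r * lam) ^+ K.
  move: (r * lam) => q; elim: (K) => [|j IHj]; first by rewrite big_ord0 expr0 subrr.
  by rewrite big_ord_recr /= IHj exprS; ring.
rewrite -mulr_suml => ->; have := exprn_ge0 K rl0; lra.
Qed.

(** The default exponent 0 makes a square function truncated at [b] empty, so points outside the
    region contribute nothing. *)
Lemma dyadic_exponent (R : realType) (x : R) : exists b : nat,
  ((0 < b)%N -> 2 ^+ b <= x < 2 ^+ b.+1) /\ forall j, 2 ^+ j <= x -> (j <= b)%N.
Proof.
have [x1|x1] := ltP x 1.
  exists 0%N; split => // j hj; exfalso; have : 1 <= 2 ^+ j :> R by rewrite exprn_ege1 // ler1n.
  lra.
have x0 : 0 <= x by lra.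
have /andP[t1 t2] := truncn_itv x0; set t := Num.truncn x in t1 t2.
have t0 : (0 < t)%N.
  by rewrite lt0n; apply/eqP => e; move: t2; rewrite e; lra.
have /andP[b1 b2] := trunc_log_bounds (isT : (1 < 2)%N) t0.
exists (trunc_log 2 t); split => [_|j hj].
  apply/andP; split; first by apply: le_trans t1; rewrite -natrX ler_nat.
  by apply: lt_le_trans t2 _; rewrite -natrX ler_nat.
apply: trunc_log_max => //; rewrite -ltnS -(ltr_nat R) natrX.
exact: le_lt_trans t2.
Qed.

Lemma stopping_scale (R : realType) (F : nat -> R) (b : nat) (L : R) : 0 <= L -> F b = 0 ->
  L < F 0%N -> exists s, [/\ (s < b)%N, L < F s & F s.+1 <= L].
Proof.
elim: b F => [|b IH] F L0 Fb F0; first by move: F0; rewrite Fb ltNge L0.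
have [h|h] := leP (F 1%N) L; first by exists 0%N.
have [s [h1 h2 h3]] := IH (fun k => F k.+1) L0 Fb h.
by exists s.+1.
Qed.

(* Comparing the square function at scales above the stopping scale of [y i] between
   nearby points, a fixed proportion of the stopping ball lies between two levels, so the
   distribution function of the square function decays geometrically.  The square
   functions are truncated at scales comparable to the distance to the boundary. *)
Lemma good_lambda (R : realType) n (C1 eta Lam : R) : 0 < C1 -> 0 < eta -> 0 <= Lam ->
  exists2 C : R, 0 < C & forall d (I : finType) (m : I -> R) (y : I -> 'rV[R]_d),
  (forall i, 0 <= m i) -> upper_regular n m y C1 -> forall x0 B,
  (forall i b, enorm (y i - x0) <= 2 ^+ B.+1 -> (b <= B.+1)%N -> eta * 2 ^+ (b * n) <=
     \sum_(l | (enorm (y l - y i) <= 2 ^+ b) && (sqfun n m y 0 b (y l) <= Lam)) m l) ->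
  \sum_(i | enorm (y i - x0) <= 2 ^+ B) m i * sqfun n m y 0 B (y i) <= C * 2 ^+ (B * n).
Proof.
move=> C10 eta0 Lam0.
(* The proportion of the mass of the stopping set found between the two levels, from [vitali_mass].
   As [c <= 1], the choice [e = c / 8] gives [(1 + e) ^ 2 < 1 + c]. *)
pose c := Order.min 1 (eta / (C1 * 2 ^+ n)).
have K1 : 0 < C1 * 2 ^+ n by rewrite mulr_gt0 ?exprn_gt0.
have c0 : 0 < c by rewrite lt_min ltr01 divr_gt0.
have c1 : c <= 1 by rewrite ge_min lexx.
have c2 : c * (C1 * 2 ^+ n) <= eta by rewrite -ler_pdivlMr // ge_min lexx orbT.
pose e := c / 8; have e0 : 0 < e by rewrite divr_gt0.
pose K0 := C1 ^+ 2 * 4 ^+ n.+1.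
have K00 : 0 <= K0 by apply: mulr_ge0; [apply: sqr_ge0|apply: exprn_ge0].
have [Kd Kd0 hKd] := sqfun_compare n (ltW C10) e0.
pose lam := (1 + e) ^+ 2; pose r := (1 + c)^-1.
pose A := Lam + (1 + e) * ((1 + e) * K0 + Kd + K0) + Kd + K0.
have lam1 : 1 <= lam by rewrite exprn_ege1 // lerDl ltW.
have A0 : 0 < A.
  have : 0 <= (1 + e) * ((1 + e) * K0 + Kd + K0).
    have e1 : 0 <= 1 + e by rewrite addr_ge0 ?(ltW e0).
    by rewrite !(mulr_ge0, addr_ge0) // ltW.
  rewrite /A; move: Lam0 K00 Kd0; clear; lra.
have c1p : 0 < 1 + c by rewrite addr_gt0.
have r0 : 0 <= r by rewrite invr_ge0 ltW.
have rl : r * lam < 1.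
  rewrite mulrC ltr_pdivrMr // mul1r /lam /e; move: c0 c1; clear; nra.
exists (A / (1 - r * lam) * (C1 * 2 ^+ n)); first by rewrite mulr_gt0 ?divr_gt0 ?subr_gt0.
move=> d I m y m0 up x0 B good.
(* Each point is truncated at a scale comparable to its distance to the complement of the doubled
   ball. Neighbours within the stopping radius then have truncation scales differing by at most one,
   which costs a single block [K0]. *)
pose dist i := 2 ^+ B.+1 - enorm (y i - x0).
have [bb hbb] := choice (fun i => dyadic_exponent (dist i)).
pose S i := sqfun n m y 0 (bb i) (y i).
have q0 a b x := @sqfun_ge0 R n d I m y a b x.
have one k x : sqfun n m y k k.+1 x <= K0.
  by have := sqfun_le m0 up (ltW C10) k k.+1 x; rewrite subSnn mul1r.
have nbr i l s : (s < bb i)%N -> enorm (y l - y i) <= 2 ^+ s ->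
    ((bb i).-1 <= bb l <= (bb i).+1)%N.
  move=> sb hl; have b0 : (0 < bb i)%N by apply: leq_ltn_trans sb.
  have [/(_ b0)/andP[h1 h2] _] := hbb i; have [hb1 hb2] := hbb l.
  have s2 : 2 ^+ s <= 2 ^+ (bb i).-1 :> R by rewrite ler_eXn2l ?ltr1n // -ltnS prednK.
  have bE : 2 ^+ bb i = 2 * 2 ^+ (bb i).-1 :> R by rewrite -exprS prednK.
  have t1 := enorm_triangle (y i) (y l) x0; have t2 := enorm_triangle (y l) (y i) x0.
  rewrite (enormB (y i) (y l)) in t2.
  apply/andP; split.
    apply: hb2; move: h1 t1 hl s2; rewrite bE /dist; clear; lra.
  rewrite leqNgt; apply/negP => lt; have l0 : (0 < bb l)%N by apply: leq_ltn_trans lt.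
  have /andP[g1 _] := hb1 l0.
  have : 2 ^+ (bb i).+2 <= 2 ^+ bb l :> R by rewrite ler_eXn2l ?ltr1n.
  have p : 0 < 2 ^+ (bb i).-1 :> R by rewrite exprn_gt0.
  move: g1 h2 t2 hl s2 p; rewrite !exprS bE /dist.
  by clear; lra.
have inside i : (0 < bb i)%N -> enorm (y i - x0) <= 2 ^+ B.+1 /\ (bb i <= B.+1)%N.
  move=> b0; have [/(_ b0)/andP[h1 h2] _] := hbb i.
  have p : 0 < 2 ^+ bb i :> R by rewrite exprn_gt0.
  have g := enorm_ge0 (y i - x0); split; first by move: p h1; rewrite /dist; clear; lra.
  by rewrite -(ler_eXn2l (x := 2 : R)) ?ltr1n //; move: g h1; rewrite /dist; clear; lra.
have dec l : 0 <= l -> \sum_(i | lam * l + A < S i) m i <= r * \sum_(i | l < S i) m i.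
  (* A tail above [L] at the stopping point forces a tail above [l + K0] at its neighbours.
     Conversely, [L'] bounds the neighbours whose scales below the stopping scale contribute at most
     [Lam]. *)
  move=> l0; pose L := (1 + e) * (l + K0) + Kd.
  pose L' := Lam + (1 + e) * (L + K0) + Kd + K0.
  have LA : lam * l + A = L' by rewrite /lam /A /L' /L; ring.
  have Ll : l <= L.
    have : 0 <= e * (l + K0) by rewrite mulr_ge0 ?addr_ge0 // ltW.
    rewrite /L mulrDl mul1r; move: K00 Kd0; clear; lra.
  have L0 : 0 <= L by apply: le_trans Ll.
  have LL : L <= L'.
    have : 0 <= e * (L + K0) by apply: mulr_ge0; [exact: ltW|apply: addr_ge0].
    rewrite /L' mulrDl mul1r; move: K00 Kd0 Lam0; clear; lra.
  have ex i : exists s : nat, L < S i ->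
     [/\ (s < bb i)%N, L < sqfun n m y s (bb i) (y i) & sqfun n m y s.+1 (bb i) (y i) <= L].
    have [h|h] := ltP L (S i); last by exists 0%N.
    have [s hs] := @stopping_scale R (fun a => sqfun n m y a (bb i) (y i)) (bb i) L L0 (big_geq (leqnn _)) h.
    by exists s.
  have [s hs] := choice ex.
  pose E := finset (fun i => L < S i).
  pose T i := (l < S i) && (S i <= L').
  have hE j : j \in E -> eta * 2 ^+ (s j * n) <=
     \sum_(i | T i && (enorm (y i - y j) <= 2 ^+ s j)) m i.
    rewrite inE => hj; have [sb h1 h2] := hs j hj.
    have b0 : (0 < bb j)%N by apply: leq_ltn_trans sb.
    have [i1 i2] := inside j b0.
    apply: le_trans (good j (s j) i1 _) _; first by apply: leq_trans (ltnW sb) i2.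
    rewrite big_mkcond [leRHS]big_mkcond; apply: ler_sum => i _.
    case: ifP => [/andP[hi gi]|_]; last by case: ifP.
    rewrite hi andbT ifT //.
    have /andP[n1 n2] := nbr j i _ sb hi.
    have sbi : (s j <= bb i)%N by apply: leq_trans n1; rewrite -ltnS prednK.
    have hij : enorm (y j - y i) <= 2 ^+ s j by rewrite enormB.
    have cmp1 := hKd d I m y m0 up (s j) (bb j) _ _ hi.
    have cmp2 := hKd d I m y m0 up (s j) (bb j) _ _ hij.
    have top : sqfun n m y (s j) (bb j) (y j) <= L + K0.
      have hh : (s j <= (s j).+1 <= bb j)%N by rewrite leqnSn.
      rewrite (sqfun_cat n m y _ hh); have := one (s j) (y j); move: h2; clear; lra.
    have lowi : sqfun n m y (s j) (bb j) (y i) <= sqfun n m y (s j) (bb i) (y i) + K0.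
      have [le|lt] := leqP (bb j) (bb i).
        have hh : (s j <= bb j <= bb i)%N by rewrite (ltnW sb).
        rewrite [in leRHS](sqfun_cat n m y _ hh); have := q0 (bb j) (bb i) (y i); move: K00; clear; lra.
      have bE : bb j = (bb i).+1 by move: n1 lt b0; clear; lia.
      have hh : (s j <= bb i <= bb j)%N by rewrite sbi ltnW.
      by rewrite [in leLHS](sqfun_cat n m y _ hh) lerD2l bE.
    have upi : sqfun n m y (s j) (bb i) (y i) <= sqfun n m y (s j) (bb j) (y i) + K0.
      have [le|lt] := leqP (bb i) (bb j).
        have hh : (s j <= bb i <= bb j)%N by rewrite sbi.
        rewrite [in leRHS](sqfun_cat n m y _ hh); have := q0 (bb i) (bb j) (y i); move: K00; clear; lra.
      have bE : bb i = (bb j).+1 by move: n2 lt b0; clear; lia.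
      have hh : (s j <= bb j <= bb i)%N by rewrite (ltnW sb) ltnW.
      by rewrite [in leLHS](sqfun_cat n m y _ hh) lerD2l bE.
    have SE : S i = sqfun n m y 0 (s j) (y i) + sqfun n m y (s j) (bb i) (y i).
      by apply: sqfun_cat; rewrite leq0n.
    have e1 : 0 < 1 + e by rewrite addr_gt0.
    apply/andP; split.
      have : (1 + e) * (l + K0) < (1 + e) * sqfun n m y (s j) (bb j) (y i).
        by move: h1 cmp2; rewrite {1}/L; clear; lra.
      rewrite ltr_pM2l // => hlt; rewrite SE; have := q0 0%N (s j) (y i).
      move: hlt lowi; clear; lra.
    have := ler_wpM2l (ltW e1) top; rewrite SE /L'; move: gi upi cmp1; clear; lra.
  have V := vitali_mass m0 up (ltW C10) (ltW eta0) hE.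
  rewrite LA /r mulrC ler_pdivlMr //.
  have s1 : \sum_(i | L' < S i) m i <= \sum_(i in E) m i.
    rewrite big_mkcond [leRHS]big_mkcond; apply: ler_sum => i _; rewrite inE.
    by case: ltP => h; [rewrite (le_lt_trans LL h)|case: ifP].
  have s2 : \sum_(i | T i && [exists j in E, enorm (y i - y j) <= 2 ^+ s j]) m i +
      \sum_(i | L' < S i) m i <= \sum_(i | l < S i) m i.
    rewrite [X in X + _ <= _]big_mkcond [X in _ + X <= _]big_mkcond [X in _ <= X]big_mkcond -big_split /=.
    apply: ler_sum => i _; rewrite /T; case: (leP (S i) L') => h.
      by rewrite andbT addr0; case: (l < S i) => //=; case: ifP.
    by rewrite andbF add0r (le_lt_trans (le_trans Ll LL) h).
  have s3 : 0 <= \sum_(i in E) m i by apply: sumr_ge0.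
  have s4 := ler_wpM2r s3 c2.
  have s5 : c * \sum_(i in E) m i <=
      \sum_(l0 | T l0 && [exists j in E, enorm (y l0 - y j) <= 2 ^+ s j]) m l0.
    rewrite -(ler_pM2l K1); apply: le_trans V; apply: le_trans s4.
    by rewrite mulrA (mulrC (C1 * _) c).
  have := ler_wpM2l (ltW c0) s1; move: s2 s5; clear; lra.
have main := layer_sum m0 lam1 A0 r0 rl dec.
have S0 i : 0 <= S i by apply: q0.
apply: le_trans (_ : \sum_(i | 0 < S i) m i * S i <= _).
  rewrite big_mkcond [leRHS]big_mkcond; apply: ler_sum => i _.
  case: ifP => [hi|_]; last by case: ifP => // _; rewrite mulr_ge0.
  have bB : (B <= bb i)%N.
    apply: (hbb i).2; rewrite /dist exprS; move: hi; clear; lra.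
  apply: le_trans (_ : m i * S i <= _).
    have hh : (0 <= B <= bb i)%N by rewrite leq0n.
    by rewrite ler_wpM2l // /S (sqfun_cat n m y _ hh) lerDl.
  by case: ltP => // h; rewrite mulr_ge0_le0.
apply: le_trans main _.
rewrite -[leRHS]mulrA; apply: ler_wpM2l; first by rewrite divr_ge0 ?(ltW A0) // subr_ge0 ltW.
rewrite -mulrA -exprD -mulSn; apply: le_trans (up x0 B.+1).
rewrite big_mkcond [leRHS]big_mkcond; apply: ler_sum => i _.
case: ifP => [hi|_]; last by case: ifP.
rewrite ifT //; apply: (inside i _).1; rewrite lt0n; apply/eqP => b0.
by move: hi; rewrite /S /sqfun b0 big_geq ?ltxx.
Qed.

Lemma discrete_square_bound (R : realType) n d (M C1 C2 theta : R) :
  (0 < n)%N -> 0 <= M -> 0 < C1 -> 0 <= C2 -> 0 < theta -> exists2 C : R, 0 < C &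
  forall (I : finType) (m : I -> R) (y : I -> 'rV[R]_d),
  (forall i, 0 <= m i) -> upper_regular n m y C1 -> forall x0 B,
  (forall i b, enorm (y i - x0) <= 2 ^+ B.+1 -> (b <= B.+1)%N ->
    exists2 g : 'rV[int]_n -> 'rV[R]_d,
      (forall u v, enorm (g u - g v) <= M * (znorm (u - v))%:R) &
    exists (J : pred I) (kap : I -> 'rV[int]_n), [/\
      forall l, J l -> (znorm (kap l) <= 2 ^ b)%N,
      forall l, J l -> enorm (y l - g (kap l)) <= C2,
      forall l, J l -> enorm (y l - y i) <= 2 ^+ b &
      theta * 2 ^+ (b * n) <= \sum_(l | J l) m l]) ->
  \sum_(i | enorm (y i - x0) <= 2 ^+ B) m i * sqfun n m y 0 B (y i) <= C * 2 ^+ (B * n).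
Proof.
move=> n0 M0 C10 C20 th0.
have [eta [Lam [eta0 Lam0 hg]]] := good_piece d n0 M0 (ltW C10) C20 th0.
have [C C0 hC] := @good_lambda R n C1 eta Lam C10 eta0 (ltW Lam0).
exists C => // I m y m0 up x0 B hUR; apply: (hC d I m y m0 up) => i b hi hb.
have [g gL [J [kap [h1 h2 h3 h4]]]] := hUR i b hi hb.
apply: le_trans (hg I m y m0 up g gL J kap b h1 h2 h4) _.
rewrite big_mkcond [leRHS]big_mkcond; apply: ler_sum => l _.
case: (boolP (J l)) => [Jl|_] /=; last by case: ifP.
by rewrite h3.
Qed.

(** * From the discrete estimate to the measure *)

Section fatou_bounds.
Local Open Scope ereal_scope.

Lemma limn_einf_ge (R : realType) (u : nat -> \bar R) (a : \bar R) (n0 : nat) :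
  (forall n, (n0 <= n)%N -> a <= u n) -> a <= limn_einf u.
Proof.
move=> h; rewrite limn_einf_lim; apply: lime_ge; first exact: is_cvg_einfs.
exists n0 => // n /= n0n; apply: le_ereal_inf_tmp => _ [k /= block_weight <-].
by apply: h; apply: leq_trans block_weight.
Qed.

Lemma limn_einf_le (R : realType) (u v : nat -> \bar R) :
  (forall n, u n <= v n) -> limn_einf u <= limn_einf v.
Proof.
move=> h; rewrite !limn_einf_lim; apply: lee_lim; [exact: is_cvg_einfs..|].
apply: nearW => n; apply: le_ereal_inf_tmp => _ [k /= block_weight <-].
by apply: le_trans (h k); apply: ereal_inf_lbound; exists k.
Qed.

Lemma limn_einf_le_cst (R : realType) (u : nat -> \bar R) (a : \bar R) :
  (forall n, u n <= a) -> limn_einf u <= a.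
Proof.
move=> h; rewrite limn_einf_lim; apply: lime_le; first exact: is_cvg_einfs.
by apply: nearW => n; apply: le_trans (h n); apply: ereal_inf_lbound; exists n => //=.
Qed.

Context dd (T : measurableType dd) (R : realType) (mu : {measure set T -> \bar R}).

(* The integral of a nonnegative function is a supremum over simple functions, hence
   monotone without any measurability assumption. *)
Lemma ge0_le_integral_nomeas (D : set T) (f g : T -> \bar R) :
  (forall x, D x -> 0 <= f x) -> (forall x, D x -> f x <= g x) ->
  \int[mu]_(x in D) f x <= \int[mu]_(x in D) g x.
Proof.
move=> f0 fg; have g0 x : D x -> 0 <= g x by move=> Dx; apply: le_trans (fg _ Dx); apply: f0.
rewrite !ge0_integralE //; apply: ge_ereal_sup => _ [h hh <-].
apply: ereal_sup_ubound; exists h => // x; apply: le_trans (hh x) _; apply: lee_restrict => y; exact: fg.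
Qed.

(** Only the majorants [f] enter the classical lemma; [h] is handled by monotonicity, which holds
    without measurability. The exceptional set is absorbed by adding a function equal to [+oo] on
    [N], whose integral is 0. *)
Lemma fatou_le (D N : set T) (f : nat -> T -> \bar R) (h : T -> \bar R) :
  measurable D -> measurable N -> mu N = 0 ->
  (forall n, measurable_fun D (f n)) -> (forall n x, D x -> 0 <= f n x) ->
  (forall x, D x -> 0 <= h x) ->
  (forall x, D x -> ~ N x -> h x <= limn_einf (f^~ x)) ->
  \int[mu]_(x in D) h x <= limn_einf (fun n => \int[mu]_(x in D) f n x).
Proof.
move=> mD mN N0 mf f0 h0 hf; apply: le_trans (fatou mu mD mf f0).
have L0 x : D x -> 0 <= limn_einf (f^~ x).
  by move=> Dx; apply: (@limn_einf_ge _ _ _ 0%N) => n _; apply: f0.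
have mL : measurable_fun D (fun x => limn_einf (f^~ x)).
  rewrite /limn_einf; apply: measurableT_comp => //.
  by apply: measurable_fun_limn_esup => n; apply: measurableT_comp.
pose inf := (cst +oo : T -> \bar R) \_ N.
have inf0 x : 0 <= inf x by rewrite /inf patchE; case: ifP => _; rewrite ?le0y.
have minf : measurable_fun D inf.
  by apply/(measurable_restrict _ mN mD); exact: measurable_cst.
apply: le_trans (_ : \int[mu]_(x in D) (limn_einf (f^~ x) + inf x) <= _).
  apply: ge0_le_integral_nomeas => // x Dx; rewrite /inf patchE.
  case: ifPn => [_|]; last by rewrite notin_setE addr0 => Nx; apply: hf.
  by rewrite addey ?leey //; apply/eqP => e; have := L0 x Dx; rewrite e.
rewrite ge0_integralD //.
have -> : \int[mu]_(x in D) inf x = 0.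
  rewrite /inf -integral_mkcondr integral_cst; last exact: measurableI.
  have -> : mu (D `&` N) = 0.
    by apply: (subset_measure0 (B := N)) => //; exact: measurableI.
  by rewrite mule0.
by rewrite adde0.
Qed.

End fatou_bounds.

Section euclidean_topology.
Context (R : realType) (d : nat).
Implicit Types (x y : 'rV[R]_d) (r e : R).

Lemma enorm_le_coord x e : 0 <= e -> (forall i, `|x 0 i| <= e) -> enorm x <= d%:R * e.
Proof.
move=> e0 h; rewrite -(@ler_pXn2r _ 2) ?nnegrE ?enorm_ge0 ?mulr_ge0 // enorm_sqr.
apply: le_trans (_ : \sum_(i < d) e ^+ 2 <= _).
  apply: ler_sum => i _; rewrite -[_ ^+ 2]ger0_norm ?sqr_ge0 // normrX.
  by rewrite lerXn2r ?nnegrE.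
rewrite sumr_const card_ord -[leLHS]mulr_natl exprMn ler_wpM2r ?sqr_ge0 // expr2 -natrM ler_nat.
by case: (d) => // k; rewrite leq_pmulr.
Qed.

Lemma enorm_near x e : 0 < e -> \forall y \near x, enorm (x - y) < e.
Proof.
move=> e0; have q0 : 0 < e / (d.+1%:R) by rewrite divr_gt0.
apply/nbhs_ballP; exists (e / d.+1%:R) => // y [_ hy] /=.
have h i : `|(x - y) 0 i| <= e / d.+1%:R by rewrite !mxE ltW //; apply: hy.
apply: le_lt_trans (enorm_le_coord (ltW q0) h) _.
rewrite mulrCA -[ltRHS]mulr1 ltr_pM2l // ltr_pdivrMr // mul1r ltr_nat //.
Qed.

Lemma eball_open x r : open (eball x r).
Proof.
rewrite openE => y /= hy; rewrite /interior.
have e0 : 0 < r - enorm (x - y) by rewrite subr_gt0.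
apply: filterS (enorm_near y e0) => z hz; rewrite /eball /=.
have := enorm_triangle y x z; move: hz; clear; lra.
Qed.

Lemma open_borel (U : set 'rV[R]_d) : open U -> measurable (U : set (borel_rV R d)).
Proof. by move=> oU; apply: sub_sigma_algebra. Qed.

Lemma closed_borel (U : set 'rV[R]_d) : closed U -> measurable (U : set (borel_rV R d)).
Proof.
move=> cU; rewrite -(setCK U); apply: measurableC; apply: open_borel.
exact: closed_openC.
Qed.

Lemma eball_measurable x r : measurable (eball x r : set (borel_rV R d)).
Proof. by apply: open_borel; apply: eball_open. Qed.

Lemma coord_measurable (D : set (borel_rV R d)) (j : 'I_d) :
  measurable_fun D (fun y : borel_rV R d => (y : 'rV[R]_d) 0 j).
Proof.
suff h : measurable_fun setT (fun y : borel_rV R d => (y : 'rV[R]_d) 0 j).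
  by apply: measurable_funS h.
apply: (measurability _ (RGenOInfty.measurableE R)) => _ [_ [a ->] <-].
rewrite setTI; apply: open_borel; rewrite set_itvoy.
have /continuousP := @coord_continuous R 1 d 0 j; apply; exact: open_gt.
Qed.

End euclidean_topology.

(** The open ball is a countable union of compact balls on which [g] is continuous, so the image is
    a countable union of compact sets. *)
Lemma lipschitz_image_borel (R : realType) n d (M r : R) (g : 'rV[R]_n -> 'rV[R]_d) : 0 <= M ->
  lipschitz_with M (eball 0 r) g -> measurable (g @` eball 0 r : set (borel_rV R d)).
Proof.
move=> M0 gL.
pose K k : set 'rV[R]_n := [set u | enorm u <= r - k.+1%:R^-1].
have KB k : K k `<=` eball 0 r.
  move=> u; rewrite /K /eball /= sub0r enormN => h; apply: le_lt_trans h _.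
  by rewrite ltrBlDr ltrDl invr_gt0.
have -> : g @` eball 0 r = \bigcup_k (g @` K k).
  rewrite eqEsubset; split => [_ [u hu <-]|_ [k _ [u hu <-]]]; last first.
    by exists u => //; apply: KB hu.
  have e0 : 0 < r - enorm u by move: hu; rewrite /eball /= sub0r enormN subr_gt0.
  exists (Num.truncn (r - enorm u)^-1) => //; exists u => //.
  rewrite /K /= lerBrDr -lerBrDl -[leRHS]invrK lef_pV2 ?posrE ?invr_gt0 //.
  exact/ltW/truncnS_gt.
apply: bigcup_measurable => k _; apply: closed_borel.
apply: compact_closed; first exact: norm_hausdorff.
apply: continuous_compact.
  apply/subspace_continuousP => u Ku; apply/cvg_ballP => e e0.
  have q0 : 0 < e / (M + 1) by rewrite divr_gt0 // ltr_wpDl.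
  rewrite near_withinE; have hn := enorm_near u q0.
  near=> v => Kv.
  have hv : enorm (u - v) < e / (M + 1) by near: v.
  rewrite /from_subspace /=; split => // i j; rewrite (ord1 i).
  apply: le_lt_trans (_ : enorm (g u - g v) < e).
    by have := enorm_coord (g u - g v) j; rewrite !mxE.
  apply: le_lt_trans (gL _ _ (KB k _ Ku) (KB k _ Kv)) _.
  apply: le_lt_trans (_ : (M + 1) * enorm (u - v) < e).
    by rewrite ler_wpM2r ?enorm_ge0 // lerDl.
  by rewrite mulrC -ltr_pdivlMr // ltr_wpDl.
apply: bounded_closed_compact.
  exists r; split; first exact: num_real.
  move=> M' rM' u Ku; apply: le_trans (ltW rM').
  have hu : enorm u <= r by apply: le_trans Ku _; rewrite gerBl invr_ge0.
  have r0 : 0 <= r by apply: le_trans hu; apply: enorm_ge0.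
  have [->|u0] := eqVneq u 0; first by rewrite normr0.
  have un : mx_norm u != 0 by apply: contra u0 => /eqP /mx_norm_eq0 ->.
  have -> : `|u| = mx_norm u by [].
  have [ij ->] := mx_norm_neq0 un.
  by rewrite (ord1 ij.1); apply: le_trans (enorm_coord _ _) hu.
rewrite (_ : K k = ~` [set u | r - k.+1%:R^-1 < enorm u]); last first.
  by apply/seteqP; split => u /=; rewrite /K /= leNgt => /negP.
apply: open_closedC; rewrite openE => u /= hu; rewrite /interior.
have e0 : 0 < enorm u - (r - k.+1%:R^-1) by rewrite subr_gt0.
apply: filterS (enorm_near u e0) => v /= hv.
have := enorm_triangle v u 0; rewrite !subr0; move: (k.+1%:R^-1) hv; clear.
move: (enorm u) (enorm v) (enorm (u - v)) => a b c q. lra.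
Unshelve. all: by end_near. Qed.

Section finite_families.
Local Open Scope ereal_scope.
Context dd (T : measurableType dd) (R : realType) (mu : {measure set T -> \bar R}).
Context (I : eqType) (F : I -> set T).
Hypothesis mF : forall i, measurable (F i).

Lemma sum_measure_le (s : seq I) (A : set T) : uniq s -> measurable A ->
  (forall i, i \in s -> F i `<=` A) ->
  (forall i j, i \in s -> j \in s -> i != j -> F i `&` F j = set0) ->
  \sum_(i <- s) mu (F i) <= mu A.
Proof.
elim: s A => [|i s IH] A; first by rewrite big_nil.
move=> /= /andP[is_ us] mA sub dis; rewrite big_cons.
rewrite (measureDI mu (A := A) (B := F i)) // addeC leeD //.
  apply: IH => //; first exact: measurableD.
    move=> j js x Fx; split; first by apply: (sub j) => //; rewrite inE js orbT.
    move=> Fi; have ij : i != j by apply: contraNneq is_ => ->.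
    have := dis i j (mem_head _ _) _ ij; rewrite inE js orbT => /(_ isT) e.
    by have : (F i `&` F j) x by []; rewrite e.
  by move=> j k js ks; apply: dis; rewrite inE ?js ?ks orbT.
by rewrite setIidr //; apply: sub; rewrite mem_head.
Qed.

Lemma measure_le_sum (s : seq I) (A : set T) : measurable A ->
  (forall x, A x -> exists2 i, i \in s & F i x) ->
  mu A <= \sum_(i <- s) mu (F i).
Proof.
elim: s A => [|i s IH] A mA cov.
  rewrite big_nil (_ : A = set0) ?measure0 //.
  by apply/seteqP; split => // x /cov[].
rewrite big_cons (measureDI mu (A := A) (B := F i)) // addeC leeD //.
  exact: measureIr.
apply: IH; first exact: measurableD.
move=> x [/cov[j]]; rewrite inE => /orP[/eqP -> //|js] Fj _; by exists j.
Qed.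

End finite_families.

Section support.
Context (R : realType) (d : nat) (mu : {measure set (borel_rV R d) -> \bar R}).

Lemma measure_mono (A B : set (borel_rV R d)) : measurable A -> measurable B ->
  A `<=` B -> (mu A <= mu B)%E.
Proof. by move=> mA mB AB; rewrite -(setIidl AB); apply: measureIr. Qed.

Lemma not_spt x : ~ spt mu x -> exists U : set 'rV[R]_d, [/\ open U, U x & mu U = 0%E].
Proof.
move=> /existsNP[U /not_implyP[oU /not_implyP[Ux /negP hU]]]; exists U; split => //.
by apply/eqP; rewrite eq_le measure_ge0 andbT leNgt.
Qed.

Lemma spt_closed : closed (spt mu).
Proof.
rewrite -(setCK (spt mu)); apply: open_closedC; rewrite openE => x /not_spt[U [oU Ux U0]].
rewrite /interior; have : nbhs x U by apply: open_nbhs_nbhs.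
by apply: filterS => z Uz /(_ U oU Uz); rewrite U0 ltxx.
Qed.

(** By inner regularity only compact subsets of the complement count, and each is covered by
    finitely many null open sets. *)
Lemma spt_null : radon mu -> mu (~` spt mu) = 0%E.
Proof.
case=> _ _ inner; apply/eqP; rewrite eq_le measure_ge0 andbT.
rewrite inner; last by apply: closed_openC; exact: spt_closed.
apply: ge_ereal_sup => _ [K [cK Ksub] <-].
have ex x : exists U : set 'rV[R]_d, [/\ open U, mu U = 0%E & ~ spt mu x -> U x].
  case: (pselect (spt mu x)) => [sx|/not_spt[U [oU Ux U0]]]; last by exists U.
  by exists set0; split => //; exact: open0.
have [F hF] := choice ex.
have Kcov : cover_compact K by rewrite -compact_cover.
have [D' _ KD] := Kcov _ K F (fun i _ => let: And3 o _ _ := hF i in o)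
  (fun x Kx => ex_intro2 _ _ x Kx (let: And3 _ _ h := hF x in h (Ksub _ Kx))).
have mF i : measurable (F i : set (borel_rV R d)) by apply: open_borel; case: (hF i).
have mK : measurable (K : set (borel_rV R d)).
  by apply: closed_borel; apply: compact_closed => //; exact: norm_hausdorff.
have hs := @measure_le_sum _ _ R mu 'rV[R]_d F mF (enum_fset D') K mK.
apply: le_trans (hs _) _; first by move=> x /KD[i iD Fi]; exists i.
by rewrite big1 // => i _; case: (hF i).
Qed.

(** A ball meeting the support lies in one of twice the radius centred on it; any other ball is
    null. *)
Lemma upper_ball n : ADR n mu -> exists2 c : R, 0 < c &
  forall x r, 0 < r -> (mu (eball x r) <= (c * r ^+ n)%:E)%E.
Proof.
case=> rad [c c1 hc]; exists (c * 2 ^+ n).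
  by rewrite mulr_gt0 ?exprn_gt0 // (lt_le_trans ltr01).
move=> x r r0; case: (pselect (exists z, spt mu z /\ eball x r z)) => [[z [sz xz]]|nex].
  have /andP[_ h] := hc z (2 * r) sz (mulr_gt0 (ltr0n R 2) r0).
  apply: le_trans (_ : mu (eball z (2 * r)) <= _)%E.
    apply: measure_mono; [exact: eball_measurable..|].
    move=> w; rewrite /eball /= => xw; apply: le_lt_trans (enorm_triangle x _ _) _.
    move: xz; rewrite /eball /= (enormB z x); move: xw; clear; lra.
  by apply: le_trans h _; rewrite lee_fin exprMn mulrA.
apply: le_trans (_ : mu (~` spt mu) <= _)%E.
  apply: measure_mono; first exact: eball_measurable.
    by apply: measurableC; apply: closed_borel; exact: spt_closed.
  by move=> z xz sz; apply: nex; exists z.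
rewrite spt_null // lee_fin; apply: mulr_ge0; last exact/exprn_ge0/ltW.
by rewrite mulr_ge0 ?exprn_ge0 // (le_trans ler01).
Qed.

End support.

(** * Discretization of the measure and of the Lipschitz maps *)

Section cells.
Context (R : realType) (d : nat) (s : R).
Hypothesis s0 : 0 < s.

Definition cidx (x : 'rV[R]_d) : 'rV[int]_d := \row_j Num.floor (s * x 0 j).

Lemma cidxP x j : (cidx x 0 j)%:~R <= s * x 0 j < (cidx x 0 j)%:~R + 1.
Proof. by rewrite /cidx zrowE; have := floor_itv (s * x 0 j); rewrite intrD. Qed.

Lemma cell_measurable p : measurable ([set x | cidx x = p] : set (borel_rV R d)).
Proof.
have -> : [set x | cidx x = p] = \bigcap_(j in [set: 'I_d])
   ([set x | p 0 j <= Num.floor (s * x 0 j)] `&` [set x | Num.floor (s * x 0 j) < p 0 j + 1]).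
  apply/seteqP; split => [x <- j _|x h] /=.
    by rewrite /cidx zrowE; split => //; rewrite ltzD1.
  apply: zP => j; have [h1 h2] := h j I; rewrite /cidx zrowE.
  by move: h1 h2 => /=; clear; lia.
have mI (j : 'I_d) (J : set R) : measurable J ->
    measurable ([set x : 'rV[R]_d | J (x 0 j)] : set (borel_rV R d)).
  by move=> mJ; have := coord_measurable (D := setT) j measurableT mJ; rewrite setTI.
apply: fin_bigcap_measurable => // j _; apply: measurableI.
  have := mI j `[(p 0 j)%:~R / s, +oo[%classic (measurable_itv _).
  congr measurable; apply/seteqP; split => x /=;
    by rewrite in_itv /= andbT ler_pdivrMr // mulrC floor_ge_int.
have := mI j `]-oo, (p 0 j + 1)%:~R / s[%classic (measurable_itv _).
congr measurable; apply/seteqP; split => x /=;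
  by rewrite in_itv /= ltr_pdivlMr // mulrC floor_lt_int.
Qed.

Lemma cell_diam x z : cidx x = cidx z -> enorm (x - z) <= d%:R / s.
Proof.
move=> e; apply: enorm_le_coord; first by rewrite invr_ge0 ltW.
move=> j; rewrite !mxE -(ler_pM2l s0) mulfV ?gt_eqF //.
rewrite -[X in X * `|_|](gtr0_norm s0) -normrM mulrBr.
have := cidxP x j; have := cidxP z j; rewrite e ler_norml; clear; lra.
Qed.

Lemma zn_cidx (x : 'rV[R]_d) (r : R) : (forall j, `|x 0 j| <= r) -> (znorm (cidx x) <= (Num.truncn (s * r)).+2)%N.
Proof.
move=> h; apply/zn_leP => j; rewrite -(ler_nat R) natr_absz intr_norm.
have := cidxP x j; have : `|s * x 0 j| <= s * r by rewrite normrM (gtr0_norm s0) ler_pM2l.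
have := truncnS_gt (s * r); rewrite -(natr1 (Num.truncn _).+1) !ler_norml; clear; lra.
Qed.

End cells.

(* At scale [eta] the measure is replaced by point masses: each cell of side [eta / (2 d)]
   is collapsed to a point of the support inside it, and lengths are divided by [eta].
   Cells missing the support are null; their point is irrelevant. *)
Lemma discretize (R : realType) n d (mu : {measure set (borel_rV R d) -> \bar R}) :
  (0 < d)%N -> ADR n mu -> exists2 C1 : R, 0 < C1 &
  forall x0 (eta rho : R), spt mu x0 -> 0 < eta -> 0 < rho ->
  exists (I : finType) (m : I -> R) (y : I -> 'rV[R]_d) (A : I -> set (borel_rV R d)),
  [/\ [/\ forall i, measurable (A i), forall i j, i != j -> A i `&` A j = set0,
          forall i, A i `<=` eball x0 rho & forall z, eball x0 rho z -> exists i, A i z],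
      [/\ forall i, 0 <= m i, forall i, mu (A i) = (m i * eta ^+ n)%:E & upper_regular n m y C1],
      forall i z, m i != 0 -> A i z -> enorm (y i - eta^-1 *: z) <= 2^-1,
      forall i x z, spt mu x -> A i x -> A i z -> enorm (y i - eta^-1 *: z) <= 2^-1 &
      forall i, spt mu (eta *: y i)].
Proof.
move=> d0 adr; have [c c0 hc] := upper_ball adr; have [rad _] := adr.
exists (c * 2 ^+ n); first by rewrite mulr_gt0 ?exprn_gt0.
move=> x0 eta rho sx0 eta0 rho0.
have dR : 0 < d%:R :> R by rewrite ltr0n.
(* Cells of side [eta / (2 * d)] have Euclidean diameter at most [eta / 2], that is 1/2 after
   rescaling. *)
pose s : R := 2 * d%:R / eta; have s0 : 0 < s by rewrite divr_gt0 ?mulr_gt0.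
pose N := (Num.truncn (s * (enorm x0 + rho))).+2.
pose I : finType := seq_sub (zbox d N).
pose A (i : I) : set (borel_rV R d) := [set x | cidx s x = val i] `&` eball x0 rho.
have mA i : measurable (A i).
  by apply: measurableI; [exact: cell_measurable|exact: eball_measurable].
have en0 : eta^-1 * eta = 1 by rewrite mulVf // gt_eqF.
have diam i x z : A i x -> A i z -> enorm (eta^-1 *: x - eta^-1 *: z) <= 2^-1.
  move=> [/= ex _] [/= ez _]; rewrite -scalerBr enormZ gtr0_norm ?invr_gt0 //.
  have h : enorm (x - z) <= d%:R / s by apply: cell_diam => //; rewrite ex ez.
  apply: le_trans (ler_wpM2l _ h) _; first by rewrite invr_ge0 ltW.
  by rewrite /s le_eqVlt; apply/orP; left; apply/eqP; field; rewrite !gt_eqF.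
have ex i : exists y : 'rV[R]_d, spt mu (eta *: y) /\
    ((exists2 x, spt mu x & A i x) -> A i (eta *: y)).
  have back (x : 'rV[R]_d) : eta *: (eta^-1 *: x) = x.
    by rewrite scalerA mulrC en0 scale1r.
  case: (pselect (exists2 x, spt mu x & A i x)) => [[x sx Ax]|nx].
    by exists (eta^-1 *: x); rewrite back.
  by exists (eta^-1 *: x0); rewrite back.
have [y hy] := choice ex.
have close i x z : spt mu x -> A i x -> A i z -> enorm (y i - eta^-1 *: z) <= 2^-1.
  move=> sx Ax Az; have [_ h] := hy i.
  have := diam i _ _ (h (ex_intro2 _ _ x sx Ax)) Az.
  by rewrite scalerA en0 scale1r.
have sub i : A i `<=` eball x0 rho by move=> z [].
have fin i : (mu (A i) < +oo)%E.
  apply: le_lt_trans (ltry (c * rho ^+ n)); apply: le_trans (hc x0 rho rho0).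
  by apply: measure_mono => //; exact: eball_measurable.
have finn i : mu (A i) \is a fin_num by rewrite ge0_fin_numE.
pose m i := fine (mu (A i)) / eta ^+ n.
have en : 0 < eta ^+ n by rewrite exprn_gt0.
have m0 i : 0 <= m i by rewrite divr_ge0 ?(ltW en) // fine_ge0.
have mE i : mu (A i) = (m i * eta ^+ n)%:E.
  by rewrite /m divfK ?gt_eqF // fineK.
have mnz i z : m i != 0 -> A i z -> enorm (y i - eta^-1 *: z) <= 2^-1.
  move=> mi Az; case: (pselect (exists2 x, spt mu x & A i x)) => [[x sx Ax]|nx].
    exact: close sx Ax Az.
  exfalso; move/eqP: mi; apply; rewrite /m.
  have -> : mu (A i) = 0%E; last by rewrite mul0r.
  apply/eqP; rewrite eq_le measure_ge0 andbT -(spt_null rad); apply: measure_mono => //.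
    by apply: measurableC; apply: closed_borel; exact: spt_closed.
  by move=> x Ax sx; apply: nx; exists x.
have dis i j : i != j -> A i `&` A j = set0.
  move=> ij; apply/seteqP; split => // z [[/= e1 _] [/= e2 _]].
  by move/eqP: ij; apply; apply: val_inj; apply: etrans (esym e1) e2.
exists I, m, y, A; split; [split => //|split => //|exact: mnz|exact: close|].
- move=> z hz; have zb : cidx s z \in zbox d N.
    rewrite mem_bx; apply: zn_cidx => // j; apply: le_trans (enorm_coord z j) _.
    have := enorm_triangle x0 z 0; rewrite !subr0; move: hz; rewrite /eball /= enormB.
    by clear; lra.
  by exists (SeqSub zb).
(* Massless atoms are dropped, since they may be far from their cells; for the others the doubled
   radius contains the whole cell. *)
- move=> x k; pose P := [seq i <- index_enum I | (m i != 0) && (enorm (y i - x) <= 2 ^+ k)].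
  have k1 : 1 <= 2 ^+ k :> R by rewrite exprn_ege1 // ler1n.
  have r0 : 0 < eta * (2 * 2 ^+ k) by rewrite !mulr_gt0 ?exprn_gt0.
  have hs := @sum_measure_le _ _ R mu I A mA P (eball (eta *: x) (eta * (2 * 2 ^+ k))).
  have {}hs : (\sum_(i <- P) mu (A i) <= (c * (eta * (2 * 2 ^+ k)) ^+ n)%:E)%E.
    apply: le_trans (hc _ _ r0); apply: hs; first by rewrite filter_uniq ?index_enum_uniq.
    - exact: eball_measurable.
    - move=> i; rewrite mem_filter => /andP[/andP[mi ix] _] z Az; rewrite /eball /=.
      have -> : eta *: x - z = eta *: (x - eta^-1 *: z).
        by rewrite scalerBr scalerA (mulrC eta) en0 scale1r.
      rewrite enormZ (gtr0_norm eta0) ltr_pM2l //.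
      apply: le_lt_trans (enorm_triangle (y i) _ _) _.
      have := mnz i z mi Az; move: ix; rewrite (enormB (y i) x); move: k1; clear; lra.
    - by move=> i j _ _; apply: dis.
  have -> : \sum_(i | enorm (y i - x) <= 2 ^+ k) m i = \sum_(i <- P) m i.
    rewrite big_filter big_mkcond [RHS]big_mkcond; apply: eq_bigr => i _.
    by have [->|_] := eqVneq (m i) 0; rewrite //=; case: ifP.
  rewrite -(ler_pM2r en) mulr_suml -lee_fin -sumEFin.
  rewrite (eq_bigr (fun i => mu (A i))); last by move=> i _; rewrite mE.
  apply: le_trans hs _; rewrite lee_fin !exprMn -exprM le_eqVlt; apply/orP; left; apply/eqP; ring.
- by move=> i; have [] := hy i.
Qed.

(* McShane's formula, one coordinate at a time. *)
Lemma mcshane (R : realType) n d (L : R) (K : seq 'rV[int]_n) (g : 'rV[int]_n -> 'rV[R]_d) :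
  0 <= L -> (0 < size K)%N ->
  (forall u v, u \in K -> v \in K -> enorm (g u - g v) <= L * (znorm (u - v))%:R) ->
  exists2 g' : 'rV[int]_n -> 'rV[R]_d,
    (forall u v, enorm (g' u - g' v) <= d%:R * L * (znorm (u - v))%:R) &
    forall u, u \in K -> g' u = g u.
Proof.
move=> L0 K0 hg.
have ex (uj : 'rV[int]_n * 'I_d) : exists v, v \in K /\ forall v', v' \in K ->
    g v 0 uj.2 + L * (znorm (uj.1 - v))%:R <= g v' 0 uj.2 + L * (znorm (uj.1 - v'))%:R.
  have [v vK h] := seq_argmin (fun v => g v 0 uj.2 + L * (znorm (uj.1 - v))%:R) K0.
  by exists v.
have [v hv] := choice ex.
pose g' u : 'rV[R]_d := \row_j (g (v (u, j)) 0 j + L * (znorm (u - v (u, j)))%:R).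
have one u u' j : g' u 0 j <= g' u' 0 j + L * (znorm (u - u'))%:R.
  rewrite !mxE; have [_ /=] := hv (u, j); have [vK _] := hv (u', j).
  move=> /(_ _ vK) /le_trans; apply; rewrite -addrA lerD2l -mulrDr ler_wpM2l // -natrD ler_nat.
  by rewrite addnC; exact: zn_triangle.
exists g' => [u u'|u uK].
  rewrite -mulrA; apply: enorm_le_coord => [|j]; first by rewrite mulr_ge0.
  rewrite [in X in X <= _]mxE [X in _ + X]mxE; have := one u u' j; have := one u' u j.
  rewrite (znB u' u) ler_norml; move: (g' u 0 j) (g' u' 0 j) (L * _); clear; move=> a b c; lra.
apply/rowP => j; rewrite mxE; have [vK /= h] := hv (u, j).
apply/eqP; rewrite eq_le; apply/andP; split.
  by have := h u uK; rewrite subrr zn0 mulr0 addr0.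
have := le_trans (enorm_coord _ j) (hg u _ uK vK); rewrite !mxE ler_norml => /andP[_].
clear; lra.
Qed.

Section truncation.
Context (R : realType).

(** Rounding towards 0 does not increase absolute values, so a rounded parameter stays in the ball
    on which the map is Lipschitz. *)
Definition truncz (x : R) : int := if 0 <= x then Num.floor x else - Num.floor (- x).

Lemma trz_le x : `|(truncz x)%:~R : R| <= `|x|.
Proof.
have pos z : 0 <= z -> `|(Num.floor z)%:~R : R| <= `|z|.
  move=> z0; have f0 : 0 <= Num.floor z by rewrite floor_ge0.
  by rewrite !ger0_norm ?ler0z // floor_le.
rewrite /truncz; case: (leP 0 x) => h; first exact: pos.
by rewrite intrN normrN -(normrN x); apply: pos; rewrite oppr_ge0 ltW.
Qed.

Lemma trz_close x : `|x - (truncz x)%:~R| <= 1.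
Proof.
have pos (z : R) : `|z - (Num.floor z)%:~R| <= 1.
  have := floor_itv z; rewrite intrD ler_norml; clear; lra.
rewrite /truncz; case: (leP 0 x) => h; first exact: pos.
have := pos (- x); rewrite intrN -normrN; congr (`|_| <= _); ring.
Qed.

End truncation.

Lemma enorm_mono (R : realType) n (x y : 'rV[R]_n) :
  (forall j, `|x 0 j| <= `|y 0 j|) -> enorm x <= enorm y.
Proof.
move=> h; rewrite ler_sqrt ?sumr_ge0 // => [|j _]; last by rewrite sqr_ge0.
apply: ler_sum => j _; rewrite -(real_normK (num_real (x 0 j))) -(real_normK (num_real (y 0 j))).
by rewrite lerXn2r ?nnegrE.
Qed.

(** The Lipschitz map of a ball is sampled at the points [eta * u], rescaled, and extended to the
    whole lattice by [mcshane]. The selected atoms are those whose cells meet the image inside the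
    ball, so their cells carry all of its mass there. *)
Lemma ur_lattice (R : realType) n d (mu : {measure set (borel_rV R d) -> \bar R})
    (theta M eta rho : R) (x0 : 'rV[R]_d) (I : finType) (m : I -> R) (y : I -> 'rV[R]_d)
    (A : I -> set (borel_rV R d)) (i : I) (b : nat) :
  0 < theta -> 0 < M ->
  (forall (x : 'rV[R]_d) (r : R), spt mu x -> 0 < r ->
      exists2 g : 'rV[R]_n -> 'rV[R]_d, lipschitz_with M (eball 0 r) g &
        ((theta * r ^+ n)%:E <= mu (eball x r `&` g @` eball 0%R r))%E) ->
  0 < eta ->
  (forall i, measurable (A i)) -> (forall z, eball x0 rho z -> exists i, A i z) ->
  (forall i, 0 <= m i) -> (forall i, mu (A i) = (m i * eta ^+ n)%:E) ->
  (forall i z, m i != 0 -> A i z -> enorm (y i - eta^-1 *: z) <= 2^-1) ->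
  spt mu (eta *: y i) ->
  eball (eta *: y i) (2 ^+ b * eta / 2) `<=` eball x0 rho ->
  exists2 g : 'rV[int]_n -> 'rV[R]_d,
    (forall u v, enorm (g u - g v) <= d%:R * (M * n%:R) * (znorm (u - v))%:R) &
  exists (J : pred I) (kap : I -> 'rV[int]_n), [/\
    forall l, J l -> (znorm (kap l) <= 2 ^ b)%N,
    forall l, J l -> enorm (y l - g (kap l)) <= 2^-1 + M * n%:R,
    forall l, J l -> enorm (y l - y i) <= 2 ^+ b &
    theta / 2 ^+ n * 2 ^+ (b * n) <= \sum_(l | J l) m l].
Proof.
move=> th0 M0 hUR eta0 mA cov m0 mE mnz syi sub.
(* The factor 1/2 leaves room for the cells: their atoms stay within [2 ^ b / 2 + 1 / 2 <= 2 ^ b] of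
   [y i]. *)
pose r : R := 2 ^+ b * eta / 2.
have b1 : 1 <= 2 ^+ b :> R by rewrite exprn_ege1 // ler1n.
have r0 : 0 < r by rewrite divr_gt0 ?mulr_gt0 ?exprn_gt0.
have en0 : eta^-1 * eta = 1 by rewrite mulVf // gt_eqF.
have ei0 : 0 < eta^-1 by rewrite invr_gt0.
have rE : eta^-1 * r = 2 ^+ b / 2 by rewrite /r; field; rewrite gt_eqF.
have [g0 g0L hmass] := hUR _ r syi r0.
pose pt (u : 'rV[int]_n) : 'rV[R]_n := \row_j (eta * (u 0 j)%:~R).
pose K := [seq u <- zbox n (2 ^ b) | enorm (pt u) < r].
have inK u : u \in K -> eball 0 r (pt u).
  by rewrite mem_filter => /andP[h _]; rewrite /eball /= sub0r enormN.
have K0 : (0 < size K)%N.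
  have : 0 \in K.
    rewrite mem_filter mem_bx zn0 leq0n andbT (_ : pt 0 = 0) ?enorm0 //.
    by apply/rowP => j; rewrite !mxE mulr0.
  by case: (K).
pose g1 u : 'rV[R]_d := eta^-1 *: g0 (pt u).
have L0 : 0 <= M * n%:R by rewrite mulr_ge0 // ltW.
have g1L u v : u \in K -> v \in K -> enorm (g1 u - g1 v) <= M * n%:R * (znorm (u - v))%:R.
  move=> uK vK; rewrite /g1 -scalerBr enormZ gtr0_norm // ler_pdivrMl //.
  apply: le_trans (g0L _ _ (inK _ uK) (inK _ vK)) _.
  have -> : eta * (M * n%:R * (znorm (u - v))%:R) = M * (n%:R * (eta * (znorm (u - v))%:R)) by ring.
  rewrite ler_pM2l //; apply: enorm_le_coord => [|j]; first by rewrite mulr_ge0 // ltW.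
  rewrite !mxE -mulrBr -intrB normrM (gtr0_norm eta0) ler_pM2l //.
  by rewrite -intr_norm -natr_absz ler_nat -zBE; exact: zn_coord.
have [g gL gE] := mcshane L0 K0 g1L.
exists g => //.
pose hit l v := [/\ eball 0 r v, A l (g0 v) & eball (eta *: y i) r (g0 v)].
pose J l := (m l != 0) && `[< exists v, hit l v >].
have ex l : exists v, J l -> hit l v.
  by rewrite /J; case: (boolP `[< _ >]) => [/asboolP[v hv]|_]; [exists v|exists 0; rewrite andbF].
have [v hv] := choice ex.
pose kap l : 'rV[int]_n := \row_j truncz (eta^-1 * v l 0 j).
have vball l : J l -> enorm (v l) < r.
  by move=> /hv[]; rewrite /eball /= sub0r enormN.
have kapz l : J l -> (znorm (kap l) <= 2 ^ b)%N.
  move=> Jl; apply/zn_leP => j; rewrite -(ler_nat R) natr_absz intr_norm /kap zrowE.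
  apply: le_trans (trz_le _) _; rewrite normrM (gtr0_norm ei0) natrX.
  apply: le_trans (_ : eta^-1 * r <= _).
    rewrite ler_pM2l //; apply: le_trans (enorm_coord _ j) _; exact/ltW/vball.
  rewrite rE; move: b1; clear; lra.
have kapK l : J l -> kap l \in K.
  move=> Jl; rewrite mem_filter mem_bx kapz // andbT; apply: le_lt_trans (vball l Jl).
  apply: enorm_mono => j; rewrite /pt mxE /kap zrowE normrM (gtr0_norm eta0).
  apply: le_trans (ler_wpM2l (ltW eta0) (trz_le _)) _.
  by rewrite normrM (gtr0_norm ei0) mulrA (mulrC eta) en0 mul1r.
exists J, kap; split => //.
- move=> l Jl; have [v1 v2 v3] := hv l Jl; have /andP[ml _] := Jl.
  rewrite gE ?kapK // /g1; apply: le_trans (enorm_triangle (eta^-1 *: g0 (v l)) _ _) _.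
  apply: lerD; first exact: mnz.
  rewrite -scalerBr enormZ gtr0_norm // ler_pdivrMl //.
  apply: le_trans (g0L _ _ v1 (inK _ (kapK _ Jl))) _.
  have -> : eta * (M * n%:R) = M * (n%:R * eta) by ring.
  rewrite ler_pM2l //; apply: enorm_le_coord => [|j]; first exact: ltW.
  rewrite /pt !mxE; have -> : v l 0 j = eta * (eta^-1 * v l 0 j).
    by rewrite mulrA (mulrC eta) en0 mul1r.
  rewrite (mulrA eta^-1) (_ : eta^-1 * eta = 1) // mul1r -mulrBr normrM (gtr0_norm eta0).
  by rewrite -[leRHS]mulr1 ler_pM2l // trz_close.
- move=> l Jl; have [v1 v2 v3] := hv l Jl; have /andP[ml _] := Jl.
  apply: le_trans (enorm_triangle (eta^-1 *: g0 (v l)) _ _) _.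
  have := mnz l _ ml v2.
  have : enorm (eta^-1 *: g0 (v l) - y i) <= eta^-1 * r.
    have -> : eta^-1 *: g0 (v l) - y i = eta^-1 *: (g0 (v l) - eta *: y i).
      by rewrite scalerBr scalerA en0 scale1r.
    rewrite enormZ gtr0_norm // ler_pM2l // enormB; exact/ltW/v3.
  rewrite rE; move: b1; clear; lra.
- set E := _ `&` _ in hmass.
  have mEs : measurable (E : set (borel_rV R d)).
    apply: measurableI; first exact: eball_measurable.
    by apply: lipschitz_image_borel g0L; apply: ltW.
  pose s := [seq l <- index_enum I | `[< exists v, hit l v >]].
  have hs := @measure_le_sum _ _ R mu I A mA s E mEs.
  have {}hs : (mu E <= \sum_(l <- s) mu (A l))%E.
    apply: hs => z [zb [w wb wz]]; have [l Al] := cov z (sub _ zb).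
    exists l => //; rewrite mem_filter mem_index_enum andbT; apply/asboolP.
    by exists w; rewrite /hit wz.
  have := le_trans hmass hs; rewrite (eq_bigr (fun l => (m l * eta ^+ n)%:E)); last by move=> l _; rewrite mE.
  rewrite sumEFin lee_fin -mulr_suml => h.
  have -> : \sum_(l | J l) m l = \sum_(l <- s) m l.
    rewrite big_filter big_mkcond [RHS]big_mkcond; apply: eq_bigr => l _; rewrite /J.
    by have [->|_] := eqVneq (m l) 0; rewrite //=; case: ifP.
  rewrite -(ler_pM2r (exprn_gt0 n eta0)); apply: le_trans h.
  rewrite /r !exprMn exprVn -exprM le_eqVlt; apply/orP; left; apply/eqP.
  by field; rewrite expf_neq0.
Qed.

(** * Comparison of the continuous and discrete square functions *)

Lemma phi_close_cell (R : realType) d (a b : 'rV[R]_d) (tau : R) (t : nat) :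
  enorm (a - b) <= 1 -> t%:R <= tau < t%:R + 1 ->
  enorm (phi tau a - phi t%:R b) <=
    if enorm b < t%:R + 2 then 2 + t%:R * (`|enorm b - t%:R| <= 2)%R%:R else 0.
Proof.
move=> ab /andP[t1 t2]; have t0 : 0 <= t%:R :> R by [].
have := enorm_lip a b; rewrite ler_norml => /andP[l1 l2].
have far (c : R) : c <= 2 + t%:R -> t%:R - 1 <= enorm b -> enorm b < t%:R + 2 ->
    c <= if enorm b < t%:R + 2 then 2 + t%:R * (`|enorm b - t%:R| <= 2)%R%:R else 0.
  move=> h1 h2 h3; rewrite h3 (_ : `|_| <= 2) ?mulr1 // ler_norml.
  by move: h2 h3; clear; lra.
rewrite /phi; case: (ltP (enorm a) tau) => ha; case: (ltP (enorm b) t%:R) => hb.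
- rewrite ifT; last by move: hb; clear; lra.
  apply: le_trans ab _; have : 0 <= t%:R * (`|enorm b - t%:R| <= 2)%R%:R :> R by rewrite mulr_ge0.
  clear; lra.
- by rewrite subr0; apply: far; move: ab l1 l2 ha hb t1 t2; clear; lra.
- by rewrite sub0r enormN; apply: far; move: ab l1 l2 ha hb t1 t2; clear; lra.
- by rewrite subr0 enorm0; case: ifP => // _; rewrite addr_ge0 ?mulr_ge0.
Qed.

(** Closeness to [a] is asked only on cells of positive mass, because the atom of a null cell may be
    anywhere on the support. *)
Lemma integral_near dd (T : measurableType dd) (R : realType) (mu : {measure set T -> \bar R})
    (A : set T) (f : T -> R) (M B a e : R) :
  measurable A -> mu A = M%:E -> measurable_fun A f -> 0 <= B ->
  (forall z, A z -> `|f z| <= B) -> (M != 0 -> forall z, A z -> `|f z - a| <= e) ->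
  (\int[mu]_(z in A) (f z)%:E)%E = (\int[mu]_(z in A) f z)%:E /\
  `|\int[mu]_(z in A) f z - a * M| <= e * M.
Proof.
move=> mA muA mf B0 fB fe.
have Afin : (mu A < +oo)%E by rewrite muA ltry.
have M0 : 0 <= M by rewrite -lee_fin -muA measure_ge0.
have bint (h : T -> R) (c : R) : measurable_fun A h -> (forall z, A z -> `|h z| <= c) ->
    mu.-integrable A (EFin \o h).
  move=> mh hc; apply: measurable_bounded_integrable => //.
  by exists c; split; [exact: num_real|move=> c' cc' z Az; apply: le_trans (hc z Az) (ltW cc')].
have If := bint f B mf fB.
split; first by rewrite /Rintegral fineK //; exact: integrable_fin_num.
have key (e' : R) : (forall z, A z -> `|f z - a| <= e') ->
    `|\int[mu]_(z in A) f z - a * M| <= e' * M.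
  move=> h; have mfa : measurable_fun A (fun z => f z - a) by apply: measurable_funB.
  have Ifa := bint _ e' mfa h.
  have Ia : mu.-integrable A (EFin \o (fun=> a)) by apply: (bint _ `|a|) => //.
  have -> : \int[mu]_(z in A) f z - a * M = \int[mu]_(z in A) (f z - a).
    by rewrite RintegralB // Rintegral_cst // muA.
  apply: le_trans (le_normr_Rintegral mA Ifa) _.
  apply: le_trans (_ : \int[mu]_(z in A) e' <= _); last by rewrite Rintegral_cst // muA.
  apply: le_Rintegral => //.
    by apply: (bint _ e') => [|z Az]; [apply: measurableT_comp|rewrite normr_id; apply: h].
  by apply: (bint _ `|e'|) => //.
have [Mz|Mz] := eqVneq M 0; last by apply: key; apply: fe.
have := key (B + `|a|); rewrite Mz !mulr0; apply => z Az.
by apply: le_trans (ler_normB _ _) _; rewrite lerD2r fB.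
Qed.

(** In units of [eta], the radius [t] is rounded down to [k] and each cell is replaced by its atom;
    the errors have the form of [errsum] with displacement 2. Of the exponent [2 * n + 3], the two
    kernels account for [2 * n + 2] and the division by [t] for 1. The plus sign in [coord] reflects
    [x - y] in [Cn] against [y - x] in [cvec]. *)
Lemma Cn_pointwise (R : realType) n d (mu : {measure set (borel_rV R d) -> \bar R})
    (eta rho : R) (x0 x : 'rV[R]_d) (I : finType) (m : I -> R) (y : I -> 'rV[R]_d)
    (A : I -> set (borel_rV R d)) (i : I) (t : R) (k : nat) :
  0 < eta ->
  (forall i, measurable (A i)) -> (forall i j, i != j -> A i `&` A j = set0) ->
  (forall i, A i `<=` eball x0 rho) -> (forall z, eball x0 rho z -> exists i, A i z) ->
  (forall i, 0 <= m i) -> (forall i, mu (A i) = (m i * eta ^+ n)%:E) ->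
  (forall i z, m i != 0 -> A i z -> enorm (y i - eta^-1 *: z) <= 2^-1) ->
  enorm (y i - eta^-1 *: x) <= 2^-1 -> eball x t `<=` eball x0 rho ->
  (0 < k)%N -> k%:R * eta <= t < k.+1%:R * eta ->
  `|Cn n mu x t| ^+ 2 / t <= 2 / (k%:R ^+ (2 * n + 3) * eta) *
    (enorm (cvec m y k (y i)) ^+ 2 + (d%:R * errsum m (fun l => enorm (y l - y i) < k%:R + 2)
       (fun=> 2) (fun l => enorm (y l - y i)) k) ^+ 2).
Proof.
move=> eta0 mA dis sub cov m0 mE mnz xi xsub k0 /andP[tk1 tk2].
have kR : 0 < k%:R :> R by rewrite ltr0n.
have t0 : 0 < t by apply: lt_le_trans tk1; rewrite mulr_gt0.
have ti0 : 0 < t^-1 by rewrite invr_gt0.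
set Err := errsum _ _ _ _ _.
have Err0 : 0 <= Err by apply: errsum_ge0.
pose G : 'rV[R]_d := \row_(j < d) \int[mu]_(z in eball x t) ((t^-1 *: (x - z)) 0 j).
have coord j : `|t * G 0 j + eta ^+ n.+1 * (cvec m y k (y i)) 0 j| <= eta ^+ n.+1 * Err.
  pose f (z : borel_rV R d) : R := (t^-1 *: (x - (z : 'rV[R]_d))) 0 j.
  have fE z : f z = t^-1 * (x 0 j - (z : 'rV[R]_d) 0 j) by rewrite /f !mxE.
  pose h : borel_rV R d -> R := f \_ (eball x t : set (borel_rV R d)).
  have hE z : h z = if enorm (x - (z : 'rV[R]_d)) < t then f z else 0.
    rewrite /h patchE; case: (boolP (enorm (x - z) < t)) => hz; [rewrite mem_set //|rewrite memNset //; exact/negP].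
  have mh (D : set (borel_rV R d)) : measurable D -> measurable_fun D h.
    move=> mD; apply/(measurable_restrict _ (eball_measurable _ _) mD).
    rewrite (_ : f = fun z => t^-1 * (x 0 j - (z : 'rV[R]_d) 0 j)); last by apply/funext => z; rewrite fE.
    by apply: measurable_funM => //; apply: measurable_funB => //; apply: coord_measurable.
  have hB z : `|h z| <= 1.
    rewrite hE; case: ltP => hz; last by rewrite normr0.
    rewrite fE normrM (gtr0_norm ti0) -(ler_pM2l t0) mulrA mulfV ?gt_eqF // mul1r mulr1.
    by have := enorm_coord (x - z) j; rewrite !mxE => /le_trans; apply; exact: ltW.
  pose a l := - (eta / t) * (phi k%:R (y l - y i)) 0 j.
  pose e l := (eta / t) * (if enorm (y l - y i) < k%:R + 2 then
      2 + k%:R * (`|enorm (y l - y i) - k%:R| <= 2)%R%:R else 0).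
  have near l : m l * eta ^+ n != 0 -> forall z, A l z -> `|h z - a l| <= e l.
    rewrite mulf_eq0 negb_or => /andP[ml _] z Az.
    pose u : 'rV[R]_d := eta^-1 *: ((z : 'rV[R]_d) - x).
    have hu : h z = - (eta / t) * (phi (t / eta) u) 0 j.
      rewrite hE /phi /u enormZ (gtr0_norm (_ : 0 < eta^-1)) ?invr_gt0 //.
      rewrite (mulrC _ (enorm _)) ltr_pM2r ?invr_gt0 // enormB; case: ifP => _; last by rewrite mxE mulr0.
      by rewrite fE !mxE; field; rewrite !gt_eqF.
    have close : enorm (u - (y l - y i)) <= 1.
      have -> : u - (y l - y i) = (y i - eta^-1 *: x) - (y l - eta^-1 *: z).
        by rewrite /u scalerBr; apply/rowP => q; rewrite !mxE; ring.
      apply: le_trans (enormD _ _) _; rewrite enormN.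
      have := mnz l z ml Az; move: xi; clear; lra.
    have tau : k%:R <= t / eta < k%:R + 1.
      by rewrite ler_pdivlMr // ltr_pdivrMr // tk1 natr1.
    have et : 0 < eta / t by rewrite divr_gt0.
    have nt : `|- (eta / t)| = eta / t by rewrite normrN gtr0_norm.
    rewrite hu /a -mulrBr normrM nt /e.
    rewrite (ler_pM2l et); apply: le_trans (phi_close_cell close tau).
    by have := enorm_coord (phi (t / eta) u - phi k%:R (y l - y i)) j; rewrite !mxE.
  have cell l := integral_near (mA l) (mE l) (mh _ (mA l)) ler01 (fun z _ => hB z) (near l).
  have GE : G 0 j = \sum_l \int[mu]_(z in A l) h z.
    rewrite mxE -[X in Rintegral mu X](setIidr xsub) Rintegral_mkcondr.
    have -> : eball x0 rho = \big[setU/set0]_(l <- index_enum I) A l.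
      rewrite -bigcup_seq; apply/seteqP; split => [z /cov[l Al]|z [l _ Al]]; last exact: sub Al.
      by exists l => //=; rewrite mem_index_enum.
    rewrite /Rintegral integral_bigsetU_EFin //.
    - rewrite (eq_bigr (fun l => (\int[mu]_(z in A l) h z)%:E)) ?sumEFin //.
      by move=> l _; rewrite -(cell l).1.
    - exact: index_enum_uniq.
    - apply/trivIsetP => l l' _ _; exact: dis.
    - apply/measurable_EFinP; apply: mh; apply: bigsetU_measurable => l _; exact: mA.
  have cE : (cvec m y k (y i)) 0 j = \sum_l m l * (phi k%:R (y l - y i)) 0 j.
    by rewrite /cvec summxE; apply: eq_bigr => l _; rewrite mxE.
  have -> : t * G 0 j + eta ^+ n.+1 * (cvec m y k (y i)) 0 j =
      t * \sum_l (\int[mu]_(z in A l) h z - a l * (m l * eta ^+ n)).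
    rewrite sumrB mulrBr -GE; congr (_ + _); rewrite cE !mulr_sumr -sumrN.
    by apply: eq_bigr => l _; rewrite /a exprS; field; rewrite gt_eqF.
  rewrite normrM (gtr0_norm t0).
  apply: le_trans (_ : t * \sum_l e l * (m l * eta ^+ n) <= _).
    rewrite ler_pM2l //; apply: le_trans (ler_norm_sum _ _ _) _.
    by apply: ler_sum => l _; exact: (cell l).2.
  rewrite le_eqVlt; apply/orP; left; apply/eqP; rewrite /Err /errsum !mulr_sumr.
  rewrite [RHS]big_mkcond; apply: eq_bigr => l _; rewrite /e exprS.
  by case: ifP => _; field; rewrite gt_eqF.
have Gle : t * enorm G <= eta ^+ n.+1 * (enorm (cvec m y k (y i)) + d%:R * Err).
  rewrite -{1}(gtr0_norm t0) -enormZ.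
  have -> : t *: G = (t *: G + eta ^+ n.+1 *: cvec m y k (y i)) - eta ^+ n.+1 *: cvec m y k (y i).
    by rewrite addrK.
  have en : 0 < eta ^+ n.+1 by rewrite exprn_gt0.
  apply: le_trans (enormD _ _) _; rewrite enormN enormZ (gtr0_norm en) mulrDr addrC lerD2l.
  rewrite mulrCA; apply: enorm_le_coord; first by rewrite mulr_ge0 // ltW.
  by move=> j; have := coord j; rewrite !mxE.
have CE : Cn n mu x t = (t ^+ n)^-1 * enorm G by [].
have C0 : 0 <= Cn n mu x t by rewrite CE mulr_ge0 ?enorm_ge0 // invr_ge0 exprn_ge0 // ltW.
set X := enorm (cvec _ _ _ _) in Gle *; set Y := d%:R * Err in Gle *.
have X0 : 0 <= X by apply: enorm_ge0.
have Y0 : 0 <= Y by rewrite mulr_ge0.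
have Cle : Cn n mu x t <= k%:R ^- n.+1 * (X + Y).
  have tn : 0 < t ^+ n.+1 by rewrite exprn_gt0.
  have kn : 0 < k%:R ^+ n.+1 :> R by rewrite exprn_gt0.
  have step : t ^+ n.+1 * Cn n mu x t <= eta ^+ n.+1 * (X + Y).
    by rewrite CE exprS -mulrA mulVKf ?expf_neq0 ?gt_eqF.
  rewrite -(ler_pM2l kn) mulVKf ?gt_eqF // -(ler_pM2l (exprn_gt0 n.+1 eta0)).
  apply: le_trans step; rewrite mulrA ler_wpM2r // -exprMn mulrC.
  by rewrite lerXn2r ?nnegrE ?mulr_ge0 ?(ltW eta0) ?(ltW t0) // ltW.
rewrite (ger0_norm C0).
have XY : (X + Y) ^+ 2 <= 2 * (X ^+ 2 + Y ^+ 2).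
  by have := sqr_ge0 (X - Y); rewrite !sqrrD sqrrN; clear; lra.
apply: le_trans (_ : (k%:R ^- n.+1 * (X + Y)) ^+ 2 / (k%:R * eta) <= _).
  apply: ler_pM; rewrite ?sqr_ge0 ?invr_ge0 ?(ltW t0) //.
    by rewrite lerXn2r ?nnegrE // (le_trans C0 Cle).
  by rewrite lef_pV2 ?posrE ?mulr_gt0.
have p : 0 <= (k%:R ^+ (2 * n + 3) * eta)^-1 by rewrite invr_ge0 mulr_ge0 ?exprn_ge0 // ltW.
have := ler_wpM2r p XY.
have -> : 2 / (k%:R ^+ (2 * n + 3) * eta) * (X ^+ 2 + Y ^+ 2) =
   2 * (X ^+ 2 + Y ^+ 2) * (k%:R ^+ (2 * n + 3) * eta)^-1 by ring.
apply: le_trans; rewrite le_eqVlt; apply/orP; left; apply/eqP.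
rewrite exprMn exprVn -exprM (_ : (2 * n + 3 = n.+1 * 2 + 1)%N); last by clear; lia.
rewrite exprD expr1; move: (exprn_gt0 (n.+1 * 2) kR) => q.
by field; rewrite !gt_eqF.
Qed.

Lemma sum_dyadic_blocks (V : nmodType) (F : nat -> V) (B : nat) :
  \sum_(1 <= k < 2 ^ B) F k = \sum_(0 <= j < B) \sum_(2 ^ j <= k < 2 ^ j.+1) F k.
Proof.
elim: B => [|B IH]; first by rewrite expn0 !big_geq.
rewrite big_nat_recr //= -IH -big_cat_nat //; first by rewrite expn_gt0.
by rewrite leq_exp2l.
Qed.

(** The displacement is the constant 2, so the error of block [j] decays like [2 ^- j]. *)
Lemma err_tail (R : realType) n d (I : finType) (m : I -> R) (y : I -> 'rV[R]_d) (C1 : R) x B :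
  (forall i, 0 <= m i) -> upper_regular n m y C1 -> 0 <= C1 ->
  \sum_(0 <= j < B) block_weight R n j * \sum_(2 ^ j <= k < 2 ^ j.+1)
    errsum m (fun l => enorm (y l - x) < k%:R + 2) (fun=> 2) (fun l => enorm (y l - x)) k ^+ 2
  <= C1 ^+ 2 * 2 ^+ (4 * n) * 112.
Proof.
move=> m0 up C10; pose E : R := C1 ^+ 2 * 2 ^+ (4 * n) * 56.
have E0 : 0 <= E by rewrite /E !mulr_ge0 ?exprn_ge0.
apply: le_trans (_ : \sum_(0 <= j < B) E * 2^-1 ^+ j <= _).
  apply: ler_sum => j _; pose P i := enorm (y i - x) <= 2 ^+ (j + 2).
  have P2 : 2 ^+ (j + 2) = 4 * 2 ^+ j :> R by rewrite exprD; ring.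
  have j1 : 1 <= 2 ^+ j :> R by rewrite exprn_ege1 // ler1n.
  have h2 := @err_block R n d I m y m0 C1 2 2 j x P (fun=> 2) (fun i => enorm (y i - x)) up (fun i Pi => Pi).
  have {}h2 := h2 (fun i => ler1n R 2).
  apply: le_trans (_ : block_weight R n j * \sum_(2 ^ j <= k < 2 ^ j.+1)
     errsum m P (fun=> 2) (fun l => enorm (y l - x)) k ^+ 2 <= _).
    rewrite ler_wpM2l ?nk_ge0 //; apply: ler_sum_nat => k /andP[_ hk].
    rewrite lerXn2r ?nnegrE ?errsum_ge0 // /errsum big_mkcond [leRHS]big_mkcond /=.
    apply: ler_sum => i _; case: ifP => h; last by case: ifP => // _; rewrite mulr_ge0 // addr_ge0 ?mulr_ge0.
    rewrite ifT // /P P2; have : k%:R + 1 <= 2 ^+ j.+1 :> R by rewrite natr1 -natrX ler_nat.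
    by rewrite exprS; move: h j1; clear; lra.
  apply: le_trans (h2 _) _; first by move=> _ _; move: j1; clear; lra.
  rewrite -mulr_suml; have up' := up x (j + 2)%N.
  have c0 : 0 <= C1 * 2 ^+ (2 * n) * (2 + 2) * 7 * 2^-1 ^+ (j * n.+1) :> R.
    by rewrite !mulr_ge0 ?exprn_ge0 ?invr_ge0.
  have := ler_wpM2l c0 (ler_wpM2r (ler0n R 2) up').
  move/le_trans; apply; rewrite le_eqVlt; apply/orP; left; apply/eqP.
  have e : 2^-1 ^+ (j * n.+1) * 2 ^+ (j * n) = 2^-1 ^+ j :> R.
    by rewrite mulnS exprD -mulrA -exprMn mulVf // expr1n mulr1.
  have e4 : 2 ^+ (4 * n) = 2 ^+ (2 * n) * 2 ^+ (2 * n) :> R.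
    by rewrite -exprD -mulnDl.
  rewrite mulnDl exprD -e /E e4; ring.
rewrite -mulr_sumr.
have h : \sum_(0 <= j < B) 2^-1 ^+ j <= 2 :> R.
  have : \sum_(0 <= j < B) 2^-1 ^+ j + 2 * 2^-1 ^+ B = 2 :> R.
    elim: (B) => [|b IH]; first by rewrite big_geq // add0r expr0 mulr1.
    by rewrite big_nat_recr //= -[RHS]IH exprS; field.
  have : 0 <= 2^-1 ^+ B :> R by rewrite exprn_ge0 // invr_ge0.
  lra.
by have := ler_wpM2l E0 h; rewrite /E; lra.
Qed.

(** The square function is dominated by step functions, constant on cells in [x] and on intervals of
    length [eta] in [t], whose measurability is clear. The domination holds for [t >= rB / 2 ^ B]
    and on the support; [K] does not depend on [B]. *)
Lemma scale_bound (R : realType) n d (mu : {measure set (borel_rV R d) -> \bar R}) :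
  (0 < n)%N -> (0 < d)%N -> ADR n mu -> uniformly_rectifiable n mu ->
  exists2 K : R, 0 < K & forall (x0 : 'rV[R]_d) (rB : R) (B : nat), spt mu x0 -> 0 < rB ->
  exists U : borel_rV R d -> \bar R,
  [/\ measurable_fun setT U, forall x, (0 <= U x)%E,
      (\int[mu]_(x in eball x0 rB) U x <= (K * rB ^+ n)%:E)%E &
      forall x, eball x0 rB x -> spt mu x -> exists s : R -> \bar R,
      [/\ measurable_fun setT s, forall t, (0 <= s t)%E,
          (\int[lebesgue_measure]_(t in `]0%R, rB[) s t <= U x)%E &
          forall t, 0 < t < rB -> rB / 2 ^+ B <= t -> ((`|Cn n mu x t| ^+ 2 / t)%:E <= s t)%E]].
Proof.
move=> n0 d0 adr [_ [theta [M [th0 M0 hUR]]]].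
have [C1 C10 hdisc] := discretize d0 adr.
have nR : 0 < n%:R :> R by rewrite ltr0n.
have L0 : 0 <= d%:R * (M * n%:R) :> R by rewrite !mulr_ge0 // ltW.
have C20 : 0 <= 2^-1 + M * n%:R by rewrite addr_ge0 ?invr_ge0 ?mulr_ge0 // ltW.
have th1 : 0 < theta / 2 ^+ n by rewrite divr_gt0 ?exprn_gt0.
have [Cd Cd0 hCd] := @discrete_square_bound R n d _ C1 _ _ n0 L0 C10 C20 th1.
pose Ke : R := 2 * d%:R ^+ 2 * (C1 ^+ 2 * 2 ^+ (4 * n) * 112).
have Ke0 : 0 <= Ke.
  by rewrite /Ke; apply: mulr_ge0; rewrite !mulr_ge0 ?exprn_ge0 ?ler0n // ltW.
exists (2 ^+ n * (2 * Cd + Ke * C1)).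
  by rewrite mulr_gt0 ?exprn_gt0 // ltr_pwDl ?mulr_gt0 // mulr_ge0 // ltW.
move=> x0 rB B sx0 rB0; pose eta := rB / 2 ^+ B.
have P0 : 0 < 2 ^+ B :> R by rewrite exprn_gt0.
have P1 : 1 <= 2 ^+ B :> R by rewrite exprn_ege1 // ler1n.
have eta0 : 0 < eta by rewrite divr_gt0.
have rBE : rB = 2 ^+ B * eta by rewrite /eta mulrC divfK // gt_eqF.
(* The radius [8 * rB] contains the balls of radius up to [2 * rB] around atoms within [4 * rB] of
   the centre, where [discrete_square_bound] asks for Lipschitz maps. *)
have [I [m [y [A [[mA dis sub cov] [m0 mE up] mnz close sy]]]]] :=
  hdisc x0 eta (8 * rB) sx0 eta0 (mulr_gt0 (ltr0n R 8) rB0).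
pose z0 := eta^-1 *: x0.
have en0 : eta * eta^-1 = 1 by rewrite mulfV // gt_eqF.
have en0' : eta^-1 * eta = 1 by rewrite mulVf // gt_eqF.
(* Twice the rescaled ball, so that the atom of the cell of any support point of the ball is
   included. *)
pose N i := enorm (y i - z0) <= 2 ^+ B.+1.
have main : \sum_(i | N i) m i * sqfun n m y 0 B.+1 (y i) <= Cd * 2 ^+ (B.+1 * n).
  apply: hCd => // i b hi hb.
  apply: (@ur_lattice R n d mu theta M eta (8 * rB) x0 I m y A i b) => //.
  move=> z; rewrite /eball /= => hz; apply: le_lt_trans (enorm_triangle (eta *: y i) _ _) _.
  have h1 : enorm (x0 - eta *: y i) <= eta * (4 * 2 ^+ B).
    have -> : x0 - eta *: y i = - (eta *: (y i - z0)).
      by rewrite /z0 scalerBr scalerA en0 scale1r opprB.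
    by rewrite enormN enormZ (gtr0_norm eta0) ler_pM2l //; move: hi; rewrite !exprS; clear; lra.
  have h2 : 2 ^+ b * eta / 2 <= eta * (2 * 2 ^+ B).
    have : 2 ^+ b <= 2 ^+ B.+2 :> R by rewrite ler_eXn2l ?ltr1n.
    by move/(ler_wpM2r (ltW eta0)); rewrite !exprS; clear; lra.
  by move: h1 h2 hz; rewrite rBE; have := mulr_gt0 P0 eta0; clear; lra.
pose a i : R := if N i then 2 * sqfun n m y 0 B (y i) + Ke else 0.
have a0 i : 0 <= a i.
  by rewrite /a; case: ifP => // _; apply: addr_ge0 Ke0; apply: mulr_ge0 => //; exact: sqfun_ge0.
pose U (x : borel_rV R d) : \bar R := (\sum_(i <- index_enum I) (a i)%:E * (\1_(A i) x)%:E)%E.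
have mind i : measurable_fun setT (fun x : borel_rV R d => (\1_(A i) x : R)%:E).
  by apply/measurable_EFinP; apply: measurable_indic.
have mterm i : measurable_fun setT (fun x : borel_rV R d => ((a i)%:E * (\1_(A i) x)%:E)%E).
  exact: measurable_funeM.
have U0 x : (0 <= U x)%E by apply: sume_ge0 => i _; rewrite mule_ge0 ?lee_fin.
exists U; split => //.
- exact: emeasurable_sum.
- rewrite ge0_integral_sum //; first last.
  + by move=> i x _; rewrite mule_ge0 ?lee_fin.
  + by move=> i; apply: measurable_funTS.
  + exact: eball_measurable.
  apply: le_trans (_ : \sum_(i <- index_enum I) (a i * (m i * eta ^+ n))%:E <= _)%E.
    apply: lee_sum => i _; rewrite ge0_integralZl_EFin //.
    + rewrite EFinM lee_pmul ?lee_fin ?integral_ge0 //.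
      rewrite (integral_indic mu (eball_measurable x0 rB) (mA i)).
      apply: le_trans (_ : mu (A i) <= _)%E; last by rewrite mE.
      apply: measure_mono; [|exact: mA|by move=> z []].
      by apply: measurableI; [exact: mA|exact: eball_measurable].
    + exact: eball_measurable.
    + exact: measurable_funTS.
  rewrite sumEFin lee_fin.
  have -> : \sum_(i <- index_enum I) a i * (m i * eta ^+ n) =
      eta ^+ n * (2 * \sum_(i | N i) m i * sqfun n m y 0 B (y i) + Ke * \sum_(i | N i) m i).
    rewrite mulrDr !mulr_sumr -big_split [RHS]big_mkcond /=; apply: eq_bigr => i _.
    by rewrite /a; case: ifP => _; ring.
  have s1 : \sum_(i | N i) m i * sqfun n m y 0 B (y i) <= Cd * 2 ^+ (B.+1 * n).
    apply: le_trans main; apply: ler_sum => i _; rewrite ler_wpM2l //.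
    have hh : (0 <= B <= B.+1)%N by rewrite leq0n leqnSn.
    by rewrite (sqfun_cat n m y _ hh) lerDl sqfun_ge0.
  have s2 := up z0 B.+1.
  have rn : rB ^+ n = 2 ^+ (B * n) * eta ^+ n by rewrite rBE exprMn exprM.
  rewrite rn mulSn exprD in s1 s2 *.
  have e0 : 0 <= eta ^+ n by rewrite exprn_ge0 // ltW.
  have := ler_wpM2l Ke0 s2; have s1' := s1; move=> s2'.
  have : 2 * (\sum_(i | N i) m i * sqfun n m y 0 B (y i)) + Ke * (\sum_(i | N i) m i) <=
     2 * (Cd * (2 ^+ n * 2 ^+ (B * n))) + Ke * (C1 * (2 ^+ n * 2 ^+ (B * n))).
    by apply: lerD => //; rewrite ler_wpM2l.
  move/(ler_wpM2l e0)/le_trans; apply; rewrite le_eqVlt; apply/orP; left; apply/eqP; ring.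
move=> x xb sx; have xdom : eball x0 (8 * rB) x by move: xb; rewrite /eball /=; move: rB0; clear; lra.
have [i Aix] := cov x xdom; have hi := close i x x sx Aix Aix.
have Ni : N i.
  rewrite /N; apply: le_trans (enorm_triangle (eta^-1 *: x) _ _) _.
  have : enorm (eta^-1 *: x - z0) <= 2 ^+ B.
    rewrite /z0 -scalerBr enormZ gtr0_norm ?invr_gt0 // ler_pdivrMl // mulrC -rBE enormB.
    exact/ltW/xb.
  by rewrite exprS; move: hi P1; clear; lra.
pose Err k := errsum m (fun l => enorm (y l - y i) < k%:R + 2)
       (fun=> 2) (fun l => enorm (y l - y i)) k.
pose w (k : nat) : R := 2 / (k%:R ^+ (2 * n + 3) * eta) *
    (enorm (cvec m y k (y i)) ^+ 2 + (d%:R * Err k) ^+ 2).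
pose J k : set R := `[k%:R * eta, k.+1%:R * eta[%classic.
have w0 k : 0 <= w k.
  rewrite /w; apply: mulr_ge0; last by rewrite addr_ge0 ?sqr_ge0.
  by rewrite divr_ge0 // mulr_ge0 ?exprn_ge0 // ltW.
pose s (t : R) : \bar R := (\sum_(k <- index_iota 1 (2 ^ B)) (w k)%:E * (\1_(J k) t)%:E)%E.
have mJ k : measurable (J k) by apply: measurable_itv.
have mindJ k : measurable_fun setT (fun t : R => (\1_(J k) t : R)%:E).
  by apply/measurable_EFinP; apply: measurable_indic.
have mtJ k : measurable_fun setT (fun t : R => ((w k)%:E * (\1_(J k) t)%:E)%E).
  exact: measurable_funeM.
exists s; split.
- exact: emeasurable_sum.
- by move=> t; apply: sume_ge0 => k _; rewrite mule_ge0 ?lee_fin.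
- rewrite ge0_integral_sum //; first last.
  + by move=> k t _; rewrite mule_ge0 ?lee_fin.
  + move=> k; exact: (measurable_funTS (mtJ k)).
  have UA : ((a i)%:E <= U x)%E.
    rewrite /U (bigD1_seq i) ?mem_index_enum ?index_enum_uniq //=.
    rewrite indicE mem_set // mule1 leeDl //.
    by apply: sume_ge0 => l _; rewrite mule_ge0 ?lee_fin.
  apply: le_trans UA.
  apply: le_trans (_ : \sum_(k <- index_iota 1 (2 ^ B)) (w k * eta)%:E <= _)%E.
    apply: lee_sum => k _; rewrite ge0_integralZl_EFin //.
    + rewrite (EFinM (w k)) lee_pmul ?lee_fin ?integral_ge0 //.
      rewrite integral_indic; [|exact: measurable_itv|exact: mJ].
      apply: le_trans (_ : lebesgue_measure (J k) <= _)%E.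
        by apply: measureIl; [exact: mJ|exact: measurable_itv].
      have lt : k%:R * eta < k.+1%:R * eta by rewrite ltr_pM2r // ltr_nat.
      rewrite /J lebesgue_measure_itv /= lte_fin lt -EFinD lee_fin -mulrBl -natr1.
      by rewrite addrAC subrr add0r mul1r.
    + by apply/measurable_EFinP; apply: measurable_indic; exact: mJ.
  rewrite sumEFin lee_fin /a Ni sum_dyadic_blocks.
  have tail := err_tail (y i) B m0 up (ltW C10).
  have -> : Ke = 2 * d%:R ^+ 2 * (C1 ^+ 2 * 2 ^+ (4 * n) * 112) by [].
  apply: le_trans (_ : 2 * sqfun n m y 0 B (y i) + 2 * d%:R ^+ 2 *
     \sum_(0 <= j < B) block_weight R n j * \sum_(2 ^ j <= k < 2 ^ j.+1) Err k ^+ 2 <= _); last first.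
    by rewrite lerD2l ler_wpM2l ?mulr_ge0 ?exprn_ge0.
  rewrite /sqfun !mulr_sumr -big_split /=; apply: ler_sum => j _.
  rewrite /sqfun_block (mulrCA 2) (mulrCA (2 * _)) -mulrDr !mulr_sumr -big_split /= mulr_sumr.
  apply: ler_sum_nat => k /andP[jk _].
  have kR : 2 ^+ j <= k%:R :> R by rewrite -natrX ler_nat.
  have jp : 0 < 2 ^+ j :> R by rewrite exprn_gt0.
  have kp : 0 < k%:R :> R by apply: lt_le_trans kR.
  have -> : w k * eta = (k%:R ^+ (2 * n + 3))^-1 *
      (2 * enorm (cvec m y k (y i)) ^+ 2 + 2 * d%:R ^+ 2 * Err k ^+ 2).
    by rewrite /w; field; rewrite !expf_neq0 ?gt_eqF.
  apply: ler_wpM2r.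
    apply: addr_ge0; first exact: mulr_ge0 (ler0n _ 2) (sqr_ge0 _).
    exact: mulr_ge0 (mulr_ge0 (ler0n _ 2) (sqr_ge0 _)) (sqr_ge0 _).
  have -> : block_weight R n j = ((2 ^+ j) ^+ (2 * n + 3))^-1 by rewrite /block_weight exprM !exprVn.
  by rewrite lef_pV2 ?posrE ?exprn_gt0 // lerXn2r ?nnegrE // ltW.
- move=> t /andP[t0 trB] te; have et0 : 0 <= t / eta by rewrite divr_ge0 // ltW.
  have /andP[k1 k2] := truncn_itv et0; set k := Num.truncn _ in k1 k2.
  rewrite ler_pdivlMr // in k1; rewrite ltr_pdivrMr // in k2.
  have k0 : (0 < k)%N.
    rewrite -ltnS -(ltr_nat R) -(ltr_pM2r eta0); apply: le_lt_trans k2.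
    by rewrite mul1r.
  have kB : (k < 2 ^ B)%N.
    rewrite -(ltr_nat R) natrX -(ltr_pM2r eta0); apply: le_lt_trans k1 _.
    by rewrite -rBE.
  have xsub : eball x t `<=` eball x0 (8 * rB).
    move=> z; rewrite /eball /= => hz; apply: le_lt_trans (enorm_triangle x _ _) _.
    by move: xb hz; rewrite /eball /=; move: rB0 trB; clear; lra.
  have tk : k%:R * eta <= t < k.+1%:R * eta by rewrite k1 k2.
  have := Cn_pointwise eta0 mA dis sub cov m0 mE mnz hi xsub k0 tk.
  rewrite -lee_fin => /le_trans; apply.
  have kin : k \in index_iota 1 (2 ^ B) by rewrite mem_index_iota k0.
  rewrite /s (bigD1_seq k) ?iota_uniq //= indicE mem_set ?mule1 ?leeDl //.
    by apply: sume_ge0 => l _; rewrite mule_ge0 ?lee_fin.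
Qed.

Theorem theorem1p4 (R : realType) (n d : nat) (hnd : (1 <= n <= d - 1)%N)
    (mu : {measure set (borel_rV R d) -> \bar R})
    (hADR : ADR n mu) (hUR : uniformly_rectifiable n mu) :
  exists2 C : R, 0 < C &
    forall (x0 : 'rV[R]_d) (rB : R), spt mu x0 -> 0 < rB ->
      (\int[mu]_(x in eball x0 rB)
         \int[lebesgue_measure]_(t in `]0%R, rB[)
            (`|Cn n mu x t| ^+ 2 / t)%:E
       <= (C * rB ^+ n)%:E)%E.
Proof.
have n0 : (0 < n)%N by case/andP: hnd.
have d0 : (0 < d)%N by move: hnd; clear; lia.
have [K K0 hK] := scale_bound n0 d0 hADR hUR.
exists K => // x0 rB sx0 rB0.
have [U hU] := choice (fun B => hK x0 rB B sx0 rB0).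
have mU B : measurable_fun (eball x0 rB : set (borel_rV R d)) (U B).
  by have [mUB _ _ _] := hU B; apply: measurable_funTS.
have U0 B x : (0 <= U B x)%E by have [_ h _ _] := hU B.
have h0 x t : `]0, rB[%classic t -> (0 <= (`|Cn n mu x t| ^+ 2 / t)%:E)%E.
  by rewrite /= in_itv /= => /andP[t0 _]; rewrite lee_fin divr_ge0 ?sqr_ge0 // ltW.
(* Limit in [x]: the majorants dominate on the support only, and its complement is the exceptional
   null set. *)
apply: le_trans (@fatou_le _ _ R mu _ (~` spt mu) U _ _ _ _ mU _ _ _) _.
- exact: eball_measurable.
- by apply: measurableC; apply: closed_borel; exact: spt_closed.
- by apply: spt_null; case: hADR.
- by move=> B x _; apply: U0.
- by move=> x _; apply: integral_ge0 => t; apply: h0.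
- move=> x xb /contrapT sx.
  have ex B : exists s : R -> \bar R, [/\ measurable_fun setT s, forall t, (0 <= s t)%E,
      (\int[lebesgue_measure]_(t in `]0%R, rB[) s t <= U B x)%E &
      forall t, 0 < t < rB -> rB / 2 ^+ B <= t -> ((`|Cn n mu x t| ^+ 2 / t)%:E <= s t)%E].
    by have [_ _ _ h] := hU B; apply: h.
  have [s hs] := choice ex.
  (* Limit in [t]: the majorant [s B] is valid once [rB / 2 ^ B <= t], hence eventually for each
     [t > 0]. *)
  apply: le_trans (@fatou_le _ _ R lebesgue_measure _ set0 s _ _ _ _ _ _ _ _) _.
  + exact: measurable_itv.
  + exact: measurable0.
  + exact: measure0.
  + by move=> B; have [ms _ _ _] := hs B; apply: measurable_funTS.
  + by move=> B t _; have [_ h _ _] := hs B.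
  + by move=> t; apply: h0.
  + move=> t; rewrite /= in_itv /= => tB _; have /andP[t0 _] := tB.
    have [B0 hB0] := pow2_above (rB / t).
    apply: (@limn_einf_ge _ _ _ B0) => B B0B; have [_ _ _ h] := hs B; apply: h => //.
    rewrite ler_pdivrMr ?exprn_gt0 // mulrC -ler_pdivrMr //; apply: le_trans hB0 _.
    by rewrite ler_eXn2l ?ltr1n.
  by apply: limn_einf_le => B; have [_ _ h _] := hs B.
by apply: limn_einf_le_cst => B; have [_ _ h _] := hU B.
Qed.
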